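(* Let $N\ge 1$, let $\Omega\subset\mathbb{R}^N$ be a bounded open domain with $C^1$ boundary and outward unit normal $\nu$, and let $g^\pm\in C^1(\overline\Omega)$ with $g^-(x)<g^+(x)$ for $x\in\overline\Omega$. Let $F\in C(\mathcal{S}(N+1)\times\mathbb{R}^{N+1}\times\mathbb{R}\times\overline\Omega\times[-1,1],\mathbb{R})$ and suppose there is a constant $\alpha>0$ such that, for every $(p,x,y)\in\mathbb{R}^{N+1}\times\overline\Omega\times[-1,1]$, $F(X,p,r,x,y)-\alpha r\le F(Y,p,s,x,y)-\alpha s$ whenever $X,Y\in\mathcal{S}(N+1)$, $r,s\in\mathbb{R}$, $X\ge Y$ and $r\le s$. Let $\gamma_1^\pm\in C(\overline\Omega\times[-1,1],\mathbb{R}^N)$, $\beta^\pm\in C(\overline\Omega\times[-1,1],\mathbb{R})$ and put $\gamma^+=(\gamma_1^+,1)$, $\gamma^-=(\gamma_1^-,-1)$. Assume that there are $\gamma_o\in C^1(\overline\Omega,\mathbb{R}^N)$, $\beta_o\in C^1(\overline\Omega,\mathbb{R})$ with $$\gamma_1^+(x,0)=-\gamma_1^-(x,0)=\gamma_o(x),\qquad \beta^+(x,0)=-\beta^-(x,0)=\beta_o(x)\qquad (x\in\overline\Omega),$$ and $k^\pm\in C(\overline\Omega,\mathbb{R}^N)$, $l^\pm\in C(\overline\Omega,\mathbb{R})$ such that, as $y\to0$, uniformly in $x\in\overline\Omega$, $$\gamma_1^\pm(x,y)=\pm\gamma_o(x)+k^\pm(x)y+o(|y|),\qquad \beta^\pm(x,y)=\pm\beta_o(x)+l^\pm(x)y+o(|y|).$$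 Then there exist positive constants $\varepsilon_1<\varepsilon_0$ and $C_0$ such that for each $0<\varepsilon<\varepsilon_1$ there is a viscosity solution $u^\varepsilon$ of $$\begin{cases}F(D^2u,Du,u,x,y)=0&\text{in }\Omega_\varepsilon,\\ \gamma^+\cdot Du=\beta^+&\text{on }\partial_{\mathrm T}\Omega_\varepsilon,\\ \gamma^-\cdot Du=\beta^-&\text{on }\partial_{\mathrm B}\Omega_\varepsilon,\\ \nu\cdot D_xu=0&\text{on }\partial_{\mathrm L}\Omega_\varepsilon,\end{cases}$$ and furthermore, for each $0<\varepsilon<\varepsilon_1$, any viscosity solution $u^\varepsilon$ of this problem satisfies $\sup_{\overline{\Omega_\varepsilon}}|u^\varepsilon|\le C_0$.
   Context: $\mathcal{S}(k)$ is the space of real symmetric $k\times k$ matrices with the semidefinite order. For compact $K\subset\mathbb{R}^j$, $C^i(K,\mathbb{R}^k)$ denotes restrictions to $K$ of $C^i$ functions on $\mathbb{R}^j$. For $\varepsilon>0$: $\Omega_\varepsilon=\{(x,y)\in\Omega\times\mathbb{R}: \varepsilon g^-(x)<y<\varepsilon g^+(x)\}$, $\partial_{\mathrm T}\Omega_\varepsilon=\{(x,y): x\in\overline\Omega,\ y=\varepsilon g^+(x)\}$, $\partial_{\mathrm B}\Omega_\varepsilon=\{(x,y): x\in\overline\Omega,\ y=\varepsilon g^-(x)\}$, $\partial_{\mathrm L}\Omega_\varepsilon=\{(x,y): x\in\partial\Omega,\ \varepsilon g^-(x)\le y\le\varepsilon g^+(x)\}$. The constant $\varepsilon_0>0$ is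 fixed so small that for all $0<\varepsilon<\varepsilon_0$: $\overline{\Omega_\varepsilon}\subset\overline\Omega\times[-1,1]$, $1-\varepsilon Dg^+\cdot\gamma_1^+>0$ on $\partial_{\mathrm T}\Omega_\varepsilon$, and $1+\varepsilon Dg^-\cdot\gamma_1^->0$ on $\partial_{\mathrm B}\Omega_\varepsilon$ (obliqueness of $\gamma^\pm$). Viscosity solutions. A bounded function $u$ on $\overline{\Omega_\varepsilon}$ is a viscosity subsolution if, with $v$ its upper semicontinuous envelope on $\overline{\Omega_\varepsilon}$, whenever $\phi\in C^2(\overline{\Omega_\varepsilon})$ and $v-\phi$ attains its maximum over $\overline{\Omega_\varepsilon}$ at $\hat z$, at least one of the following holds: (a) $F(D^2\phi(\hat z),D\phi(\hat z),v(\hat z),\hat z)\le0$; (b) $\hat z=(\hat x,\hat y)\in\partial_{\mathrm L}\Omega_\varepsilon$ and $\nu(\hat x)\cdot D_x\phi(\hat z)\le0$; (c) $\hat z\in\partial_{\mathrm T}\Omega_\varepsilon$ and $\gamma^+(\hat z)\cdot D\phi(\hat z)\le\beta^+(\hat z)$; (d) $\hat z\in\partial_{\mathrm B}\Omega_\varepsilon$ and $\gamma^-(\hat z)\cdot D\phi(\hat z)\le\beta^-(\hat z)$. Viscosity supersolutions are defined by replacing maximum by minimum, $\le$ by $\ge$, and the upper by the lower semicontinuous envelope. A viscosity solution is a bounded function that is both a viscosity subsolution and supersolution (continuity is not required). *)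

(* Defs.v *)
(* A point of R^(N+1) is a row vector z : 'rV[R]_(N + 1); its first N
   coordinates are [xpart z] and its last coordinate is [ypart z].  The norm of
   'rV[R]_n in the library is the max norm; it is used for topology only, and
   Euclidean notions go through [dot]. *)
From HB Require Import structures.
From mathcomp Require Import all_boot all_order all_algebra sesquilinear.
From mathcomp Require Import all_classical all_reals all_analysis.
Set Implicit Arguments.
Unset Strict Implicit.
Unset Printing Implicit Defensive.
Import Order.TTheory GRing.Theory Num.Theory.
Import numFieldNormedType.Exports.
Local Open Scope classical_set_scope.
Local Open Scope ring_scope.

Section Calculus.
Context {R : realType}.

Definition dot n (u v : 'rV[R]_n) : R := \sum_i u 0 i * v 0 i.

Definition partial n (V : normedModType R) (i : 'I_n) (f : 'rV[R]_n -> V) :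
    'rV[R]_n -> V :=
  fun x => 'D_(delta_mx 0 i) f x.

(* For compact K, the space C^i(K, R^k) consists of the restrictions to K of
   C^i functions on the whole space.  Its elements are represented below by
   such a whole-space function; the sets K that occur are closures of open
   sets, so the derivatives up to order i on K do not depend on the choice. *)
Definition C1 n (V : normedModType R) (f : 'rV[R]_n -> V) : Prop :=
  (forall x, differentiable f x) /\ (forall i, continuous (partial i f)).

Definition C2 n (f : 'rV[R]_n -> R) : Prop :=
  C1 f /\ forall i, C1 (partial i f).

Definition grad n (f : 'rV[R]_n -> R) (x : 'rV[R]_n) : 'rV[R]_n :=
  \row_i partial i f x.

Definition hess n (f : 'rV[R]_n -> R) (x : 'rV[R]_n) : 'M[R]_n :=
  \matrix_(i, j) partial i (partial j f) x.

Definition psd_le n (Y X : 'M[R]_n) : Prop :=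
  forall v : 'rV[R]_n, dot (v *m Y) v <= dot (v *m X) v.

Definition boundary n (A : set 'rV[R]_n) : set 'rV[R]_n :=
  closure A `\` interior A.

(* [rho] is a C^1 function with nonvanishing gradient at [x] such that A
   coincides with {rho < 0} near [x]; [grad rho x] then points out of A. *)
Definition local_defining n (A : set 'rV[R]_n) (x : 'rV[R]_n)
    (rho : 'rV[R]_n -> R) : Prop :=
  [/\ C1 rho, grad rho x != 0 & \forall z \near x, A z <-> rho z < 0].

Definition C1_boundary n (A : set 'rV[R]_n) : Prop :=
  forall x, boundary A x -> exists rho, local_defining A x rho.

Definition outward_unit_normal n (A : set 'rV[R]_n)
    (nu : 'rV[R]_n -> 'rV[R]_n) : Prop :=
  forall x rho, boundary A x -> local_defining A x rho ->
    nu x = (Num.sqrt (dot (grad rho x) (grad rho x)))^-1 *: grad rho x.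

(* Semicontinuous envelopes relative to K.  The neighbourhoods are not
   punctured, so u z itself is taken into account; [fine] is harmless because
   the envelopes are used for u bounded on K and at points of K only. *)
Definition usc_env n (K : set 'rV[R]_n) (u : 'rV[R]_n -> R)
    (z : 'rV[R]_n) : R :=
  fine (limf_esup (EFin \o u) (within K (nbhs z))).

Definition lsc_env n (K : set 'rV[R]_n) (u : 'rV[R]_n -> R)
    (z : 'rV[R]_n) : R :=
  fine (limf_einf (EFin \o u) (within K (nbhs z))).

(* [\forall y \near 0] is taken inside R, hence the restriction on y. *)
Definition uniform_first_order n (V : normedModType R) (K : set 'rV[R]_n)
    (f : 'rV[R]_n -> R -> V) (f0 f1 : 'rV[R]_n -> V) : Prop :=
  forall e : R, 0 < e ->
    \forall y \near (0 : R), y \in `[-1, 1] ->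
      forall x, K x -> `|f x y - (f0 x + y *: f1 x)| <= e * `|y|.

End Calculus.

Section ThinDomain.
Context {R : realType} {N : nat}.

Definition xpart (z : 'rV[R]_(N + 1)) : 'rV[R]_N := lsubmx z.
Definition ypart (z : 'rV[R]_(N + 1)) : R := rsubmx z 0 0.

Variables (Omega : set 'rV[R]_N) (gp gm : 'rV[R]_N -> R).

Definition thin (eps : R) : set 'rV[R]_(N + 1) :=
  [set z | Omega (xpart z) /\
           eps * gm (xpart z) < ypart z < eps * gp (xpart z)].

Definition thin_top (eps : R) : set 'rV[R]_(N + 1) :=
  [set z | closure Omega (xpart z) /\ ypart z = eps * gp (xpart z)].

Definition thin_bottom (eps : R) : set 'rV[R]_(N + 1) :=
  [set z | closure Omega (xpart z) /\ ypart z = eps * gm (xpart z)].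

Definition thin_lateral (eps : R) : set 'rV[R]_(N + 1) :=
  [set z | boundary Omega (xpart z) /\
           eps * gm (xpart z) <= ypart z <= eps * gp (xpart z)].

Variables (gam1p gam1m : 'rV[R]_N -> R -> 'rV[R]_N).

Definition gammap (z : 'rV[R]_(N + 1)) : 'rV[R]_(N + 1) :=
  row_mx (gam1p (xpart z) (ypart z)) (const_mx 1).

Definition gammam (z : 'rV[R]_(N + 1)) : 'rV[R]_(N + 1) :=
  row_mx (gam1m (xpart z) (ypart z)) (const_mx (-1)).

Definition admissible_eps0 (eps0 : R) : Prop :=
  forall eps : R, 0 < eps < eps0 ->
  [/\ forall z, closure (thin eps) z ->
        closure Omega (xpart z) /\ ypart z \in `[-1, 1],
      forall z, thin_top eps z ->
        0 < 1 - eps * dot (grad gp (xpart z)) (gam1p (xpart z) (ypart z)) &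
      forall z, thin_bottom eps z ->
        0 < 1 + eps * dot (grad gm (xpart z)) (gam1m (xpart z) (ypart z))].

Variables (nu : 'rV[R]_N -> 'rV[R]_N) (betap betam : 'rV[R]_N -> R -> R).
Variable F : 'M[R]_(N + 1) -> 'rV[R]_(N + 1) -> R -> 'rV[R]_N -> R -> R.
Variable eps : R.

Let K : set 'rV[R]_(N + 1) := closure (thin eps).

Definition viscosity_subsolution (u : 'rV[R]_(N + 1) -> R) : Prop :=
  [bounded u z | z in K] /\
  let v := usc_env K u in
  forall (phi : 'rV[R]_(N + 1) -> R) (z : 'rV[R]_(N + 1)),
    C2 phi -> K z -> (forall w, K w -> v w - phi w <= v z - phi z) ->
    [\/ F (hess phi z) (grad phi z) (v z) (xpart z) (ypart z) <= 0,
        thin_lateral eps z /\ dot (nu (xpart z)) (xpart (grad phi z)) <= 0,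
        thin_top eps z /\
          dot (gammap z) (grad phi z) <= betap (xpart z) (ypart z) |
        thin_bottom eps z /\
          dot (gammam z) (grad phi z) <= betam (xpart z) (ypart z)].

Definition viscosity_supersolution (u : 'rV[R]_(N + 1) -> R) : Prop :=
  [bounded u z | z in K] /\
  let v := lsc_env K u in
  forall (phi : 'rV[R]_(N + 1) -> R) (z : 'rV[R]_(N + 1)),
    C2 phi -> K z -> (forall w, K w -> v z - phi z <= v w - phi w) ->
    [\/ F (hess phi z) (grad phi z) (v z) (xpart z) (ypart z) >= 0,
        thin_lateral eps z /\ dot (nu (xpart z)) (xpart (grad phi z)) >= 0,
        thin_top eps z /\
          dot (gammap z) (grad phi z) >= betap (xpart z) (ypart z) |
        thin_bottom eps z /\
          dot (gammam z) (grad phi z) >= betam (xpart z) (ypart z)].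

Definition viscosity_solution (u : 'rV[R]_(N + 1) -> R) : Prop :=
  viscosity_subsolution u /\ viscosity_supersolution u.

End ThinDomain.

(* Main.v *)
Require Import Defs.
From HB Require Import structures.
From mathcomp Require Import all_boot all_order all_algebra sesquilinear.
From mathcomp Require Import all_classical all_reals all_analysis.
From mathcomp Require Import ring lra.
Set Implicit Arguments.
Unset Strict Implicit.
Unset Printing Implicit Defensive.
Import Order.TTheory GRing.Theory Num.Theory.
Import numFieldNormedType.Exports.
Local Open Scope classical_set_scope.
Local Open Scope ring_scope.

(** The proof rests on an a priori bound whose barriers need no smoothing, and on
    Perron's method between two constant obstacles, which needs no barriers at
    all beyond that bound.

    A priori bound ([apriori_upper]). Let v be the upper envelope of a
    subsolution. If the boundary inequalities are strictly reversed for a test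
    function phi, then the equation itself must hold where v - phi is maximal,
    and since F grows at rate alpha in the unknown, v is bounded there in terms
    of the derivatives of phi. A formal expansion in the thin variable suggests
        phi = h(x) + y (betao - gamo . Dh) + A/2 (y - eps m)^2,
    where m is the mean of gp and gm and h increases across the lateral
    boundary. None of these coefficients is smooth enough, so they are frozen:
    h is replaced by the squared distance to a point s of an inner parallel set
    of Omega, the other coefficients are taken at a point b, and |x - b|^2 is
    added ([barrier]). The difference of v and this quadratic function is
    maximised over s and b as well. Maximality in b gives |x - b| = O(eps)
    ([active_dist_le]); maximality in s makes s almost a nearest point, so that
    x - s points outwards at lateral points, which for a C^1 domain follows from
    a uniform cone property ([uniform_cone], [inner_parallel_set]). On top and
    bottom the leading terms of the oblique operator cancel and the remainder is
    O(eps), whereas A (y - eps m) has the right sign and order A eps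
    ([oblique_split], [oblique_remainder_le]). The derivatives of the frozen
    quadratic stay bounded as eps tends to 0. Supersolutions are treated by
    passing to - u and the reflected operator ([reflect_op]).

    Existence ([perron]). Consider the supremum U of all functions with values
    in [-C, C], C larger than the a priori bound, that satisfy the subsolution
    condition wherever their envelope exceeds -C; the constant -C is one of
    them. The bound above only uses points where the envelope is positive, so it
    applies to the whole family and keeps it away from C. The usual bump
    argument then shows that U is a supersolution everywhere, hence U is bounded
    below by more than -C, and the restriction in the subsolution condition
    disappears. The bump argument requires that a strict classical subsolution
    cannot touch a strict classical supersolution ([strict_compare]): in the
    interior by the second-order conditions, on the boundary because the oblique
    fields and the normal give feasible directions, also at the corners when eps
    is small ([inward_thin]). *)

(** * Calculus in coordinates *)

Section DotProduct.
Context {R : realType} {n : nat}.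
Implicit Types u v w : 'rV[R]_n.

Lemma dotC u v : dot u v = dot v u.
Proof. by apply: eq_bigr => i _; rewrite mulrC. Qed.

Lemma dotDl u v w : dot (u + v) w = dot u w + dot v w.
Proof. by rewrite /dot -big_split; apply: eq_bigr => i _; rewrite mxE mulrDl. Qed.

Lemma dotZl a u v : dot (a *: u) v = a * dot u v.
Proof. by rewrite /dot mulr_sumr; apply: eq_bigr => i _; rewrite mxE mulrA. Qed.

Lemma dotNl u v : dot (- u) v = - dot u v.
Proof. by rewrite -scaleN1r dotZl mulN1r. Qed.

Lemma dotBl u v w : dot (u - v) w = dot u w - dot v w.
Proof. by rewrite dotDl dotNl. Qed.

Lemma dotDr u v w : dot w (u + v) = dot w u + dot w v.
Proof. by rewrite dotC dotDl !(dotC _ w). Qed.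

Lemma dotZr a u v : dot v (a *: u) = a * dot v u.
Proof. by rewrite dotC dotZl dotC. Qed.

Lemma dotNr u v : dot v (- u) = - dot v u.
Proof. by rewrite dotC dotNl dotC. Qed.

Lemma dotBr u v w : dot w (u - v) = dot w u - dot w v.
Proof. by rewrite dotDr dotNr. Qed.

Lemma dot0l v : dot 0 v = 0.
Proof. by rewrite /dot big1 // => i _; rewrite mxE mul0r. Qed.

Lemma dot0r v : dot v 0 = 0. Proof. by rewrite dotC dot0l. Qed.

Lemma dot_ge0 v : 0 <= dot v v.
Proof. by apply: sumr_ge0 => i _; rewrite -expr2 sqr_ge0. Qed.

Lemma coord_le_norm v i : `|v 0 i| <= `|v|.
Proof.
rewrite [leRHS]/Num.norm /= mx_normrE; apply/bigmax_geP; right => /=.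
by exists (0, i).
Qed.

Lemma dot_le_norm u v : `|dot u v| <= n%:R * `|u| * `|v|.
Proof.
rewrite (le_trans (ler_norm_sum _ _ _))//.
have -> : n%:R * `|u| * `|v| = \sum_(i < n) (`|u| * `|v|).
  by rewrite sumr_const card_ord -[RHS]mulr_natl mulrA.
apply: ler_sum => i _; rewrite normrM.
by apply: ler_pM => //; exact: coord_le_norm.
Qed.

Lemma norm_sqr_le_dot v : `|v| ^+ 2 <= dot v v.
Proof.
have [->|v0] := eqVneq v 0; first by rewrite normr0 expr0n dot0l.
have [[i j] ->] : exists i, `|v| = `|v i.1 i.2|.
  apply: mx_norm_neq0; rewrite -[X in X != _]/(`|v|) normr_eq0.
  exact: v0.
rewrite ord1 /= -normrX ger0_norm ?sqr_ge0//.
rewrite /dot (bigD1 j)//= -expr2 lerDl.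
by apply: sumr_ge0 => k _; rewrite -expr2 sqr_ge0.
Qed.

Lemma dot_gt0 v : v != 0 -> 0 < dot v v.
Proof.
move=> v0; apply: lt_le_trans (norm_sqr_le_dot v).
by rewrite exprn_gt0// normr_gt0.
Qed.

Lemma dot_CauchySchwarz u v : dot u v ^+ 2 <= dot u u * dot v v.
Proof.
have [->|v0] := eqVneq v 0; first by rewrite dot0r dot0l expr0n mulr0.
have vv := dot_gt0 v0.
have := dot_ge0 (dot v v *: u - dot u v *: v).
rewrite dotBl !dotBr !dotZl !dotZr (dotC v u) => h.
have : 0 <= dot v v * (dot u u * dot v v - dot u v ^+ 2) by nra.
by rewrite pmulr_rge0// subr_ge0.
Qed.

End DotProduct.

Section Calculus.
Context {R : realType} {n : nat}.
Implicit Types (f g : 'rV[R]_n -> R) (x z v d : 'rV[R]_n).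

Lemma row_sum_coord v : v = \sum_i v 0 i *: delta_mx 0 i.
Proof. exact: row_sum_delta. Qed.

Lemma derive_sum_partial (V : normedModType R) (f : 'rV[R]_n -> V) x v :
  differentiable f x -> 'D_v f x = \sum_i v 0 i *: partial i f x.
Proof.
move=> df; rewrite deriveE// {1}[v]row_sum_coord linear_sum.
by apply: eq_bigr => i _; rewrite linearZ /partial deriveE.
Qed.

Lemma derive_dot_grad f x v : differentiable f x -> 'D_v f x = dot (grad f x) v.
Proof.
move=> df; rewrite derive_sum_partial//; apply: eq_bigr => i _.
by rewrite mxE mulrC.
Qed.

Lemma is_derive_line (V : normedModType R) (f : 'rV[R]_n -> V) x v (t : R) :
  differentiable f (x + t *: v) ->
  is_derive t 1 (fun s : R => f (x + s *: v)) ('D_v f (x + t *: v)).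
Proof.
move=> df; have dv : derivable f (x + t *: v) v by exact: diff_derivable.
have E : (fun h : R => h^-1 *: (((fun s : R => f (x + s *: v)) \o shift t) (h *: 1)
    - f (x + t *: v))) =
    (fun h => h^-1 *: ((f \o shift (x + t *: v)) (h *: v) - f (x + t *: v))).
  apply/funext => h /=; congr (_ *: (f _ - _)).
  by rewrite [h *: 1]mulr1 scalerDl addrCA.
by split; rewrite /derivable /derive E.
Qed.

Lemma C1_continuous (V : normedModType R) (f : 'rV[R]_n -> V) : C1 f -> continuous f.
Proof. by move=> [df _] x; exact: differentiable_continuous. Qed.

Lemma MVT_line f x v : (forall y, differentiable f y) ->
  exists2 t : R, 0 < t < 1 & f (x + v) - f x = dot (grad f (x + t *: v)) v.
Proof.
move=> df.
have D (t : R) : is_derive t 1 (fun s : R => f (x + s *: v))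
    (dot (grad f (x + t *: v)) v).
  by rewrite -derive_dot_grad//; exact: is_derive_line.
have cf : {within `[0, 1], continuous (fun s : R => f (x + s *: v))}.
  apply: continuous_subspaceT => t.
  by apply/differentiable_continuous/derivable1_diffP; have [] := D t.
have [t tI] := @MVT R _ (fun t => dot (grad f (x + t *: v)) v) 0 1 ltr01
  (fun t _ => D t) cf.
rewrite scale1r scale0r addr0 subr0 mulr1 => ->.
rewrite in_itv /= in tI; exists t; [exact: tI|].
reflexivity.
Qed.

Lemma partialD i f g x : differentiable f x -> differentiable g x ->
  partial i (f \+ g) x = partial i f x + partial i g x.
Proof. by move=> df dg; rewrite /partial deriveD//; exact: diff_derivable. Qed.

Lemma partialN i f x : differentiable f x ->
  partial i (\- f) x = - partial i f x.
Proof. by move=> df; rewrite /partial deriveN//; exact: diff_derivable. Qed.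

Lemma partialZ i (c : R) f x : differentiable f x ->
  partial i (fun y => c * f y) x = c * partial i f x.
Proof. by move=> df; rewrite /partial [LHS]deriveZ//; exact: diff_derivable. Qed.

Lemma partial_cst i (c : R) x : partial i (fun=> c) x = 0.
Proof. by rewrite /partial derive_cst. Qed.

Lemma partial_shift i f c x :
  partial i (fun y => f (y + c)) x = partial i f (x + c).
Proof.
rewrite /partial /derive.
have -> // : (fun k : R => k^-1 *: (((fun z => f (z + c)) \o shift x)
      (k *: delta_mx 0 i : 'rV_n) - f (x + c))) =
    fun k => k^-1 *: ((f \o shift (x + c)) (k *: delta_mx 0 i) - f (x + c)).
by apply/funext => k /=; rewrite addrA.
Qed.

Lemma gradE f x i : grad f x 0 i = partial i f x.
Proof. by rewrite /grad mxE. Qed.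

Lemma hessE f x i j : hess f x i j = partial i (partial j f) x.
Proof. by rewrite /hess mxE. Qed.

Lemma gradD f g x : differentiable f x -> differentiable g x ->
  grad (f \+ g) x = grad f x + grad g x.
Proof.
move=> df dg; apply/rowP => i; rewrite gradE partialD// [RHS]mxE.
by congr (_ + _); rewrite gradE.
Qed.

Lemma gradN f x : differentiable f x -> grad (\- f) x = - grad f x.
Proof.
move=> df; apply/rowP => i; rewrite gradE partialN// [RHS]mxE.
by congr (- _); rewrite gradE.
Qed.

Lemma C1D f g : C1 f -> C1 g -> C1 (f \+ g).
Proof.
move=> [df cf] [dg cg]; split=> [x|i]; first exact: differentiableD.
rewrite (_ : partial i _ = partial i f \+ partial i g).
  by move=> x; apply: continuousD; [exact: cf|exact: cg].
by apply/funext => x /=; rewrite partialD.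
Qed.

Lemma C1N f : C1 f -> C1 (\- f).
Proof.
move=> [df cf]; split=> [x|i]; first exact: differentiableN.
rewrite (_ : partial i _ = \- partial i f).
  by move=> x; apply: continuousN; exact: cf.
by apply/funext => x /=; rewrite partialN.
Qed.

Lemma C2D f g : C2 f -> C2 g -> C2 (f \+ g).
Proof.
move=> [cf cf'] [cg cg']; split=> [|i]; first exact: C1D cf cg.
rewrite (_ : partial i _ = partial i f \+ partial i g); first exact: C1D (cf' i) (cg' i).
have [[df _] [dg _]] := (cf, cg).
by apply/funext => x /=; rewrite partialD.
Qed.

Lemma C2N f : C2 f -> C2 (\- f).
Proof.
move=> [cf cf']; split=> [|i]; first exact: C1N cf.
rewrite (_ : partial i _ = \- partial i f); first exact: C1N (cf' i).
have [df _] := cf.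
by apply/funext => x /=; rewrite partialN.
Qed.

Lemma hessD f g x : C2 f -> C2 g -> hess (f \+ g) x = hess f x + hess g x.
Proof.
move=> [[df _] cf'] [[dg _] cg']; apply/matrixP => i j.
have [[dfj _] [dgj _]] := (cf' j, cg' j).
have E : partial j (f \+ g) = partial j f \+ partial j g.
  by apply/funext => y; exact: partialD (df y) (dg y).
rewrite hessE E partialD// [RHS]mxE.
by congr (_ + _); rewrite hessE.
Qed.

Lemma hessN f x : C2 f -> hess (\- f) x = - hess f x.
Proof.
move=> [[df _] cf']; apply/matrixP => i j.
have [dfj _] := cf' j.
have E : partial j (\- f) = \- partial j f.
  by apply/funext => y; exact: partialN (df y).
rewrite hessE E partialN// [RHS]mxE.
by congr (- _); rewrite hessE.
Qed.

Lemma cvg_mx (T : Type) (F : set_system T) {FF : Filter F} m k (M : T -> 'M[R]_(m, k))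
    (A : 'M[R]_(m, k)) :
  (forall i j, (fun s => M s i j) @ F --> A i j) -> M @ F --> A.
Proof.
move=> cM; apply/cvg_ballP => e e0.
suff : \forall s \near F, forall i j, ball (A i j) e (M s i j).
  by apply: filterS => s H; split.
apply: filter_forall => i; apply: filter_forall => j.
by have /cvg_ballP/(_ e e0) := cM i j.
Qed.

Lemma continuous_grad f : C1 f -> continuous (grad f).
Proof.
move=> [_ cf] x; apply: (cvg_mx (F := nbhs x)) => i j; rewrite ord1.
have -> : (fun s => grad f s 0 j) = partial j f.
  by apply/funext => s; exact: gradE.
by rewrite gradE; exact: cf.
Qed.

Lemma continuous_hess f : C2 f -> continuous (hess f).
Proof.
move=> [_ cf] x; apply: (cvg_mx (F := nbhs x)) => i j.
have -> : (fun s => hess f s i j) = partial i (partial j f).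
  by apply/funext => s; exact: hessE.
by have [_ cfj] := cf j; rewrite hessE; exact: cfj.
Qed.

Lemma differentiable_partial f i x : C2 f -> differentiable (partial i f) x.
Proof. by move=> [_ /(_ i)[]]. Qed.

(** The mean value theorem, applied first along axis i to the increment of f
    along axis j and then along axis j to the i-th partial derivative. *)
Lemma second_difference f x (i j : 'I_n) (h : R) : C2 f ->
  exists p : R * R, [/\ 0 <= p.1 <= 1, 0 <= p.2 <= 1 &
   f (x + h *: delta_mx 0 i + h *: delta_mx 0 j) - f (x + h *: delta_mx 0 j)
   - (f (x + h *: delta_mx 0 i) - f x) =
  h ^+ 2 * partial j (partial i f)
    (x + (p.1 * h) *: delta_mx 0 i + (p.2 * h) *: delta_mx 0 j)].
Proof.
move=> cf; have [df _] := cf.1.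
pose ei : 'rV[R]_n := delta_mx 0 i; pose ej : 'rV[R]_n := delta_mx 0 j.
pose q y := f (y + h *: ej) - f y.
have dsh y : differentiable (fun y => f (y + h *: ej)) y.
  by apply: (@differentiable_comp _ _ _ _ (fun y => y + h *: ej) f).
have dq y : differentiable q y by apply: differentiableB.
have [t t01] := MVT_line x (h *: ei) dq.
have dotdelta (g : 'rV[R]_n -> R) y k : dot (grad g y) (h *: delta_mx 0 k) = h * partial k g y.
  rewrite dotZr /dot (bigD1 k)//= big1 ?addr0; first by rewrite !mxE !eqxx mulr1.
  by move=> l lk; rewrite !mxE eqxx (negbTE lk) mulr0.
rewrite dotdelta => E.
have pq y : partial i q y = partial i f (y + h *: ej) - partial i f y.
  rewrite -partial_shift -[RHS]/(_ + - _) -partialN// -partialD//.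
  exact: differentiableN.
have [s s01 E2] := MVT_line (x + t *: (h *: ei)) (h *: ej)
  (fun y => differentiable_partial i y cf).
have {t01} /andP[/ltW t0 /ltW t1] := t01; have {s01} /andP[/ltW s0 /ltW s1] := s01.
exists (t, s); split => /=; [by rewrite t0|by rewrite s0|].
have -> : f (x + h *: delta_mx 0 i + h *: delta_mx 0 j) - f (x + h *: delta_mx 0 j) -
   (f (x + h *: delta_mx 0 i) - f x) = q (x + h *: ei) - q x.
  rewrite /q /ei /ej; ring.
rewrite E pq E2 dotdelta /ei /ej !scalerA; ring.
Qed.

Lemma symmetricmxE m (M : 'M[R]_m) : (M \is symmetricmx) = (M == M^T).
Proof. by rewrite qualifE /= expr0 scale1r map_mx_id. Qed.

End Calculus.

Section MixedDerivatives.
Context {R : realType} {n : nat}.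
Implicit Types (f g : 'rV[R]_n -> R) (x z v d : 'rV[R]_n).

Lemma dist_via (a b c e : R) : `|a - c| < e / 2 -> `|b - c| < e / 2 -> `|a - b| <= e.
Proof.
rewrite !ltr_distl ler_distl => /andP[? ?] /andP[? ?]; apply/andP; split; lra.
Qed.

(** The second difference quotient is symmetric in the two directions, and by
    [second_difference] both mixed derivatives are its limit. *)
Lemma partial_comm f x i j : C2 f ->
  partial i (partial j f) x = partial j (partial i f) x.
Proof.
move=> cf.
apply/eqP; rewrite -subr_eq0 -normr_le0; apply/ler_addgt0Pr => e e0.
rewrite add0r.
have e2 : 0 < e / 2 by rewrite divr_gt0.
have near_partial k l : exists2 d : R, 0 < d & forall h p q : R, `|h| < d ->
    0 <= p <= 1 -> 0 <= q <= 1 -> `|partial k (partial l f) x - partial k (partial l f)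
     (x + (p * h) *: delta_mx 0 l + (q * h) *: delta_mx 0 k)| < e / 2.
  have /cvgrPdist_lt/(_ _ e2) : {for x, continuous (partial k (partial l f))}.
    by have [_ cfl] := cf.2 l; exact: cfl.
  move=> /nbhs_ballP[d /= d0 Hd].
  exists (d / 2); first by rewrite divr_gt0.
  move=> h p q hh /andP[p0 p1] /andP[q0 q1].
  apply: Hd; rewrite -ball_normE /= -addrA opprD addNKr normrN.
  apply: le_lt_trans (ler_normD _ _) _; rewrite !normrZ.
  have nd m : `|delta_mx 0 m : 'rV[R]_n| <= 1.
    rewrite [leLHS]/Num.norm /= mx_normrE; apply/bigmax_leP; split=> // k' _.
    by rewrite mxE; case: (_ && _); rewrite ?normr1 ?normr0.
  rewrite (splitr d); apply: ltrD.
    apply: le_lt_trans hh; rewrite (ger0_norm p0).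
    by apply: le_trans (ler_piMr _ (nd l)) _; rewrite ?mulr_ge0// ler_piMl.
  apply: le_lt_trans hh; rewrite (ger0_norm q0).
  by apply: le_trans (ler_piMr _ (nd k)) _; rewrite ?mulr_ge0// ler_piMl.
have [d1 d10 H1] := near_partial i j; have [d2 d20 H2] := near_partial j i.
pose h := Num.min d1 d2 / 2.
have m0 : 0 < Num.min d1 d2 by rewrite lt_min d10.
have h0 : h != 0 by rewrite gt_eqF// divr_gt0.
have hm : `|h| < Num.min d1 d2.
  by rewrite gtr0_norm ?divr_gt0// gtr_pMr// invf_lt1// ltr1n.
move: hm; rewrite lt_min => /andP[hd1 hd2].
have [p [p1 p2 E1]] := second_difference x i j h cf.
have [q [q1 q2 E2]] := second_difference x j i h cf.
apply: (dist_via (H1 _ _ _ hd1 q1 q2)).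
have -> := mulfI (expf_neq0 2 h0) (etrans (esym E2) (etrans _ E1)); first exact: H2 _ _ _ hd2 p1 p2.
move: (f (x + _)) => A; move: (f (x + _)) => B.
rewrite -!addrA.
rewrite (addrC (h *: delta_mx 0 j) (h *: delta_mx 0 i)); ring.
Qed.

Lemma hess_sym f x : C2 f -> hess f x \is symmetricmx.
Proof.
move=> cf; rewrite symmetricmxE; apply/eqP/matrixP => i j.
by rewrite [RHS]mxE [LHS]hessE [RHS]hessE; exact: partial_comm.
Qed.

End MixedDerivatives.

Section SecondOrder.
Context {R : realType} {n : nat}.
Implicit Types (f g : 'rV[R]_n -> R) (x z v d : 'rV[R]_n).

Lemma C1_cst (c : R) : C1 ((fun=> c) : 'rV[R]_n -> R).
Proof.
split=> [x|i]; first exact: differentiable_cst.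
rewrite (_ : partial i _ = fun=> 0); first exact: cst_continuous.
by apply/funext => x; rewrite partial_cst.
Qed.

Lemma C1Z (c : R) f : C1 f -> C1 (fun y => c * f y).
Proof.
move=> [df cf]; split=> [x|i]; first exact: differentiableZ.
rewrite (_ : partial i _ = fun y => c * partial i f y).
  by move=> x; apply: continuousM; [exact: cst_continuous|exact: cf].
by apply/funext => x; rewrite partialZ.
Qed.

Lemma C1_partial_sum (I : Type) (r : seq I) (h : I -> 'rV[R]_n -> R) :
  (forall k, C1 (h k)) ->
  C1 (fun y => \sum_(k <- r) h k y) /\
  forall i y, partial i (fun y => \sum_(k <- r) h k y) y =
    \sum_(k <- r) partial i (h k) y.
Proof.
move=> ch; elim: r => [|k r [IH1 IH2]].
  rewrite (_ : (fun y => _) = fun=> 0).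
    split; first exact: C1_cst.
    by move=> i y; rewrite big_nil partial_cst.
  by apply/funext => y; rewrite big_nil.
rewrite (_ : (fun y => _) = h k \+ fun y => \sum_(k <- r) h k y); last first.
  by apply/funext => y; rewrite big_cons.
split=> [|i y]; first exact: C1D (ch k) IH1.
have [dk _] := ch k; have [dr _] := IH1.
by rewrite big_cons partialD ?IH2.
Qed.

Lemma C1_dot_grad f v : C2 f -> C1 (fun y => dot (grad f y) v) /\
  forall x, dot (grad (fun y => dot (grad f y) v) x) v = dot (v *m hess f x) v.
Proof.
move=> cf; pose h k y := v 0 k * partial k f y.
have ch k : C1 (h k) by apply: C1Z; exact: cf.2.
have E : (fun y => dot (grad f y) v) = fun y => \sum_k h k y.
  by apply/funext => y; apply: eq_bigr => k _; rewrite gradE mulrC.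
have [c1 pE] := C1_partial_sum (index_enum 'I_n) ch.
rewrite E; split=> [|x]; first exact: c1.
apply: eq_bigr => i _; rewrite gradE pE mxE; congr (_ * _).
apply: eq_bigr => k _; rewrite hessE partialZ; last exact: differentiable_partial.
have := hess_sym x cf; rewrite symmetricmxE => /eqP /matrixP/(_ i k).
by rewrite [RHS]mxE [X in X = _ -> _]hessE [X in _ = X -> _]hessE => ->.
Qed.

Lemma cvg_dot (T : Type) (F : set_system T) {FF : Filter F} (h k : T -> 'rV[R]_n) u v :
  h @ F --> u -> k @ F --> v -> (fun s => dot (h s) (k s)) @ F --> dot u v.
Proof.
move=> hu kv; rewrite /dot; elim: (index_enum 'I_n) => [|i r IH].
  rewrite big_nil (_ : (fun s => _) = fun=> 0); first exact: cvg_cst.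
  by apply/funext => s; rewrite big_nil.
rewrite big_cons (_ : (fun s => _) = (fun s => h s 0 i * k s 0 i +
   \sum_(j <- r) h s 0 j * k s 0 j)); last by apply/funext => s; rewrite big_cons.
apply: cvgD => //; apply: cvgM.
- by apply: (cvg_comp h (fun w : 'rV[R]_n => w 0 i) hu); exact: coord_continuous.
- by apply: (cvg_comp k (fun w : 'rV[R]_n => w 0 i) kv); exact: coord_continuous.
Qed.

Lemma near0_right (P : set R) : (\forall t \near (0 : R), P t) -> \forall t \near 0^'+, P t.
Proof. by move=> HP; apply: cvg_within. Qed.

Lemma near0_line x v (P : set 'rV[R]_n) : nbhs x P ->
  \forall t \near (0 : R), P (x + t *: v).
Proof.
move=> xP; have : (fun t : R => x + t *: v) @ 0 --> x + 0 *: v.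
  by apply: cvgD; [exact: cvg_cst|apply: cvgZr_tmp; exact: cvg_id].
by rewrite scale0r addr0; apply.
Qed.

(** A strict lower bound c on the derivative along v survives as a growth rate
    for small positive times. *)
Lemma lt_near_dot_grad f x v (c : R) : C1 f -> c < dot (grad f x) v ->
  \forall t \near 0^'+, f x + t * c < f (x + t *: v).
Proof.
move=> cf pos; have [df _] := cf.
have cg : {for x, continuous (fun y => dot (grad f y) v)}.
  by apply: (cvg_dot (F := nbhs x)); [exact: continuous_grad|exact: cvg_cst].
have /(near0_line v) : \forall y \near x, c < dot (grad f y) v.
  exact: (cvgr_gt _ cg _ pos).
move=> /nbhs_ballP[d /= d0 Hd].
near=> t.
have t0 : 0 < t by near: t; exact: nbhs_right_gt.
have td : t < d by near: t; exact: nbhs_right_lt.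
have [s /andP[s0 s1]] := MVT_line x (t *: v) df.
rewrite -ltrBrDl => ->; rewrite dotZr ltr_pM2l//.
rewrite scalerA; apply: Hd; rewrite -ball_normE /= sub0r normrN normrM.
rewrite !gtr0_norm//; apply: le_lt_trans td.
by rewrite ler_piMl// ltW.
Unshelve. all: by end_near. Qed.

Lemma dot_grad_le0 f x v : C1 f ->
  (\forall t \near 0^'+, f (x + t *: v) <= f x) -> dot (grad f x) v <= 0.
Proof.
move=> cf H; rewrite leNgt; apply/negP => /(lt_near_dot_grad cf) H2.
near (0 : R)^'+ => t.
have : f (x + t *: v) <= f x by near: t.
rewrite leNgt => /negP; apply; rewrite -[f x]addr0 -[X in _ + X](mulr0 t).
by near: t.
Unshelve. all: by end_near. Qed.

(** At an interior maximum the gradient vanishes and the Hessian is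
    nonpositive; a positive second derivative along v would make the
    directional derivative, hence f itself, increase from x along v. *)
Lemma interior_max f x : C2 f -> (\forall y \near x, f y <= f x) ->
  grad f x = 0 /\ psd_le (hess f x) 0.
Proof.
move=> cf H; have Hl v := near0_line v H.
have g0 : grad f x = 0.
  apply/eqP; apply: contraT => /dot_gt0; rewrite ltNge => /negP; case.
  apply: dot_grad_le0; first exact: cf.1.
  by apply: near0_right; exact: Hl.
split=> // v; rewrite mulmx0 dot0l leNgt; apply/negP => pos.
have [cG GE] := C1_dot_grad v cf.
rewrite -GE in pos; set G := (fun y => _) in cG pos.
have cg : {for x, continuous (fun y => dot (grad G y) v)}.
  by apply: (cvg_dot (F := nbhs x)); [exact: continuous_grad|exact: cvg_cst].
have /(near0_line v) : \forall y \near x, 0 < dot (grad G y) v.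
  exact: (cvgr_gt _ cg _ pos).
move=> /nbhs_ballP[d /= d0 Hd].
have [[df _] [dG _]] := (cf.1, cG).
near (0 : R)^'+ => t.
have t0 : 0 < t by near: t; exact: nbhs_right_gt.
have td : t < d by near: t; exact: nbhs_right_lt.
have : f (x + t *: v) <= f x by near: t; apply: near0_right; exact: Hl.
have [s /andP[s0 s1]] := MVT_line x (t *: v) df.
rewrite leNgt => E; rewrite -subr_gt0 E dotZr pmulr_rgt0// => /negP; apply.
have [r /andP[r0 r1]] := MVT_line x (s *: (t *: v)) dG.
rewrite {2}/G g0 dot0l subr0 -/(G _) => ->; rewrite !dotZr.
apply: mulr_gt0; first exact: s0.
apply: mulr_gt0; first exact: t0.
rewrite !scalerA; apply: Hd; rewrite -ball_normE /= sub0r normrN !normrM.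
rewrite !gtr0_norm//; apply: le_lt_trans td.
by rewrite ler_piMl ?ltW// -[1]mulr1 ltr_pM// ltW.
Unshelve. all: by end_near. Qed.

(** Every test function constructed below is a quadratic polynomial without
    mixed terms; this normal form gives its gradient and Hessian at once. *)
Definition diag_quad (a b : 'rV[R]_n) (c : R) (z : 'rV[R]_n) : R :=
  c + \sum_i (b 0 i * z 0 i + a 0 i * z 0 i ^+ 2).

Lemma partial_coord (i k : 'I_n) (z : 'rV[R]_n) :
  partial i (fun y : 'rV[R]_n => y 0 k) z = (k == i)%:R.
Proof.
rewrite /partial /derive; apply/lim_near_cst => //.
near=> h; rewrite /= mxE addrK mxE mxE eqxx /=.
by rewrite -[LHS]/(h^-1 * _) mulKf//; near: h; exact: nbhs_dnbhs_neq.
Unshelve. all: by end_near. Qed.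

Lemma C1_affine_coord (k : 'I_n) (a b : R) :
  C1 (fun z : 'rV[R]_n => b + a * z 0 k) /\
  forall i z, partial i (fun z => b + a * z 0 k) z = a * (k == i)%:R.
Proof.
have dk z : differentiable (fun z : 'rV[R]_n => z 0 k) z by exact: differentiable_coord.
have ck : C1 (fun z : 'rV[R]_n => z 0 k).
  split=> // i; rewrite (_ : partial i _ = fun=> (k == i)%:R : R); first exact: cst_continuous.
  by apply/funext => z; exact: partial_coord.
have cb : C1 ((fun=> b) : 'rV[R]_n -> R) by exact: C1_cst.
have cak : C1 (fun z : 'rV[R]_n => a * z 0 k) by exact: C1Z.
split=> [|i z]; first exact: C1D cb cak.
by rewrite (partialD _ (cb.1 z) (cak.1 z)) partial_cst partialZ// partial_coord add0r.
Qed.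

Lemma partialM i f g x : differentiable f x -> differentiable g x ->
  partial i (fun y => f y * g y) x = f x * partial i g x + g x * partial i f x.
Proof.
by move=> df dg; rewrite /partial [LHS]deriveM//; exact: diff_derivable.
Qed.

Lemma C1_quad_coord (k : 'I_n) (a b : R) :
  C1 (fun z : 'rV[R]_n => b * z 0 k + a * z 0 k ^+ 2) /\
  forall i z, partial i (fun z => b * z 0 k + a * z 0 k ^+ 2) z =
    (b + 2 * a * z 0 k) * (k == i)%:R.
Proof.
have [ck pk] := C1_affine_coord k 1 0; have [cl pl] := C1_affine_coord k a b.
have E : (fun z : 'rV[R]_n => b * z 0 k + a * z 0 k ^+ 2) =
    fun z => (0 + 1 * z 0 k) * (b + a * z 0 k).
  by apply/funext => z; ring.
have pE i z : partial i (fun z : 'rV[R]_n => b * z 0 k + a * z 0 k ^+ 2) z =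
    (b + 2 * a * z 0 k) * (k == i)%:R.
  rewrite E (partialM _ (ck.1 z) (cl.1 z)) pk pl; ring.
split; last exact: pE.
split=> [z|i].
  by rewrite E; apply: differentiableM; [exact: ck.1|exact: cl.1].
rewrite (_ : partial i _ = fun z => (b + (2 * a) * z 0 k) * (k == i)%:R : R).
  have [c2 _] := C1_affine_coord k (2 * a) b.
  move=> z; have cz := C1_continuous c2 (x := z).
  exact: cvgM cz (@cst_continuous _ R ((k == i)%:R) z).
by apply/funext => z; exact: pE.
Qed.

Lemma C1_diag_quad a b c : C1 (diag_quad a b c) /\
  forall i z, partial i (diag_quad a b c) z = b 0 i + 2 * a 0 i * z 0 i.
Proof.
have [cS pS] := C1_partial_sum (index_enum 'I_n)
  (fun k => (C1_quad_coord k (a 0 k) (b 0 k)).1).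
have cc : C1 ((fun=> c) : 'rV[R]_n -> R) by exact: C1_cst.
split=> [|i z]; first exact: C1D cc cS.
rewrite (partialD _ (cc.1 z) (cS.1 z)) partial_cst add0r pS (bigD1 i)//=.
rewrite (C1_quad_coord i (a 0 i) (b 0 i)).2 eqxx mulr1 big1 ?addr0// => k ki.
by rewrite (C1_quad_coord k (a 0 k) (b 0 k)).2 (negbTE ki) mulr0.
Qed.

Lemma C2_diag_quad a b c : C2 (diag_quad a b c).
Proof.
have [c1 p1] := C1_diag_quad a b c; split; first exact: c1.
move=> i.
rewrite (_ : partial i _ = fun z => b 0 i + 2 * a 0 i * z 0 i).
  exact: (C1_affine_coord i (2 * a 0 i) (b 0 i)).1.
by apply/funext => z; exact: p1.
Qed.

Lemma grad_diag_quad a b c z :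
  grad (diag_quad a b c) z = \row_i (b 0 i + 2 * a 0 i * z 0 i).
Proof. by apply/rowP => i; rewrite gradE (C1_diag_quad a b c).2 mxE. Qed.

Lemma hess_diag_quad a b c z : hess (diag_quad a b c) z = diag_mx (2 *: a).
Proof.
apply/matrixP => i j; rewrite hessE.
rewrite (_ : partial j _ = fun z => b 0 j + 2 * a 0 j * z 0 j); last first.
  by apply/funext => y; exact: (C1_diag_quad a b c).2.
rewrite (C1_affine_coord j (2 * a 0 j) (b 0 j)).2 !mxE.
by rewrite eq_sym; case: eqP => [->|]; rewrite ?mulr1 ?mulr0.
Qed.

Definition dist_sq (c z : 'rV[R]_n) : R := dot (z - c) (z - c).

Lemma dist_sqE c : dist_sq c = diag_quad (const_mx 1) (- 2 *: c) (dot c c).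
Proof.
apply/funext => z; rewrite /dist_sq /diag_quad dotBl !dotBr [dot z c]dotC.
rewrite /dot -!sumrB -big_split /=; apply: eq_bigr => i _; rewrite !mxE; ring.
Qed.

End SecondOrder.

(** * Lipschitz and boundedness estimates *)

Section Compactness.
Context {R : realType}.

Lemma within_continuous_bounded (T : topologicalType) (V : normedModType R)
    (K : set T) (h : T -> V) : compact K -> {within K, continuous h} ->
  exists2 M : R, 0 < M & forall x, K x -> `|h x| <= M.
Proof.
move=> cK ch; have [M [_ HM]] := compact_bounded (continuous_compact ch cK).
exists (`|M| + 1); first by rewrite ltr_wpDl.
move=> x Kx; apply: (HM (`|M| + 1)); last by exists x.
by rewrite (le_lt_trans (ler_norm M))// ltrDl.
Qed.

Lemma continuous_bounded (T : topologicalType) (V : normedModType R)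
    (K : set T) (h : T -> V) : compact K -> continuous h ->
  exists2 M : R, 0 < M & forall x, K x -> `|h x| <= M.
Proof.
by move=> cK ch; apply: within_continuous_bounded => //; exact: continuous_subspaceT.
Qed.

Lemma compact_norm_ball n (M : R) : compact [set x : 'rV[R]_n | `|x| <= M].
Proof.
apply: bounded_closed_compact.
  by exists M; split=> [|y My x /= xM]; [exact: num_real|rewrite (le_trans xM)// ltW].
rewrite (_ : [set x | _] = (fun x : 'rV[R]_n => `|x|) @^-1` [set t | t <= M]) //.
apply: closed_comp; last exact: closed_le.
by move=> x _; exact: norm_continuous.
Qed.

Lemma C1_lipschitz n (f : 'rV[R]_n -> R) (M : R) : C1 f ->
  exists2 L : R, 0 < L & forall x y, `|x| <= M -> `|y| <= M ->
    `|f x - f y| <= L * `|x - y|.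
Proof.
move=> cf; have [df _] := cf.
have [L L0 HL] := continuous_bounded (@compact_norm_ball n M) (continuous_grad cf).
exists (n%:R * L + 1); first by rewrite ltr_wpDl// mulr_ge0// ltW.
move=> x y xM yM; have [t /andP[t0 t1] E] := MVT_line y (x - y) df.
rewrite [y + (x - y)]addrC subrK in E; rewrite E.
apply: (le_trans (dot_le_norm _ _)); rewrite ler_wpM2r//.
suff : `|grad f (y + t *: (x - y))| <= L.
  move=> H; apply: (@le_trans _ _ (n%:R * L)); first by rewrite ler_wpM2l.
  by rewrite lerDl.
apply: HL => /=.
rewrite (_ : y + _ = (1 - t) *: y + t *: x); last first.
  by rewrite scalerBl scale1r scalerBr addrAC addrA.
apply: (le_trans (ler_normD _ _)); rewrite !normrZ (ger0_norm (ltW t0)).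
rewrite (@ger0_norm _ (1 - t)); last by rewrite subr_ge0 ltW.
have : (1 - t) * `|y| <= (1 - t) * M by rewrite ler_wpM2l// subr_ge0 ltW.
have : t * `|x| <= t * M by rewrite ler_wpM2l// ltW.
lra.
Qed.

Lemma C1_coord n m (f : 'rV[R]_n -> 'rV[R]_m) k : C1 f -> C1 (fun x => f x 0 k).
Proof.
move=> [df cf]; split=> [x|i].
  apply: (@differentiable_comp _ _ _ _ f (fun v : 'rV[R]_m => v 0 k)) => //.
  exact: differentiable_coord.
rewrite (_ : partial i _ = fun x => (partial i f x) 0 k).
  move=> x; apply: (@cvg_comp _ _ _ (partial i f) (fun v : 'rV[R]_m => v 0 k)).
    exact: cf.
  exact: coord_continuous.
apply/funext => x; rewrite /partial derive_mx ?mxE//; exact: diff_derivable.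
Qed.

Lemma C1_lipschitz_rV n m (f : 'rV[R]_n -> 'rV[R]_m) (M : R) : C1 f ->
  exists2 L : R, 0 < L & forall x y, `|x| <= M -> `|y| <= M ->
    `|f x - f y| <= L * `|x - y|.
Proof.
move=> cf.
have HL k : exists L : R, 0 < L /\ forall x y, `|x| <= M -> `|y| <= M ->
    `|f x 0 k - f y 0 k| <= L * `|x - y|.
  by have [L L0 H] := C1_lipschitz M (C1_coord k cf); exists L.
have [L {}HL] := choice HL.
exists (1 + \sum_k L k).
  by rewrite ltr_pwDl// sumr_ge0// => k _; rewrite ltW// (HL k).1.
move=> x y xM yM; rewrite [leLHS]/Num.norm /= mx_normrE; apply/bigmax_leP; split.
  by rewrite mulr_ge0// addr_ge0// sumr_ge0// => k _; rewrite ltW// (HL k).1.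
move=> [i k] _ /=; rewrite ord1 !mxE.
apply: (le_trans ((HL k).2 x y xM yM)); rewrite ler_wpM2r// (bigD1 k)//=.
rewrite addrCA lerDl addr_ge0// sumr_ge0// => j _; rewrite ltW//.
exact: (HL j).1.
Qed.

End Compactness.

(** * Semicontinuous envelopes *)

Section SemicontinuousEnvelopes.
Context {R : realType} {n : nat}.
Variables (K : set 'rV[R]_n) (u : 'rV[R]_n -> R) (M : R).
Hypothesis u_bounded : forall x, K x -> `|u x| <= M.
Implicit Types (z w : 'rV[R]_n) (c : R).

Let limsup z := limf_esup (EFin \o u) (within K (nbhs z)).

Let limsup_ge z : K z -> ((u z)%:E <= limsup z)%E.
Proof.
move=> Kz; apply: le_ereal_inf_tmp => _ [V FV <-].
apply: ereal_sup_ubound; exists z => //.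
exact: (nbhs_singleton FV).
Qed.

Let limsup_le z : (limsup z <= M%:E)%E.
Proof.
apply: (@le_trans _ _ (ereal_sup ((EFin \o u) @` K))).
  apply: ereal_inf_lbound; exists K => //.
  exact: withinT.
apply: ge_ereal_sup => _ [x Kx <-]; rewrite lee_fin.
exact: le_trans (ler_norm _) (u_bounded Kx).
Qed.

Let limsupE z : K z -> limsup z = (usc_env K u z)%:E.
Proof.
move=> Kz; rewrite /usc_env fineK// fin_numE.
have /andP[] : ((u z)%:E <= limsup z <= M%:E)%E by rewrite limsup_ge ?limsup_le.
by rewrite /limsup; case: limf_esup.
Qed.

Lemma le_usc_env z : K z -> u z <= usc_env K u z.
Proof. by move=> Kz; rewrite -lee_fin -limsupE//; exact: limsup_ge. Qed.

Lemma usc_env_lt z c : K z -> usc_env K u z < c ->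
  \forall w \near z, K w -> u w < c.
Proof.
move=> Kz; rewrite -lte_fin -limsupE// => /ereal_inf_lt[_ [V FV <-]] Vc.
apply: filterS FV => w Vw; rewrite -lte_fin; apply: le_lt_trans Vc.
by apply: ereal_sup_ubound; exists w.
Qed.

Lemma usc_env_gt z c (U : set 'rV[R]_n) : K z -> c < usc_env K u z ->
  nbhs z U -> exists w, [/\ K w, U w & c < u w].
Proof.
move=> Kz; rewrite -lte_fin -limsupE// => cz zU.
have : (c%:E < ereal_sup ((EFin \o u) @` (K `&` U)))%E.
  apply: lt_le_trans cz _; apply: ereal_inf_lbound; exists (K `&` U) => //.
  by apply: filterS zU => w Uw Kw.
move=> /ereal_sup_gt[_ [w [Kw Uw] <-]]; rewrite lte_fin => cw.
by exists w.
Qed.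

Lemma usc_env_usc z c : K z -> usc_env K u z < c ->
  \forall w \near z, K w -> usc_env K u w < c.
Proof.
move=> Kz zc; pose c' := (usc_env K u z + c) / 2.
have zc' : usc_env K u z < c' by rewrite midf_lt.
have c'c : c' < c by rewrite midf_lt.
have /nbhs_interior := usc_env_lt Kz zc'.
apply: filterS => w Hw Kw; rewrite ltNge; apply/negP => cw.
have [y [Ky Hy]] := usc_env_gt Kw (lt_le_trans c'c cw) Hw.
by rewrite ltNge ltW// Hy.
Qed.

Lemma usc_env_le z c : K z -> (\forall w \near z, K w -> u w <= c) ->
  usc_env K u z <= c.
Proof.
move=> Kz H; rewrite leNgt; apply/negP => cz.
by have [w [Kw /(_ Kw) wc]] := usc_env_gt Kz cz H; rewrite ltNge wc.
Qed.

End SemicontinuousEnvelopes.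

Section EnvelopeOperations.
Context {R : realType} {n : nat}.
Variables (K : set 'rV[R]_n).
Implicit Types (u w : 'rV[R]_n -> R) (z : 'rV[R]_n).

Lemma lsc_envE u : lsc_env K u = \- usc_env K (\- u).
Proof.
apply/funext => z; rewrite /lsc_env /usc_env /limf_einf /= -fineN.
by congr (fine (- limf_esup _ _)); apply/funext => y /=; rewrite EFinN.
Qed.

Lemma usc_env_mono u w M z : (forall x, K x -> `|u x| <= M) ->
  (forall x, K x -> `|w x| <= M) -> (forall x, K x -> u x <= w x) -> K z ->
  usc_env K u z <= usc_env K w z.
Proof.
move=> uM wM uw Kz; rewrite leNgt; apply/negP => wu.
have Hw := usc_env_lt wM Kz wu.
have {}Hw : \forall y \near z, K y -> usc_env K w y < usc_env K u z.
  exact: (usc_env_usc wM Kz wu).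
have [c /andP[c1 c2]] : exists c, usc_env K w z < c < usc_env K u z.
  by exists ((usc_env K w z + usc_env K u z) / 2); rewrite !midf_lt.
have [y [Ky /(_ Ky) wy]] := usc_env_gt uM Kz c2 (usc_env_lt wM Kz c1).
by rewrite ltNge ltW// (le_lt_trans (uw _ Ky)).
Qed.

(** Near z both u and p stay below any level exceeding the right-hand side. *)
Lemma usc_env_max_le u (p : 'rV[R]_n -> R) M M' z :
  (forall x, K x -> `|u x| <= M) ->
  (forall x, K x -> `|Num.max (u x) (p x)| <= M') -> K z ->
  {for z, continuous p} ->
  usc_env K (fun x => Num.max (u x) (p x)) z <= Num.max (usc_env K u z) (p z).
Proof.
move=> uM mM Kz cp; rewrite leNgt; apply/negP.
set m := Num.max _ (p z); set e := usc_env _ _ _ => me.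
have [c /andP[mc ce]] : exists c, m < c < e by exists ((m + e) / 2); rewrite !midf_lt.
move: mc; rewrite gt_max => /andP[uc pc].
move: ce; apply/negP; rewrite -leNgt; apply: (usc_env_le mM) => //.
near=> w => Kw; rewrite ge_max; apply/andP; split; apply: ltW.
  by move: (Kw); near: w; exact: (usc_env_lt uM).
by near: w; exact: (cvgr_lt _ cp).
Unshelve. all: by end_near. Qed.

End EnvelopeOperations.

(** The superlevel sets of f below its supremum generate a filter; by upper
    semicontinuity f attains the supremum at any cluster point. *)
Lemma usc_max_compact (R : realType) (T : topologicalType) (A : set T) (f : T -> R) :
  compact A -> A !=set0 ->
  (forall x c, A x -> f x < c -> \forall w \near x, A w -> f w < c) ->
  exists2 x, A x & forall w, A w -> f w <= f x.
Proof.
move=> cA [a Aa] uf; pose S := ereal_sup ((EFin \o f) @` A).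
pose B (c : R) := [set w | A w /\ c < f w].
pose F := filter_from [set c : R | (c%:E < S)%E] B.
have FF : ProperFilter F.
  apply: filter_from_proper; last first.
    move=> c /= /ereal_sup_gt[_ [w Aw <-]]; rewrite lte_fin => cw.
    by exists w.
  apply: filter_from_filter.
    exists (f a - 1) => /=; apply: (@lt_le_trans _ _ (f a)%:E).
      by rewrite lte_fin ltrBlDr ltrDl.
    by apply: ereal_sup_ubound; exists a.
  move=> c d /= cS dS; exists (Num.max c d).
    by case: (leP c d).
  by move=> w [Aw]; rewrite gt_max => /andP[cw dw].
have FA : F A.
  exists (f a - 1) => /=; last by move=> w [].
  apply: (@lt_le_trans _ _ (f a)%:E); first by rewrite lte_fin ltrBlDr ltrDl.
  by apply: ereal_sup_ubound; exists a.
have [x [Ax clx]] := cA F FF FA.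
exists x => // w Aw; rewrite leNgt; apply/negP => xw.
have [c /andP[xc cw]] : exists c, f x < c < f w.
  by exists ((f x + f w) / 2); rewrite !midf_lt.
have FB : F (B c).
  exists c => //=; apply: (@lt_le_trans _ _ (f w)%:E); first by rewrite lte_fin.
  by apply: ereal_sup_ubound; exists w.
have [y [[Ay cy] /(_ Ay)]] := clx _ _ FB (uf x c Ax xc).
by rewrite ltNge ltW.
Qed.

(** * Perron's method *)

Section ScaledDistance.
Context {R : realType} {n : nat}.

Lemma scaled_dist_sqE (eta : R) (c : 'rV[R]_n) :
  (fun w => eta * dist_sq c w) =
  diag_quad (const_mx eta) ((- 2 * eta) *: c) (eta * dot c c).
Proof.
apply/funext => w; rewrite dist_sqE /diag_quad mulrDr mulr_sumr; congr (_ + _).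
by apply: eq_bigr => i _; rewrite !mxE; ring.
Qed.

Lemma C2_scaled_dist_sq (eta : R) (c : 'rV[R]_n) : C2 (fun w => eta * dist_sq c w).
Proof. by rewrite scaled_dist_sqE; exact: C2_diag_quad. Qed.

Lemma dist_sq_lt (c w : 'rV[R]_n) r : 0 < r -> dist_sq c w < r ^+ 2 -> `|w - c| < r.
Proof.
move=> r0 H; rewrite -(@ltr_pXn2r _ 2)// ?nnegrE ?normr_ge0 ?(ltW r0)//.
exact: le_lt_trans (norm_sqr_le_dot _) H.
Qed.

End ScaledDistance.

Section Perron.
Context {R : realType} {n : nat}.
(** [strict_super phi z r] is the failure at z, with value r, of the condition
    tested by a function phi touching a subsolution from above, and
    [strict_sub phi z r] the failure of the condition tested by a function
    touching a supersolution from below. *)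
Variables (K : set 'rV[R]_n) (strict_super strict_sub : ('rV[R]_n -> R) -> 'rV[R]_n -> R -> Prop).
Hypothesis K_compact : compact K.

(** Testing only where the envelope exceeds T admits the constant T itself, so
    that the Perron family is nonempty without any explicit subsolution. *)
Definition subsol_above (T : R) (u : 'rV[R]_n -> R) : Prop :=
  forall phi z, C2 phi -> K z ->
    (forall w, K w -> usc_env K u w - phi w <= usc_env K u z - phi z) ->
    T < usc_env K u z -> ~ strict_super phi z (usc_env K u z).

Definition supersol_below (T : R) (u : 'rV[R]_n -> R) : Prop :=
  forall phi z, C2 phi -> K z ->
    (forall w, K w -> lsc_env K u z - phi z <= lsc_env K u w - phi w) ->
    lsc_env K u z < T -> ~ strict_sub phi z (lsc_env K u z).

(** Perturbing phi by a multiple of the squared distance to z makes an extremum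
    at z strict; the strict inequalities must survive this near z. *)
Definition stable (s : R) (P : ('rV[R]_n -> R) -> 'rV[R]_n -> R -> Prop) : Prop :=
  forall phi z r, C2 phi -> K z -> P phi z r ->
  exists eta d : R, [/\ 0 < eta, 0 < d & forall w t, K w -> `|w - z| < d ->
    `|t - r| < d -> P (phi \+ fun y => (s * eta) * dist_sq z y) w t].

Hypothesis strict_super_stable : stable 1 strict_super.
Hypothesis strict_sub_stable : stable (-1) strict_sub.
Hypothesis strict_compare : forall psi phi z r, C2 psi -> C2 phi -> K z ->
  (forall w, K w -> psi w - phi w <= psi z - phi z) ->
  strict_sub psi z r -> strict_super phi z r -> False.

Variables (C0 : R).
Hypothesis C0_gt0 : 0 < C0.
Hypothesis subsol_le : forall u (M : R), (forall x, K x -> `|u x| <= M) ->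
  subsol_above 0 u -> forall z, K z -> usc_env K u z <= C0.
Hypothesis supersol_ge : forall u (M : R), (forall x, K x -> `|u x| <= M) ->
  supersol_below 0 u -> forall z, K z -> - C0 <= lsc_env K u z.

Let C := C0 + 1.
Let CC0 : C0 < C. Proof. by rewrite /C ltrDl. Qed.
Let C_gt0 : 0 < C. Proof. exact: lt_trans CC0. Qed.

Let subfamily : set ('rV[R]_n -> R) :=
  [set w | (forall x, K x -> `|w x| <= C) /\ subsol_above (- C) w].

Let subfamily_cst : subfamily (fun=> - C).
Proof.
have bC (x : 'rV[R]_n) : K x -> `|- C| <= C by rewrite normrN gtr0_norm.
split=> // phi z _ Kz _; rewrite ltNge => /negP; case.
have near_C : \forall w \near z, K w -> - C <= - C by near=> w.
exact: (@usc_env_le R n K (fun=> - C) C bC z (- C) Kz near_C).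
Unshelve. all: by end_near. Qed.

Let U x := sup [set w x | w in subfamily].

Let U_has_sup x : K x -> has_sup [set w x | w in subfamily].
Proof.
move=> Kx; split; first by exists (- C), (fun=> - C).
exists C => _ [w [wC _] <-]; exact: le_trans (ler_norm _) (wC x Kx).
Qed.

Let U_ub w x : subfamily w -> K x -> w x <= U x.
Proof.
by move=> Sw Kx; apply: ub_le_sup; [exact: (U_has_sup Kx).2|exists w].
Qed.

Let U_gt x c : K x -> c < U x -> exists2 w, subfamily w & c < w x.
Proof.
move=> Kx cU; have [_ [w Sw <-] cw] := sup_gt (U_has_sup Kx).1 cU.
by exists w.
Qed.

Let U_norm x : K x -> `|U x| <= C.
Proof.
move=> Kx; rewrite ler_norml (U_ub subfamily_cst Kx) /=.
apply: ge_sup; first exact: (U_has_sup Kx).1.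
by move=> _ [w [wC _] <-]; exact: le_trans (ler_norm _) (wC x Kx).
Qed.

Let near_small (psi : 'rV[R]_n -> R) (z : 'rV[R]_n) (e d : R) : C2 psi -> 0 < e -> 0 < d ->
  exists r, [/\ 0 < r, r <= d & forall w, `|w - z| < r -> `|psi w - psi z| < e].
Proof.
move=> cp e0 d0.
have /cvgrPdist_lt/(_ _ e0) : {for z, continuous psi} by exact: C1_continuous cp.1 _.
move=> /nbhs_ballP[r /= r0 Hr].
exists (Num.min r d); split; first by rewrite lt_min r0.
  by rewrite ge_min lexx orbT.
move=> w; rewrite lt_min => /andP[wr _]; rewrite distrC.
by apply: Hr; rewrite -ball_normE /= distrC.
Qed.

Let nbhs_dist (z : 'rV[R]_n) (r : R) : 0 < r -> \forall w \near z, `|w - z| < r.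
Proof.
move=> r0; apply/nbhs_ballP; exists r => //= w; rewrite -ball_normE /= distrC//.
Qed.

(** Since the maximum of the envelope of U minus psi is strict at z, a member w
    of the family that almost attains U near z has its own maximum near z, where
    the strict inequalities still hold. *)
Let U_subsol : subsol_above (- C) U.
Proof.
move=> phi z cphi Kz; set v := usc_env K U => zmax Cv bad.
have [eta [d [eta0 d0 Hd]]] := strict_super_stable cphi Kz bad.
pose psi := phi \+ fun y => (1 * eta) * dist_sq z y.
have cpsi : C2 psi := C2D cphi (C2_scaled_dist_sq _ _).
have psiz : psi z = phi z by rewrite /psi /= /dist_sq subrr dot0l mulr0 addr0.
pose e := Num.min (d / 2) ((v z + C) / 2).
have e0 : 0 < e by rewrite lt_min !divr_gt0// -(opprK C) subr_gt0.
have [r [r0 rd Hr]] := near_small z cpsi e0 d0.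
(* k is at most the gap of psi outside the ball of radius r. *)
pose k := Num.min (eta * r ^+ 2) e.
have k0 : 0 < k by rewrite lt_min e0 mulr_gt0// exprn_gt0.
have k20 : 0 < k / 2 by rewrite divr_gt0.
have [r' [r'0 _ Hr']] := near_small z cpsi k20 d0.
have vk : v z - k / 2 < v z by rewrite ltrBlDr ltrDl.
have [y [Ky /Hr' yz vy]] := usc_env_gt U_norm Kz vk (nbhs_dist z r'0).
have [w Sw wy] := U_gt Ky vy; have [wC wsub] := Sw.
have wpsi_usc x c : K x -> usc_env K w x - psi x < c ->
    \forall t \near x, K t -> usc_env K w t - psi t < c.
  move=> Kx xc; pose h := (c - (usc_env K w x - psi x)) / 2.
  have h0 : 0 < h by rewrite divr_gt0// subr_gt0.
  have [s [s0 _ Hs]] := near_small x cpsi h0 d0.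
  have xh : usc_env K w x < usc_env K w x + h by rewrite ltrDl.
  near=> t => Kt.
  have t1 : usc_env K w t < usc_env K w x + h.
    by move: (Kt); near: t; exact: (usc_env_usc wC).
  have : `|psi t - psi x| < h by apply: Hs; near: t; exact: nbhs_dist.
  by rewrite ltr_distl => /andP[t2 _]; rewrite /h in t1 t2; lra.
have [z' Kz' z'max] := usc_max_compact K_compact (ex_intro _ _ Ky) wpsi_usc.
have wv x : K x -> usc_env K w x <= v x.
  by move=> Kx; apply: (usc_env_mono wC U_norm _ Kx) => t Kt; exact: U_ub.
have A1 : v z - psi z - k < usc_env K w z' - psi z'.
  apply: lt_le_trans (z'max y Ky).
  have := le_usc_env wC Ky; move: yz; rewrite ltr_distl => /andP[_ yz]; lra.
have A2 : usc_env K w z' <= v z + psi z' - psi z - eta * dist_sq z z'.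
  have := zmax z' Kz'; have := wv z' Kz'; rewrite psiz /psi /= mul1r; lra.
have z'r : `|z' - z| < r.
  apply: dist_sq_lt => //; rewrite -(ltr_pM2l eta0).
  apply: lt_le_trans (_ : k <= _); last by rewrite ge_min lexx.
  lra.
have := Hr z' z'r; rewrite ltr_distl => /andP[B1 B2].
have ke : k <= e by rewrite ge_min lexx orbT.
have ed : e <= d / 2 by rewrite ge_min lexx.
have eC : e <= (v z + C) / 2 by rewrite ge_min lexx orbT.
have dge : 0 <= eta * dist_sq z z' by apply: mulr_ge0; [exact: ltW|exact: dot_ge0].
apply: (wsub psi z' cpsi Kz' z'max); first lra.
apply: Hd => //; first exact: lt_le_trans z'r rd.
rewrite ltr_distl; apply/andP; split; lra.
Unshelve. all: by end_near. Qed.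

Let subfamily_le w x : subfamily w -> K x -> usc_env K w x <= C0.
Proof.
move=> [wC wsub] Kx; apply: (subsol_le wC) => // phi z cphi Kz zmax z0.
by apply: wsub => //; apply: lt_trans z0; rewrite oppr_lt0.
Qed.

Let U_le x : K x -> U x <= C0.
Proof.
move=> Kx; apply: le_trans (le_usc_env U_norm Kx) _.
by apply: subfamily_le => //; split.
Qed.

Let NU_norm x : K x -> `|(\- U) x| <= C.
Proof. by move=> Kx; rewrite normrN; exact: U_norm. Qed.

(** Otherwise the maximum of U and a slightly raised copy of the touching
    function would belong to the family and exceed U near z. There is no upper
    obstacle to respect: members of the family stay below C0 < C. *)
Let U_supersol phi z : C2 phi -> K z ->
    (forall w, K w -> lsc_env K U z - phi z <= lsc_env K U w - phi w) ->
    ~ strict_sub phi z (lsc_env K U z).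
Proof.
move=> cphi Kz; set l := lsc_env K U => zmin bad.
have lE x : l x = - usc_env K (\- U) x by rewrite /l lsc_envE.
have lU x : K x -> l x <= U x.
  by move=> Kx; rewrite lE lerNl; exact: (@le_usc_env _ _ K (\- U) C NU_norm x Kx).
have [eta [d [eta0 d0 Hd]]] := strict_sub_stable cphi Kz bad.
pose psi := phi \+ fun y => (-1 * eta) * dist_sq z y.
have cpsi : C2 psi := C2D cphi (C2_scaled_dist_sq _ _).
have psiE y : psi y = phi y - eta * dist_sq z y by rewrite /psi /= mulN1r mulNr.
have psiz : psi z = phi z by rewrite psiE /= /dist_sq subrr dot0l mulr0 subr0.
have d20 : 0 < d / 2 by rewrite divr_gt0.
have [r [r0 rd Hr]] := near_small z cpsi d20 d0.
pose k := Num.min (eta * r ^+ 2) (Num.min (d / 2) 1).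
have k0 : 0 < k by rewrite !lt_min d20 ltr01 mulr_gt0// exprn_gt0.
have kr : k <= eta * r ^+ 2 by rewrite ge_min lexx.
have kd : k <= d / 2 by rewrite !ge_min lexx orbT.
have k1 : k <= 1 by rewrite !ge_min lexx !orbT.
(* By pU below, p exceeds U only where eta * dist_sq z y < k, hence inside the
   ball on which psi is a strict subsolution. *)
pose p y := psi y + (l z - psi z + k).
have pU y : K y -> p y <= U y - eta * dist_sq z y + k.
  move=> Ky; have := zmin y Ky; have := lU y Ky.
  by rewrite /p psiE psiz; lra.
have dge y : 0 <= eta * dist_sq z y by apply: mulr_ge0; [exact: ltW|exact: dot_ge0].
pose w' x := Num.max (U x) (p x).
have w'C x : K x -> `|w' x| <= C.
  move=> Kx; rewrite ler_norml /w' le_max ge_max.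
  have := U_norm Kx; rewrite ler_norml => /andP[-> ->] /=.
  have := pU x Kx; have := U_le Kx; have := dge x; rewrite /C; lra.
set v := usc_env K U.
have vw' x : K x -> v x <= usc_env K w' x.
  move=> Kx; apply: (usc_env_mono U_norm w'C _ Kx) => t Kt.
  by rewrite /w' le_max lexx.
have pw' x : K x -> p x <= usc_env K w' x.
  by move=> Kx; apply: le_trans (le_usc_env w'C Kx); rewrite /w' le_max lexx orbT.
have pcont x : {for x, continuous p}.
  apply: continuousD; first exact: C1_continuous cpsi.1 _.
  exact: cst_continuous.
have Sw' : subfamily w'.
  split=> // phi2 z2 cphi2 Kz2 z2max z2C.
  have := usc_env_max_le U_norm w'C Kz2 (pcont z2).
  rewrite -/w' -/v; have [vp|vp] := leP (p z2) (v z2) => w'le.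
    have E : usc_env K w' z2 = v z2 by apply/le_anti; rewrite w'le vw'.
    rewrite E; apply: U_subsol => //; last by rewrite -/v -E.
    move=> w Kw; rewrite -/v -E; apply: le_trans (z2max w Kw).
    by rewrite lerB// vw'.
  have E : usc_env K w' z2 = p z2 by apply/le_anti; rewrite w'le pw'.
  move=> bad2; apply: (strict_compare cpsi cphi2 Kz2 _ _ bad2).
    move=> w Kw; have := z2max w Kw; have := pw' w Kw; rewrite E /p; lra.
  have Uv : U z2 <= v z2 := le_usc_env U_norm Kz2.
  have z2r : `|z2 - z| < r.
    apply: dist_sq_lt => //; rewrite -(ltr_pM2l eta0).
    have := pU z2 Kz2; lra.
  have := Hr z2 z2r; rewrite ltr_distl => /andP[B1 B2].
  apply: Hd => //; first exact: lt_le_trans z2r rd.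
  by rewrite E /p ltr_distl; apply/andP; split; lra.
have k20 : 0 < k / 2 by rewrite divr_gt0.
have [r' [r'0 _ Hr']] := near_small z cpsi k20 d0.
have lk : - l z - k / 2 < usc_env K (\- U) z by rewrite lE opprK ltrBlDr ltrDl.
have [y [Ky /Hr' yz ly]] := usc_env_gt NU_norm Kz lk (nbhs_dist z r'0).
have := U_ub Sw' Ky; rewrite /w' ge_max lexx /= /p.
move: yz ly; rewrite ltr_distl /= => /andP[yz _]; lra.
Qed.

(** The supersolution bound keeps U above - C0 > - C, so the threshold - C in the
    definition of the family is void for U. *)
Theorem perron : exists u (M : R), [/\ forall x, K x -> `|u x| <= M,
  forall phi z, C2 phi -> K z ->
    (forall w, K w -> usc_env K u w - phi w <= usc_env K u z - phi z) ->
    ~ strict_super phi z (usc_env K u z) &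
  forall phi z, C2 phi -> K z ->
    (forall w, K w -> lsc_env K u z - phi z <= lsc_env K u w - phi w) ->
    ~ strict_sub phi z (lsc_env K u z)].
Proof.
exists U, C; split=> [//| |].
  move=> phi z cphi Kz zmax; apply: U_subsol => //.
  apply: (@lt_le_trans _ _ (- C0)); first by rewrite ltrN2.
  apply: le_trans (le_usc_env U_norm Kz).
  have lU : lsc_env K U z <= U z.
    by rewrite lsc_envE lerNl; exact: (@le_usc_env _ _ K (\- U) C NU_norm z Kz).
  apply: le_trans lU; apply: (supersol_ge U_norm) => // phi' z' cphi' Kz' z'min _.
  exact: U_supersol.
by move=> phi z cphi Kz zmin; exact: U_supersol.
Qed.

End Perron.

(** * Domains with C^1 boundary *)

Section C1Domain.
Context {R : realType} {N : nat}.
Variables (Omega : set 'rV[R]_N) (nu : 'rV[R]_N -> 'rV[R]_N).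
Hypothesis Omega_open : open Omega.
Hypothesis Omega_bounded : bounded_set Omega.
Hypothesis Omega_C1 : C1_boundary Omega.
Hypothesis nu_normal : outward_unit_normal Omega nu.

Lemma closure_bounded : exists2 M : R, 0 < M & forall x, closure Omega x -> `|x| <= M.
Proof.
have [M [_ HM]] := Omega_bounded.
pose M' := `|M| + 1.
have MM' : M < M' by rewrite (le_lt_trans (ler_norm M))// ltrDl.
exists M'; first by rewrite ltr_wpDl.
move=> x clx; rewrite leNgt; apply/negP => Mx.
have : \forall y \near x, M' < `|y|.
  exact: (cvgr_gt _ (@norm_continuous _ _ x) _ Mx).
move=> /clx[y [Oy]]; rewrite ltNge => /negP; apply; exact: HM.
Qed.

Lemma closure_compact : compact (closure Omega).
Proof.
have [M _ HM] := closure_bounded.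
apply: (subclosed_compact (@closed_closure _ Omega) (@compact_norm_ball _ N M)).
by move=> x /HM.
Qed.

Lemma boundary_closed : closed (boundary Omega).
Proof.
rewrite /boundary setDE; apply: closedI; first exact: closed_closure.
by apply: open_closedC; exact: open_interior.
Qed.

Lemma boundary_compact : compact (boundary Omega).
Proof. by apply: subclosed_compact boundary_closed closure_compact _ => x []. Qed.

Lemma closure_boundary x : closure Omega x -> Omega x \/ boundary Omega x.
Proof.
move=> clx; have [Ox|nOx] := pselect (Omega x); first by left.
by right; split=> //; rewrite (interior_id Omega).1.
Qed.

Lemma boundaryNin x : boundary Omega x -> ~ Omega x.
Proof. by move=> [_]; rewrite (interior_id Omega).1. Qed.

Lemma local_defining_boundary x rho : boundary Omega x ->
  local_defining Omega x rho -> rho x = 0.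
Proof.
move=> bx [crho _ nx]; apply/le_anti/andP; split; last first.
  rewrite leNgt; apply/negP => r0; apply: (boundaryNin bx).
  exact: (nbhs_singleton nx).2.
rewrite leNgt; apply/negP => r0.
have : \forall y \near x, 0 < rho y by exact: (cvgr_gt _ (C1_continuous crho (x := x)) _ r0).
move=> /(filterI nx)/bx.1 [y [Oy [yO]]].
by rewrite ltNge => /negP; apply; apply/ltW/yO.
Qed.

(** Near a boundary point a single defining function serves all boundary
    points, which makes the estimates below locally uniform. *)
Lemma local_defining_near x0 rho : local_defining Omega x0 rho ->
  exists2 s : R, 0 < s & forall x, `|x - x0| < s -> boundary Omega x ->
    local_defining Omega x rho.
Proof.
move=> [crho g0 nx].
have : \forall x \near x0, (\forall z \near x, Omega z <-> rho z < 0) /\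
    0 < `|grad rho x|.
  apply: filterI; first exact: nbhs_interior nx.
  have g0' : 0 < `|grad rho x0| by rewrite normr_gt0.
  exact: (cvgr_gt _ (cvg_norm (continuous_grad crho (x := x0))) _ g0').
move=> /nbhs_ballP[s /= s0 Hs]; exists s => // x xs bx.
have [|H1 H2] := Hs x; first by rewrite -ball_normE /= distrC.
by split; [exact: crho|rewrite -normr_gt0|exact: H1].
Qed.

Lemma nu_unit x : boundary Omega x -> dot (nu x) (nu x) = 1.
Proof.
move=> bx; have [rho lrho] := Omega_C1 bx.
rewrite (nu_normal bx lrho) dotZl dotZr mulrA -expr2 exprVn.
have [_ /dot_gt0 g0 _] := lrho.
by rewrite sqr_sqrtr ?ltW// mulVf// gt_eqF.
Qed.

Lemma nu_norm_le1 x : boundary Omega x -> `|nu x| <= 1.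
Proof.
move=> bx; rewrite -(@ler_pXn2r _ 2)// ?nnegrE//.
by rewrite expr1n -(nu_unit bx); exact: norm_sqr_le_dot.
Qed.

Lemma nu_cvg x0 : boundary Omega x0 ->
  nu @ within (boundary Omega) (nbhs x0) --> nu x0.
Proof.
move=> bx0; have [rho lrho] := Omega_C1 bx0.
have [s s0 Hs] := local_defining_near lrho.
have [crho /dot_gt0 g0 _] := lrho.
have cg : grad rho @ x0 --> grad rho x0 by exact: continuous_grad.
have cn : (fun x => (Num.sqrt (dot (grad rho x) (grad rho x)))^-1 *: grad rho x) @ x0 -->
    nu x0.
  rewrite (nu_normal bx0 lrho).
  have cs : (fun x => Num.sqrt (dot (grad rho x) (grad rho x))) @ x0 -->
      Num.sqrt (dot (grad rho x0) (grad rho x0)).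
    by apply: (cvg_comp _ _ (cvg_dot cg cg)); exact: sqrt_continuous.
  have s0' : Num.sqrt (dot (grad rho x0) (grad rho x0)) != 0.
    by rewrite gt_eqF// sqrtr_gt0.
  exact: cvgZ (cvgV s0' cs) cg.
have cw : (fun x => (Num.sqrt (dot (grad rho x) (grad rho x)))^-1 *: grad rho x)
    @ within (boundary Omega) (nbhs x0) --> nu x0.
  by apply: cvg_trans cn; apply: cvg_app; exact: cvg_within.
apply: cvg_trans cw; apply: near_eq_cvg; rewrite near_withinE.
apply/nbhs_ballP; exists s => //= x; rewrite -ball_normE /= distrC => xs bx.
by rewrite (nu_normal bx (Hs x xs bx)).
Qed.

(** Uniform tangent cone property, with the same radius at all boundary points:
    strict differentiability of a defining function gives it locally, and the
    boundary is compact. *)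
Lemma uniform_cone (om : R) : 0 < om -> exists2 r : R, 0 < r &
  forall x z, boundary Omega x -> `|z - x| <= r ->
    (Omega z -> dot (nu x) (z - x) <= om * `|z - x|) /\
    (dot (nu x) (z - x) < - (om * `|z - x|) -> Omega z).
Proof.
move=> om0.
have loc x0 : boundary Omega x0 -> exists2 s : R, 0 < s &
    forall x z, boundary Omega x -> `|x - x0| < s -> `|z - x| < s ->
    (Omega z -> dot (nu x) (z - x) <= om * `|z - x|) /\
    (dot (nu x) (z - x) < - (om * `|z - x|) -> Omega z).
  move=> bx0; have [rho lrho] := Omega_C1 bx0.
  have [s s0 Hs] := local_defining_near lrho.
  have [crho /dot_gt0 g0 nx] := lrho; have [drho _] := crho.
  pose c := dot (grad rho x0) (grad rho x0); pose n0 := Num.sqrt (c / 2).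
  have n00 : 0 < n0 by rewrite sqrtr_gt0 divr_gt0.
  pose tau := om * n0 / (2 * (N%:R + 1)).
  have N0 : 0 < 2 * (N%:R + 1) :> R by rewrite mulr_gt0// ltr_wpDl.
  have tau0 : 0 < tau by rewrite divr_gt0// mulr_gt0.
  have : \forall x \near x0, [/\ `|grad rho x0 - grad rho x| < tau,
      c / 2 < dot (grad rho x) (grad rho x) & Omega x <-> rho x < 0].
    have cg : grad rho @ x0 --> grad rho x0 by exact: continuous_grad.
    have cc : c / 2 < c by rewrite ltr_pdivrMr// ltr_pMr// ltr1n.
    have near1 : \forall x \near x0, `|grad rho x0 - grad rho x| < tau.
      by move/cvgrPdist_lt: cg; exact.
    have near2 : \forall x \near x0, c / 2 < dot (grad rho x) (grad rho x).
      exact: (cvgr_gt _ (cvg_dot cg cg) _ cc).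
    by apply: filterS (filterI near1 (filterI near2 nx)) => x [? [? ?]].
  move=> /nbhs_ballP[s' /= s'0 Hs'].
  have {}Hs' x : `|x - x0| < s' -> [/\ `|grad rho x0 - grad rho x| < tau,
      c / 2 < dot (grad rho x) (grad rho x) & Omega x <-> rho x < 0].
    by move=> xs; apply: Hs'; rewrite -ball_normE /= distrC.
  exists (Num.min s (s' / 2)); first by rewrite lt_min s0 divr_gt0.
  move=> x z bx; rewrite !lt_min => /andP[xs xs'] /andP[_ zs'].
  have seg (t : R) : 0 <= t <= 1 -> `|x + t *: (z - x) - x0| < s'.
    move=> /andP[t0 t1]; rewrite addrAC; apply: le_lt_trans (ler_normD _ _) _.
    rewrite (splitr s'); apply: ltrD => //; rewrite normrZ ger0_norm//.
    by apply: le_lt_trans zs'; rewrite ler_piMl.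
  have lx := Hs x xs bx.
  have nuE : nu x = (Num.sqrt (dot (grad rho x) (grad rho x)))^-1 *: grad rho x.
    exact: nu_normal.
  set n := Num.sqrt _ in nuE.
  have [|gx cx _] := Hs' x.
    by move: (seg 0); rewrite lexx ler01 scale0r addr0; exact.
  have [|_ _ Oz] := Hs' z.
    by move: (seg 1); rewrite lexx ler01 scale1r [x + _]addrC subrK; exact.
  have n0n : n0 <= n by rewrite ler_wsqrtr// ltW.
  have np : 0 < n := lt_le_trans n00 n0n.
  have nudot : dot (grad rho x) (z - x) = n * dot (nu x) (z - x).
    by rewrite nuE dotZl mulrA divff ?mul1r// gt_eqF.
  have [t /andP[t0 t1]] := MVT_line x (z - x) drho.
  rewrite [x + (z - x)]addrC subrK (local_defining_boundary bx lx) subr0 => rE.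
  have [|gt _ _] := Hs' (x + t *: (z - x)).
    by apply: seg; rewrite !ltW.
  have : `|rho z - n * dot (nu x) (z - x)| <= om * n0 * `|z - x|.
    rewrite rE -nudot -dotBl; apply: le_trans (dot_le_norm _ _) _.
    rewrite ler_wpM2r//.
    have : `|grad rho (x + t *: (z - x)) - grad rho x| <= 2 * tau.
      apply: le_trans (ler_distD (grad rho x0) _ _) _.
      rewrite mulr_natl mulr2n; apply: lerD; apply: ltW; last exact: gx.
      by rewrite distrC; exact: gt.
    move=> /(ler_wpM2l (ler0n R N)) H; apply: le_trans H _.
    have -> : N%:R * (2 * tau) = om * n0 * (N%:R / (N%:R + 1)).
      by rewrite /tau; field; rewrite gt_eqF ?ltr_wpDl.
    rewrite ler_piMr ?mulr_ge0 ?(ltW om0) ?(ltW n00)//.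
    by rewrite ler_pdivrMr ?mul1r ?lerDl// ltr_wpDl.
  rewrite ler_distl => /andP[r1 r2].
  have z0 := normr_ge0 (z - x).
  have omn : om * n0 * `|z - x| <= om * n * `|z - x|.
    by rewrite ler_wpM2r// ler_wpM2l// ltW.
  split=> [/Oz rz|dz].
    rewrite -(ler_pM2l np) mulrA (mulrC n om); apply: le_trans omn.
    by rewrite -subr_le0; exact: le_trans r1 (ltW rz).
  apply/Oz; apply: le_lt_trans r2 _; apply: le_lt_trans (lerD (lexx _) omn) _.
  have : n * dot (nu x) (z - x) < n * (- (om * `|z - x|)) by rewrite ltr_pM2l.
  by rewrite mulrN -subr_lt0 opprK mulrA (mulrC n om).
pose cone (r : R) (x : 'rV[R]_N) := boundary Omega x -> forall z, `|z - x| <= r ->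
    (Omega z -> dot (nu x) (z - x) <= om * `|z - x|) /\
    (dot (nu x) (z - x) < - (om * `|z - x|) -> Omega z).
have cov : \forall r \near 0^'+, boundary Omega `<=` cone r.
  apply: ((compact_near_coveringP _).1 boundary_compact R _ cone _) => x0 bx0.
  have [s s0 Hs] := loc x0 bx0.
  exists ([set x : 'rV[R]_N | `|x - x0| < s], [set r : R | r < s]) => /=.
    split; last exact: nbhs_right_lt.
    apply/nbhs_ballP; exists s => //= y; rewrite -ball_normE /= distrC//.
  move=> [x r] /= [xs rs] bx z zr; apply: Hs => //; exact: le_lt_trans zr rs.
near (0 : R)^'+ => r.
exists r; first by near: r; exact: nbhs_right_gt.
move=> x z bx zr; have Hr : boundary Omega `<=` cone r by near: r.
exact: (Hr x bx bx z zr).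
Unshelve. all: by end_near. Qed.

End C1Domain.

(** * Geometry of the thin domain *)

Section ThinDomainGeometry.
Context {R : realType} {N : nat}.
Variables (Omega : set 'rV[R]_N) (nu : 'rV[R]_N -> 'rV[R]_N).
Hypothesis Omega_open : open Omega.
Hypothesis Omega_bounded : bounded_set Omega.
Hypothesis Omega_C1 : C1_boundary Omega.
Hypothesis nu_normal : outward_unit_normal Omega nu.
Variables (gp gm : 'rV[R]_N -> R) (eps : R).
Hypothesis gp_C1 : C1 gp.
Hypothesis gm_C1 : C1 gm.
Hypothesis eps_gt0 : 0 < eps.

Local Notation thin := (thin Omega gp gm eps).
Local Notation lateral := (thin_lateral Omega gp gm eps).
Local Notation top := (thin_top Omega gp eps).
Local Notation bottom := (thin_bottom Omega gm eps).

Lemma continuous_xpart : continuous (@xpart R N).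
Proof. move=> z; exact/differentiable_continuous/differentiable_lsubmx. Qed.

Lemma continuous_ypart : continuous (@ypart R N).
Proof.
move=> z; rewrite (_ : @ypart R N = fun z => z 0 (rshift N ord0)).
  exact: coord_continuous.
by apply/funext => w; rewrite /ypart mxE.
Qed.

Lemma continuous_height (g : 'rV[R]_N -> R) : C1 g ->
  continuous (fun z : 'rV[R]_(N + 1) => eps * g (xpart z)).
Proof.
move=> cg z; have H : (fun w : 'rV[R]_(N + 1) => g (xpart w)) @ z --> g (xpart z).
  exact: (cvg_comp _ _ (@continuous_xpart z) (C1_continuous cg (x := _))).
exact: cvgM (@cst_continuous _ R eps z) H.
Qed.

Lemma norm_row_le (p : 'rV[R]_(N + 1)) : `|p| <= `|xpart p| + `|ypart p|.
Proof.
rewrite [leLHS]/Num.norm /= mx_normrE; apply/bigmax_leP; split; first exact: addr_ge0.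
move=> [i j] _ /=; rewrite ord1; case: (splitP j) => k jk.
  have -> : j = lshift 1 k by apply/val_inj.
  have -> : p 0 (lshift 1 k) = xpart p 0 k by rewrite /xpart mxE.
  by apply: le_trans (coord_le_norm _ _) _; rewrite lerDl.
have -> : j = rshift N ord0 by apply/val_inj; rewrite /= jk ord1.
have -> : p 0 (rshift N ord0) = ypart p by rewrite /ypart mxE.
by rewrite lerDr.
Qed.

Lemma thin_open : open thin.
Proof.
rewrite (_ : thin = (@xpart R N) @^-1` Omega `&`
  ((fun z : 'rV[R]_(N + 1) => ypart z - eps * gm (xpart z)) @^-1` [set t | 0 < t] `&`
   (fun z : 'rV[R]_(N + 1) => eps * gp (xpart z) - ypart z) @^-1` [set t | 0 < t])).
  apply: openI.
    by apply: open_comp => // z _; exact: continuous_xpart.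
  apply: openI; (apply: open_comp => [z _|]; last exact: open_gt).
    exact: cvgB (@continuous_ypart z) (@continuous_height gm gm_C1 z).
  exact: cvgB (@continuous_height gp gp_C1 z) (@continuous_ypart z).
apply/seteqP; split=> z; rewrite /= !subr_gt0.
  by move=> [Oz /andP[? ?]].
by move=> [Oz [? ?]]; split=> //; apply/andP.
Qed.

Lemma closed_slab : closed [set z : 'rV[R]_(N + 1) |
  eps * gm (xpart z) <= ypart z <= eps * gp (xpart z)].
Proof.
rewrite (_ : [set z | _] =
  ((fun z : 'rV[R]_(N + 1) => ypart z - eps * gm (xpart z)) @^-1` [set t | 0 <= t] `&`
   (fun z : 'rV[R]_(N + 1) => eps * gp (xpart z) - ypart z) @^-1` [set t | 0 <= t])).
  apply: closedI; (apply: closed_comp => [z _|]; last exact: closed_ge).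
    exact: cvgB (@continuous_ypart z) (@continuous_height gm gm_C1 z).
  exact: cvgB (@continuous_height gp gp_C1 z) (@continuous_ypart z).
by apply/seteqP; split=> z; rewrite /= !subr_ge0 => /andP.
Qed.

Lemma closed_graph (g : 'rV[R]_N -> R) : C1 g -> closed [set z : 'rV[R]_(N + 1) |
  closure Omega (xpart z) /\ ypart z = eps * g (xpart z)].
Proof.
move=> cg; rewrite (_ : [set z | _] = (@xpart R N) @^-1` closure Omega `&`
  (fun z : 'rV[R]_(N + 1) => ypart z - eps * g (xpart z)) @^-1` [set 0]).
  apply: closedI.
    by apply: closed_comp => [z _|]; [exact: continuous_xpart|exact: closed_closure].
  apply: closed_comp => [z _|]; last exact: closed_eq.
  exact: cvgB (@continuous_ypart z) (@continuous_height g cg z).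
apply/seteqP; split=> z /= [clx]; first by move=> ->; rewrite subrr.
by move=> /eqP; rewrite subr_eq0 => /eqP.
Qed.

Lemma lateral_closed : closed lateral.
Proof.
rewrite (_ : lateral = (@xpart R N) @^-1` boundary Omega `&` [set z |
  eps * gm (xpart z) <= ypart z <= eps * gp (xpart z)]) //.
apply: closedI closed_slab; apply: closed_comp; last exact: boundary_closed.
by move=> z _; exact: continuous_xpart.
Qed.

Lemma closure_thin z : closure thin z ->
  closure Omega (xpart z) /\ eps * gm (xpart z) <= ypart z <= eps * gp (xpart z).
Proof.
pose D := (@xpart R N) @^-1` closure Omega `&` [set z |
    eps * gm (xpart z) <= ypart z <= eps * gp (xpart z)].
have cD : closed D.
  apply: closedI closed_slab; apply: closed_comp; last exact: closed_closure.
  by move=> w _; exact: continuous_xpart.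
have sub : thin `<=` D.
  move=> w [Ow /andP[? ?]]; split; first exact: subset_closure.
  by apply/andP; split; exact: ltW.
by move=> /(closureS sub); rewrite -((closure_id D).1 cD).
Qed.

Lemma closure_thin_compact : compact (closure thin).
Proof.
have [M M0 HM] := closure_bounded Omega_bounded.
have cO := closure_compact Omega_bounded.
have [Gp Gp0 HGp] := continuous_bounded cO (C1_continuous gp_C1).
have [Gm Gm0 HGm] := continuous_bounded cO (C1_continuous gm_C1).
apply: bounded_closed_compact; last exact: closed_closure.
exists (M + eps * (Gp + Gm)); split; first exact: num_real.
move=> t tM z /closure_thin[cx /andP[y1 y2]] /=; apply: le_trans (norm_row_le z) _.
apply: le_trans (ltW tM); apply: lerD (HM _ cx) _.
have := HGp _ cx; have := HGm _ cx; rewrite !ler_norml => /andP[g1 g2] /andP[g3 g4].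
apply/andP; split.
  apply: le_trans y1; rewrite -mulrN ler_wpM2l ?(ltW eps_gt0)//; lra.
apply: le_trans y2 _; rewrite ler_wpM2l ?(ltW eps_gt0)//; lra.
Qed.

Lemma height_near (g : 'rV[R]_N -> R) x d c : C1 g -> c < eps * dot (grad g x) d ->
  \forall t \near 0^'+, eps * g x + t * c < eps * g (x + t *: d).
Proof.
move=> cg; rewrite -ltr_pdivrMl// => /(lt_near_dot_grad cg); apply: filterS => t.
by rewrite -(ltr_pM2l eps_gt0) mulrDr mulrCA mulVKf ?gt_eqF// (mulrC c) => H.
Qed.

(** Directions that strictly point into the thin domain at z: they enter Omega
    when x is on the boundary, and move strictly off the graphs through z.
    Only the conditions attached to the pieces containing z matter, so corners
    are covered. *)
Lemma inward_thin z (dx : 'rV[R]_N) (dy : R) : closure thin z ->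
  (lateral z -> dot (nu (xpart z)) dx < 0) ->
  (top z -> dy < eps * dot (grad gp (xpart z)) dx) ->
  (bottom z -> eps * dot (grad gm (xpart z)) dx < dy) ->
  \forall t \near 0^'+, thin (z + t *: row_mx dx (const_mx dy)).
Proof.
move=> /closure_thin[clx ybd] Hlat Htop Hbot; have /andP[yb yt] := ybd.
set x := xpart z; set d : 'rV[R]_(N + 1) := row_mx dx (const_mx dy).
have xd t : xpart (z + t *: d) = x + t *: dx.
  by rewrite /xpart linearD linearZ /= row_mxKl.
have yd t : ypart (z + t *: d) = ypart z + t * dy.
  by rewrite /ypart linearD linearZ /= row_mxKr mxE [X in _ + X]mxE [X in _ + _ * X]mxE.
have nearO : \forall t \near 0^'+, Omega (x + t *: dx).
  have [Ox|bx] := closure_boundary Omega_open clx.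
    by apply: near0_right; apply: near0_line; exact: open_nbhs_nbhs.
  have nd := Hlat (conj bx ybd).
  pose om := - dot (nu x) dx / (`|dx| + 1).
  have dx1 : 0 < `|dx| + 1 by rewrite ltr_wpDl.
  have om0 : 0 < om by rewrite divr_gt0// oppr_gt0.
  have omd : om * `|dx| < - dot (nu x) dx.
    rewrite /om mulrAC ltr_pdivrMr// ltr_pM2l ?oppr_gt0// ltrDl//.
  have [r r0 Hr] := uniform_cone Omega_open Omega_bounded Omega_C1 nu_normal om0.
  near=> t.
  have t0 : 0 < t by near: t; exact: nbhs_right_gt.
  have tr : t < r / (`|dx| + 1) by near: t; apply: nbhs_right_lt; rewrite divr_gt0.
  have E : x + t *: dx - x = t *: dx by rewrite addrC addKr.
  have [|_] := Hr x (x + t *: dx) bx; rewrite E.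
    rewrite normrZ gtr0_norm// ltW//; apply: le_lt_trans (_ : t * (`|dx| + 1) < _).
      by rewrite ler_pM2l// lerDl.
    by rewrite -ltr_pdivlMr.
  by apply; rewrite normrZ gtr0_norm// dotZr mulrCA -mulrN ltr_pM2l// ltrNr.
have nearT : \forall t \near 0^'+, ypart z + t * dy < eps * gp (x + t *: dx).
  move: yt; rewrite le_eqVlt => /orP[/eqP yt|yt].
    by rewrite yt; apply: height_near => //; apply: Htop.
  have : \forall w \near z, 0 < eps * gp (xpart w) - ypart w.
    rewrite -subr_gt0 in yt.
    exact: (cvgr_gt _ (cvgB (@continuous_height gp gp_C1 z) (@continuous_ypart z)) _ yt).
  move=> /(near0_line d)/near0_right; apply: filterS => t.
  by rewrite subr_gt0 xd yd.
have nearB : \forall t \near 0^'+, eps * gm (x + t *: dx) < ypart z + t * dy.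
  move: yb; rewrite le_eqVlt => /orP[/eqP yb|yb].
    have : - dy < eps * dot (grad (\- gm) x) dx.
      by rewrite (gradN (gm_C1.1 x)) dotNl mulrN ltrN2; apply: Hbot.
    move=> /(height_near (C1N gm_C1)); apply: filterS => t.
    by rewrite -yb /= !mulrN -opprD ltrN2.
  have : \forall w \near z, 0 < ypart w - eps * gm (xpart w).
    rewrite -subr_gt0 in yb.
    exact: (cvgr_gt _ (cvgB (@continuous_ypart z) (@continuous_height gm gm_C1 z)) _ yb).
  move=> /(near0_line d)/near0_right; apply: filterS => t.
  by rewrite subr_gt0 xd yd.
apply: filterS (filterI nearO (filterI nearT nearB)) => t [tO [tT tB]].
by split; rewrite xd ?yd// tB tT.
Unshelve. all: by end_near. Qed.

End ThinDomainGeometry.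

(** * Strict sub- and supersolutions at a point *)

Section Convergence.
Context {R : realType}.

Lemma cvg_within_comp (T : Type) (U V : topologicalType) (G : set_system T) {FG : Filter G}
    (A : set U) (a : T -> U) (a0 : U) (f : U -> V) (l : V) :
  a @ G --> a0 -> (\forall q \near G, A (a q)) -> f @ within A (nbhs a0) --> l ->
  (fun q => f (a q)) @ G --> l.
Proof.
move=> ca nA cf P /cf wP; have := ca _ wP.
by rewrite /= !nbhs_filterE => H; apply: filterS2 nA H => q Aq; exact.
Qed.

Lemma within_cvg (U V : topologicalType) (A : set U) (f : U -> V) x :
  {within A, continuous f} -> A x -> f @ within A (nbhs x) --> f x.
Proof. by move=> /subspace_continuousP; exact. Qed.

Lemma cvg_fst_comp (T : Type) (U V : topologicalType) (G : set_system T)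
    (f : T -> U * V) (l : U * V) : f @ G --> l -> (fun t => (f t).1) @ G --> l.1.
Proof. move=> cf; apply: (cvg_comp _ _ cf); case: l {cf} => a b; exact: cvg_fst. Qed.

Lemma cvg_snd_comp (T : Type) (U V : topologicalType) (G : set_system T)
    (f : T -> U * V) (l : U * V) : f @ G --> l -> (fun t => (f t).2) @ G --> l.2.
Proof. move=> cf; apply: (cvg_comp _ _ cf); case: l {cf} => a b; exact: cvg_snd. Qed.

Lemma dot_row_mx N (a : 'rV[R]_N) (c : R) (p : 'rV[R]_(N + 1)) :
  dot (row_mx a (const_mx c)) p = dot a (xpart p) + c * ypart p.
Proof.
rewrite /dot big_split_ord /= big_ord1; congr (_ + _).
  by apply: eq_bigr => i _; rewrite row_mxEl /xpart [in RHS]mxE.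
by rewrite row_mxEr mxE /ypart mxE.
Qed.

Lemma grad_scaled_dist_sq n (e : R) (c w : 'rV[R]_n) :
  grad (fun y => e * dist_sq c y) w = (2 * e) *: (w - c).
Proof.
rewrite scaled_dist_sqE grad_diag_quad; apply/rowP => i; rewrite !mxE; ring.
Qed.

Lemma hess_scaled_dist_sq n (e : R) (c w : 'rV[R]_n) :
  hess (fun y => e * dist_sq c y) w = (2 * e)%:M.
Proof.
rewrite scaled_dist_sqE hess_diag_quad; apply/matrixP => i j; rewrite !mxE; ring.
Qed.

End Convergence.

Section Strictness.
Context {R : realType} {N : nat}.
Variables (Omega : set 'rV[R]_N) (nu : 'rV[R]_N -> 'rV[R]_N).
Hypothesis Omega_open : open Omega.
Hypothesis Omega_bounded : bounded_set Omega.
Hypothesis Omega_C1 : C1_boundary Omega.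
Hypothesis nu_normal : outward_unit_normal Omega nu.
Variables (gp gm : 'rV[R]_N -> R) (eps : R).
Hypothesis gp_C1 : C1 gp.
Hypothesis gm_C1 : C1 gm.
Hypothesis gm_lt_gp : forall x, closure Omega x -> gm x < gp x.
Hypothesis eps_gt0 : 0 < eps.
Variables (gam1p gam1m : 'rV[R]_N -> R -> 'rV[R]_N).
Hypothesis gam1p_cont : {within closure Omega `*` `[-1, 1], continuous (uncurry gam1p)}.
Hypothesis gam1m_cont : {within closure Omega `*` `[-1, 1], continuous (uncurry gam1m)}.

Local Notation thin := (thin Omega gp gm eps).
Local Notation lateral := (thin_lateral Omega gp gm eps).
Local Notation top := (thin_top Omega gp eps).
Local Notation bottom := (thin_bottom Omega gm eps).

Hypothesis thin_unit : forall z, closure thin z -> ypart z \in `[-1, 1].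

Implicit Types (F : 'M[R]_(N + 1) -> 'rV[R]_(N + 1) -> R -> 'rV[R]_N -> R -> R)
  (betap betam : 'rV[R]_N -> R -> R) (X : 'M[R]_(N + 1)) (p : 'rV[R]_(N + 1)) (r : R)
  (z : 'rV[R]_(N + 1)).

(** The negation of the alternative in the definition of a subsolution, in terms
    of the second-order jet of the test function. *)
Definition strict_at F betap betam X p r z : Prop :=
  [/\ 0 < F X p r (xpart z) (ypart z),
      lateral z -> 0 < dot (nu (xpart z)) (xpart p),
      top z -> betap (xpart z) (ypart z) < dot (gammap gam1p z) p &
      bottom z -> betam (xpart z) (ypart z) < dot (gammam gam1m z) p].

(** The operator satisfied by - u when u satisfies F. *)
Definition reflect_op F : 'M[R]_(N + 1) -> 'rV[R]_(N + 1) -> R -> 'rV[R]_N -> R -> R :=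
  fun X p r x y => - F (- X) (- p) (- r) x y.

Definition reflect_data (b : 'rV[R]_N -> R -> R) : 'rV[R]_N -> R -> R :=
  fun x y => - b x y.

Definition F_domain : set ('M[R]_(N + 1) * 'rV[R]_(N + 1) * R * 'rV[R]_N * R) :=
  [set a : 'M[R]_(N + 1) * 'rV[R]_(N + 1) * R * 'rV[R]_N * R |
    let: (X, p, r, x, y) := a in
    [/\ X \is symmetricmx, closure Omega x & y \in `[-1, 1]]].

Definition F_uncurried F (a : 'M[R]_(N + 1) * 'rV[R]_(N + 1) * R * 'rV[R]_N * R) : R :=
  let: (X, p, r, x, y) := a in F X p r x y.

(** Strictness is an open condition even at corners: a closed piece of the
    boundary that does not contain z is avoided near z, and on a piece that
    contains z the data and the normal are continuous. *)
Lemma strict_at_near F betap betam (T : Type) (G : set_system T) {FG : Filter G}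
    (X_ : T -> 'M[R]_(N + 1)) (p_ : T -> 'rV[R]_(N + 1)) (r_ : T -> R)
    (z_ : T -> 'rV[R]_(N + 1)) X p r z :
  {within F_domain, continuous (F_uncurried F)} ->
  {within closure Omega `*` `[-1, 1], continuous (uncurry betap)} ->
  {within closure Omega `*` `[-1, 1], continuous (uncurry betam)} ->
  X \is symmetricmx -> closure thin z ->
  X_ @ G --> X -> p_ @ G --> p -> r_ @ G --> r -> z_ @ G --> z ->
  (\forall q \near G, X_ q \is symmetricmx /\ closure thin (z_ q)) ->
  strict_at F betap betam X p r z ->
  \forall q \near G, strict_at F betap betam (X_ q) (p_ q) (r_ q) (z_ q).
Proof.
move=> cF cbp cbm sX Kz cX cp cr cz nK [SF Sl St Sb].
have [clx yzb] := closure_thin gp_C1 gm_C1 Kz.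
have cx : (fun q => xpart (z_ q)) @ G --> xpart z.
  exact: (cvg_comp _ _ cz (@continuous_xpart _ _ z)).
have cy : (fun q => ypart (z_ q)) @ G --> ypart z.
  exact: (cvg_comp _ _ cz (@continuous_ypart _ _ z)).
have cpx : (fun q => xpart (p_ q)) @ G --> xpart p.
  exact: (cvg_comp _ _ cp (@continuous_xpart _ _ p)).
have cpy : (fun q => ypart (p_ q)) @ G --> ypart p.
  exact: (cvg_comp _ _ cp (@continuous_ypart _ _ p)).
have cyc (c : R) : (fun q => c * ypart (p_ q)) @ G --> c * ypart p.
  by apply: (@cvgM _ _ _ _ (fun=> c)) cpy; exact: (@cvg_cst R).
have nxy : \forall q \near G, (closure Omega `*` `[-1, 1]) (xpart (z_ q), ypart (z_ q)).
  apply: filterS nK => q [_ Kq]; split=> /=; last exact: thin_unit.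
  by have [] := closure_thin gp_C1 gm_C1 Kq.
have cdata (V : topologicalType) (b : 'rV[R]_N -> R -> V) :
    {within closure Omega `*` `[-1, 1], continuous (uncurry b)} ->
    (fun q => b (xpart (z_ q)) (ypart (z_ q))) @ G --> b (xpart z) (ypart z).
  move=> cb; have := within_cvg cb (x := (xpart z, ypart z)).
  move=> /(_ (conj clx (thin_unit Kz))).
  move=> H.
  have cxy : (fun q => (xpart (z_ q), ypart (z_ q))) @ G --> (xpart z, ypart z).
    exact: cvg_pair cx cy.
  exact: (@cvg_within_comp _ _ _ G FG _ _ _ _ _ cxy nxy H).
have on_closed (P : set T) (E : set 'rV[R]_(N + 1)) : closed E ->
    (E z -> \forall q \near G, E (z_ q) -> P q) -> \forall q \near G, E (z_ q) -> P q.
  move=> cE; have [Ez|nEz] := pselect (E z); first exact.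
  move=> _; have : \forall w \near z, ~ E w by exact: (closed_openC cE).
  move=> /cz nE; have {}nE : \forall q \near G, ~ E (z_ q) by exact: nE.
  by apply: filterS nE => q nE /nE.
have nF : \forall q \near G, 0 < F (X_ q) (p_ q) (r_ q) (xpart (z_ q)) (ypart (z_ q)).
  have dom : F_domain (X, p, r, xpart z, ypart z) by split => //; exact: thin_unit.
  have ca : (fun q => (X_ q, p_ q, r_ q, xpart (z_ q), ypart (z_ q))) @ G -->
      (X, p, r, xpart z, ypart z).
    have c2 : (fun q => (X_ q, p_ q)) @ G --> (X, p) by exact: cvg_pair cX cp.
    have c3 : (fun q => (X_ q, p_ q, r_ q)) @ G --> (X, p, r) by exact: cvg_pair c2 cr.
    have c4 : (fun q => (X_ q, p_ q, r_ q, xpart (z_ q))) @ G --> (X, p, r, xpart z).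
      exact: cvg_pair c3 cx.
    exact: cvg_pair c4 cy.
  have na : \forall q \near G,
      F_domain (X_ q, p_ q, r_ q, xpart (z_ q), ypart (z_ q)).
    by apply: filterS2 nK nxy => q [? _] [? ?]; split.
  have H := @cvg_within_comp _ _ _ G FG _ _ _ _ _ ca na (within_cvg cF dom).
  exact: (cvgr_gt _ H _ SF).
have nl : \forall q \near G, lateral (z_ q) -> 0 < dot (nu (xpart (z_ q))) (xpart (p_ q)).
  apply: (on_closed _ lateral); first exact: lateral_closed.
  move=> lz; rewrite -near_withinE.
  have cw (U : topologicalType) (f : T -> U) (l : U) : f @ G --> l ->
      f @ within (fun q => lateral (z_ q)) G --> l.
    by move=> cf; apply: cvg_trans cf; apply: cvg_app; exact: cvg_within.
  have cnu : (fun q => nu (xpart (z_ q))) @ within (fun q => lateral (z_ q)) G -->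
      nu (xpart z).
    have nl : \forall q \near within (fun q => lateral (z_ q)) G,
        boundary Omega (xpart (z_ q)).
      by rewrite near_withinE; apply: filterE => q; case.
    have cx' := cw _ _ _ cx.
    have Hnu := nu_cvg Omega_C1 nu_normal lz.1.
    exact: (@cvg_within_comp _ _ _ _ (within_filter _ FG) _ _ _ _ _ cx' nl Hnu).
  exact: (cvgr_gt _ (cvg_dot cnu (cw _ _ _ cpx)) _ (Sl lz)).
have nt : \forall q \near G, top (z_ q) ->
    betap (xpart (z_ q)) (ypart (z_ q)) < dot (gammap gam1p (z_ q)) (p_ q).
  apply: (on_closed _ top); first exact: closed_graph.
  move=> tz; have := St tz; rewrite -subr_gt0 /gammap dot_row_mx => S0.
  have H : (fun q => dot (gam1p (xpart (z_ q)) (ypart (z_ q))) (xpart (p_ q)) +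
      1 * ypart (p_ q) - betap (xpart (z_ q)) (ypart (z_ q))) @ G -->
      dot (gam1p (xpart z) (ypart z)) (xpart p) + 1 * ypart p - betap (xpart z) (ypart z).
    exact: cvgB (cvgD (cvg_dot (cdata _ _ gam1p_cont) cpx) (cyc 1)) (cdata _ _ cbp).
  apply: filterS (cvgr_gt _ H _ S0) => q; rewrite subr_gt0 => Hq _.
  by rewrite dot_row_mx.
have nb : \forall q \near G, bottom (z_ q) ->
    betam (xpart (z_ q)) (ypart (z_ q)) < dot (gammam gam1m (z_ q)) (p_ q).
  apply: (on_closed _ bottom); first exact: closed_graph.
  move=> tz; have := Sb tz; rewrite -subr_gt0 /gammam dot_row_mx => S0.
  have H : (fun q => dot (gam1m (xpart (z_ q)) (ypart (z_ q))) (xpart (p_ q)) +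
      (-1) * ypart (p_ q) - betam (xpart (z_ q)) (ypart (z_ q))) @ G -->
      dot (gam1m (xpart z) (ypart z)) (xpart p) + (-1) * ypart p - betam (xpart z) (ypart z).
    exact: cvgB (cvgD (cvg_dot (cdata _ _ gam1m_cont) cpx) (cyc (-1))) (cdata _ _ cbm).
  apply: filterS (cvgr_gt _ H _ S0) => q; rewrite subr_gt0 => Hq _.
  by rewrite dot_row_mx.
apply: filterS2 (filterI nF nl) (filterI nt nb) => q [? ?] [? ?].
by split.
Qed.

Definition strict_super F betap betam (phi : 'rV[R]_(N + 1) -> R) z r : Prop :=
  strict_at F betap betam (hess phi z) (grad phi z) r z.

Definition strict_sub F betap betam (phi : 'rV[R]_(N + 1) -> R) z r : Prop :=
  strict_at (reflect_op F) (reflect_data betap) (reflect_data betam)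
    (- hess phi z) (- grad phi z) (- r) z.

Lemma strict_subN F betap betam phi z r : C2 phi ->
  strict_sub F betap betam phi z r <->
  strict_super (reflect_op F) (reflect_data betap) (reflect_data betam) (\- phi) z (- r).
Proof.
by move=> cphi; rewrite /strict_super hessN// gradN//; have [[]] := cphi.
Qed.

Lemma reflect_op_cont F : {within F_domain, continuous (F_uncurried F)} ->
  {within F_domain, continuous (F_uncurried (reflect_op F))}.
Proof.
move=> cF; apply/subspace_continuousP => -[[[[X p] r] x] y] /= dom.
pose neg (a : 'M[R]_(N + 1) * 'rV[R]_(N + 1) * R * 'rV[R]_N * R) :=
  (- a.1.1.1.1, - a.1.1.1.2, - a.1.1.2, a.1.2, a.2).
have sN (M : 'M[R]_(N + 1)) : M \is symmetricmx -> - M \is symmetricmx.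
  by rewrite !symmetricmxE => /eqP sM; rewrite linearN /= -sM.
have domN a : F_domain a -> F_domain (neg a).
  by case: a => [[[[X' p'] r'] x'] y'] [? ? ?]; split=> //; exact: sN.
have cneg : continuous neg.
  move=> a.
  pose T := ('M[R]_(N + 1) * 'rV[R]_(N + 1) * R * 'rV[R]_N * R)%type.
  have f0 : id @ a --> a by exact: cvg_id.
  have f1 := cvg_fst_comp f0; have f2 := cvg_fst_comp f1; have f3 := cvg_fst_comp f2.
  have n4 : (fun b : T => - b.1.1.1.1) @ a --> - a.1.1.1.1.
    exact: cvgN (cvg_fst_comp f3).
  have m4 : (fun b : T => - b.1.1.1.2) @ a --> - a.1.1.1.2.
    exact: cvgN (cvg_snd_comp f3).
  have m3 : (fun b : T => - b.1.1.2) @ a --> - a.1.1.2.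
    exact: cvgN (cvg_snd_comp f2).
  have m2 : (fun b : T => b.1.2) @ a --> a.1.2 by exact: (cvg_snd_comp f1).
  have m1 : (fun b : T => b.2) @ a --> a.2 by exact: (cvg_snd_comp f0).
  have h1 : (fun b : T => (- b.1.1.1.1, - b.1.1.1.2)) @ a --> (- a.1.1.1.1, - a.1.1.1.2).
    exact: cvg_pair n4 m4.
  have h2 : (fun b : T => (- b.1.1.1.1, - b.1.1.1.2, - b.1.1.2)) @ a -->
      (- a.1.1.1.1, - a.1.1.1.2, - a.1.1.2).
    exact: cvg_pair h1 m3.
  have h3 : (fun b : T => (- b.1.1.1.1, - b.1.1.1.2, - b.1.1.2, b.1.2)) @ a -->
      (- a.1.1.1.1, - a.1.1.1.2, - a.1.1.2, a.1.2).
    exact: cvg_pair h2 m2.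
  exact: cvg_pair h3 m1.
pose a0 := (X, p, r, x, y).
have cw : neg @ within F_domain (nbhs a0) --> neg a0.
  by apply: cvg_trans (cneg a0); apply: cvg_app; exact: cvg_within.
have nw : \forall a \near within F_domain (nbhs a0), F_domain (neg a).
  by rewrite near_withinE; apply: filterE => a; exact: domN.
have H : (fun a => F_uncurried F (neg a)) @ within F_domain (nbhs a0) -->
    F_uncurried F (neg a0).
  exact: (cvg_within_comp cw nw (within_cvg cF (domN a0 dom))).
rewrite (_ : F_uncurried (reflect_op F) = \- (fun a => F_uncurried F (neg a))); last first.
  by apply/funext => -[[[[X' p'] r'] x'] y'].
exact: cvgN H.
Qed.

Lemma reflect_data_cont (b : 'rV[R]_N -> R -> R) :
  {within closure Omega `*` `[-1, 1], continuous (uncurry b)} ->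
  {within closure Omega `*` `[-1, 1], continuous (uncurry (reflect_data b))}.
Proof.
move=> cb; have -> : uncurry (reflect_data b) = (fun a => - uncurry b a).
  by apply/funext => -[].
apply/subspace_continuousP => a Aa; exact: cvgN (within_cvg cb Aa).
Qed.

Lemma strict_super_stable F betap betam :
  {within F_domain, continuous (F_uncurried F)} ->
  {within closure Omega `*` `[-1, 1], continuous (uncurry betap)} ->
  {within closure Omega `*` `[-1, 1], continuous (uncurry betam)} ->
  stable (closure thin) 1 (strict_super F betap betam).
Proof.
move=> cF cbp cbm phi z r cphi Kz S.
(* The strength q.1.1 of the perturbation is one of the variables, tending to 0. *)
pose D := [set q : R * 'rV[R]_(N + 1) * R | closure thin q.1.2].
pose q0 : R * 'rV[R]_(N + 1) * R := (0, z, r).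
pose G := within D (nbhs q0).
have c0 : id @ q0 --> q0 by exact: cvg_id.
have ce := cvg_fst_comp (cvg_fst_comp c0); have cz := cvg_snd_comp (cvg_fst_comp c0).
have cr := cvg_snd_comp c0; rewrite /= in ce cz cr.
pose X_ (q : R * 'rV[R]_(N + 1) * R) := hess phi q.1.2 + (2 * q.1.1)%:M.
pose p_ (q : R * 'rV[R]_(N + 1) * R) := grad phi q.1.2 + (2 * q.1.1) *: (q.1.2 - z).
have toG (U : topologicalType) (f : R * 'rV[R]_(N + 1) * R -> U) (l : U) :
    f @ q0 --> l -> f @ G --> l.
  by move=> cf; apply: cvg_trans cf; apply: cvg_app; exact: cvg_within.
have c2e : (fun q : R * 'rV[R]_(N + 1) * R => 2 * q.1.1) @ q0 --> (0 : R).
  rewrite -[0 in X in _ --> X](mulr0 2).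
  by apply: (@cvgM _ _ _ _ (fun=> 2)) ce; exact: (@cvg_cst R).
have cX : X_ @ q0 --> hess phi z.
  rewrite -[hess phi z]addr0; apply: cvgD.
    exact: (cvg_comp _ _ cz (continuous_hess cphi (x := z))).
  apply: cvg_mx => i j; rewrite mxE.
  rewrite (_ : (fun s => _) = fun q : R * 'rV[R]_(N + 1) * R => 2 * q.1.1 * (i == j)%:R).
    rewrite -[0 in X in _ --> X](mul0r ((i == j)%:R : R)).
    by apply: (@cvgM _ _ _ _ _ (fun=> _)) c2e _; exact: (@cvg_cst R).
  by apply/funext => q; rewrite mxE mulr_natr.
have cp : p_ @ q0 --> grad phi z.
  rewrite -[grad phi z]addr0; apply: cvgD.
    exact: (cvg_comp _ _ cz (continuous_grad cphi.1 (x := z))).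
  rewrite -[0 in X in _ --> X](scale0r (z - z)).
  by apply: cvgZ c2e (cvgB cz _); exact: cvg_cst.
have nS : \forall q \near G, X_ q \is symmetricmx /\ closure thin q.1.2.
  rewrite near_withinE; apply: filterE => q Dq; split=> //.
  rewrite symmetricmxE linearD /= tr_scalar_mx; apply/eqP; congr (_ + _).
  by have := hess_sym q.1.2 cphi; rewrite symmetricmxE => /eqP.
have := strict_at_near cF cbp cbm (hess_sym z cphi) Kz (toG _ _ _ cX) (toG _ _ _ cp)
  (toG _ _ _ cr) (toG _ _ _ cz) nS S.
rewrite near_withinE => H.
have [d /= d0 Hd] : nbhs_ball q0 (fun q => D q -> strict_at F betap betam (X_ q) (p_ q) q.2 q.1.2).
  by apply/nbhs_ballP; exact: H.
have d20 : 0 < d / 2 by rewrite divr_gt0.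
exists (d / 2), d; split=> // w t Kw wz tr.
have cq := C2_scaled_dist_sq (1 * (d / 2)) z.
rewrite /strict_super (hessD w cphi cq) (gradD (cphi.1.1 w) (cq.1.1 w)).
rewrite hess_scaled_dist_sq grad_scaled_dist_sq mul1r.
apply: (Hd (d / 2, w, t)) => //; split=> /=; last by rewrite -ball_normE /= distrC.
split=> /=; last by rewrite -ball_normE /= distrC.
rewrite -ball_normE /= sub0r normrN gtr0_norm// ltr_pdivrMr// ltr_pMr//.
by rewrite ltr1n.
Qed.

Lemma strict_sub_stable F betap betam :
  {within F_domain, continuous (F_uncurried F)} ->
  {within closure Omega `*` `[-1, 1], continuous (uncurry betap)} ->
  {within closure Omega `*` `[-1, 1], continuous (uncurry betam)} ->
  stable (closure thin) (-1) (strict_sub F betap betam).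
Proof.
move=> cF cbp cbm phi z r cphi Kz /(strict_subN _ _ _ _ _ cphi) S.
have [eta [d [eta0 d0 Hd]]] := strict_super_stable (reflect_op_cont cF)
  (reflect_data_cont cbp) (reflect_data_cont cbm) (C2N cphi) Kz S.
exists eta, d; split=> // w t Kw wz tr.
apply/strict_subN; first exact: C2D cphi (C2_scaled_dist_sq _ _).
have -> : \- (phi \+ fun y => (-1 * eta) * dist_sq z y) =
    \- phi \+ fun y => (1 * eta) * dist_sq z y.
  by apply/funext => y /=; rewrite opprD mulN1r mulNr opprK mul1r.
by apply: Hd => //; rewrite -opprD normrN.
Qed.

Lemma dot_const_le (a : 'rV[R]_N) v (A B : R) : `|a| <= A -> `|v| <= B ->
  `|dot a v| <= N%:R * A * B.
Proof.
move=> aA vB; apply: le_trans (dot_le_norm _ _) _; rewrite -!mulrA.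
by rewrite ler_wpM2l// ler_pM.
Qed.

(** At a boundary point the difference of a strict subsolution and a strict
    supersolution has positive derivative along a suitable inward direction.
    On the top and bottom the direction is the opposite of the oblique field;
    at a corner a large multiple of the inner normal is added, and the thinness
    of the domain keeps the direction inward. *)
Lemma strict_compare F betap betam alpha Gam G1 psi phi z r :
  (forall (p : 'rV[R]_(N + 1)) (x : 'rV[R]_N) (y : R),
     closure Omega x -> y \in `[-1, 1] ->
     forall (X Y : 'M[R]_(N + 1)) (r s : R),
       X \is symmetricmx -> Y \is symmetricmx -> psd_le Y X -> r <= s ->
       F X p r x y - alpha * r <= F Y p s x y - alpha * s) ->
  (forall x y, closure Omega x -> y \in `[-1, 1] ->
     `|gam1p x y| <= Gam /\ `|gam1m x y| <= Gam) ->
  (forall x, closure Omega x -> `|grad gp x| <= G1 /\ `|grad gm x| <= G1) ->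
  eps * (N%:R * G1 * (1 + N%:R * Gam + Gam)) < 1 ->
  C2 psi -> C2 phi -> closure thin z ->
  (forall w, closure thin w -> psi w - phi w <= psi z - phi z) ->
  strict_sub F betap betam psi z r -> strict_super F betap betam phi z r -> False.
Proof.
move=> F_mono Hgam Hg eps1 cpsi cphi Kz zmax [SF Sl St Sb] [TF Tl Tt Tb].
have [clx ybd] := closure_thin gp_C1 gm_C1 Kz; have yu := thin_unit Kz.
set x := xpart z in clx ybd SF Sl St Sb TF Tl Tt Tb *.
pose chi := psi \+ \- phi.
have cchi : C2 chi := C2D cpsi (C2N cphi).
have gchi : grad chi z = grad psi z - grad phi z.
  by rewrite (gradD (cpsi.1.1 z) ((C2N cphi).1.1 z)) (gradN (cphi.1.1 z)).
have hchi : hess chi z = hess psi z - hess phi z.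
  by rewrite (hessD z cpsi (C2N cphi)) (hessN z cphi).
have xN (p : 'rV[R]_(N + 1)) : xpart (- p) = - xpart p by rewrite /xpart linearN.
have xB (p q : 'rV[R]_(N + 1)) : xpart (p - q) = xpart p - xpart q by rewrite /xpart linearB.
have lat_neg : lateral z -> dot (nu x) (xpart (grad chi z)) < 0.
  move=> lz; have := Sl lz; have := Tl lz.
  rewrite xN dotNr gchi xB dotBr; lra.
have top_neg : top z -> dot (gammap gam1p z) (grad chi z) < 0.
  move=> tz; have := St tz; have := Tt tz.
  rewrite dotNr /reflect_data gchi dotBr; lra.
have bot_neg : bottom z -> dot (gammam gam1m z) (grad chi z) < 0.
  move=> tz; have := Sb tz; have := Tb tz.
  rewrite dotNr /reflect_data gchi dotBr; lra.
have feasible (dx : 'rV[R]_N) (dy : R) :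
    (lateral z -> dot (nu x) dx < 0) ->
    (top z -> dy < eps * dot (grad gp x) dx) ->
    (bottom z -> eps * dot (grad gm x) dx < dy) ->
    dot dx (xpart (grad chi z)) + dy * ypart (grad chi z) <= 0.
  move=> Hl Ht Hb; rewrite -dot_row_mx dotC; apply: dot_grad_le0 cchi.1 _.
  have := inward_thin Omega_open Omega_bounded Omega_C1 nu_normal gp_C1 gm_C1 eps_gt0
    Kz Hl Ht Hb.
  apply: filterS => t tt; rewrite /chi /=; apply: zmax; exact: subset_closure.
have [Gp Gm] := Hg x clx; have [gamp gamm] := Hgam x (ypart z) clx yu.
have Gam0 : 0 <= Gam := le_trans (normr_ge0 _) gamp.
have G10 : 0 <= G1 := le_trans (normr_ge0 _) Gp.
(* a exceeds |nu . gamma|, so that a nu + gamma points out of the lateral side. *)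
pose a := 1 + N%:R * Gam.
have a0 : 0 < a by rewrite /a ltr_pwDl// mulr_ge0.
have [n [nl n0]] : exists n : 'rV[R]_N, (lateral z -> n = nu x) /\ (~ lateral z -> n = 0).
  by have [lz|nlz] := pselect (lateral z); [exists (nu x)|exists 0].
have an : `|a *: n| <= a.
  rewrite normrZ gtr0_norm// ler_piMr ?(ltW a0)//.
  have [lz|/n0 ->] := pselect (lateral z); last by rewrite normr0.
  by rewrite nl//; exact: (nu_norm_le1 Omega_C1 nu_normal lz.1).
have nchi : dot (a *: n) (xpart (grad chi z)) <= 0.
  rewrite dotZl pmulr_rle0//.
  have [lz|/n0 ->] := pselect (lateral z); last by rewrite dot0l.
  by rewrite nl//; exact: ltW (lat_neg lz).
have small g v : `|grad g x| <= G1 -> `|v| <= Gam ->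
    eps * `|dot (grad g x) (a *: n + v)| < 1.
  move=> gG vG; apply: le_lt_trans eps1; rewrite ler_wpM2l ?(ltW eps_gt0)//.
  apply: dot_const_le => //; apply: le_trans (ler_normD _ _) _; exact: lerD.
have lat_dir v : `|v| <= Gam -> lateral z -> dot (nu x) (- (a *: n + v)) < 0.
  move=> vG lz; rewrite dotNr dotDr dotZr oppr_lt0 nl//.
  rewrite (nu_unit Omega_C1 nu_normal lz.1) mulr1 /a.
  have := dot_const_le (nu_norm_le1 Omega_C1 nu_normal lz.1) vG.
  rewrite mulr1 ler_norml => /andP[]; lra.
have ttb : top z -> bottom z -> False.
  move=> [_ tz] [_ bz]; have := gm_lt_gp clx.
  by rewrite -(ltr_pM2l eps_gt0) -tz -bz ltxx.
have [tz|ntz] := pselect (top z).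
  have := top_neg tz; rewrite /gammap dot_row_mx mul1r => neg.
  have := feasible (- (a *: n + gam1p x (ypart z))) (- 1) (lat_dir _ gamp) _ _.
  rewrite dotNl dotDl mulN1r => H; suff : 0 < 0 :> R by rewrite ltxx.
  apply: lt_le_trans (H _ _) => [|_|/(ttb tz)//].
    by rewrite -opprD oppr_gt0; rewrite -/x in neg; lra.
  have := small _ _ Gp gamp; rewrite dotNr mulrN ltrN2.
  by apply: le_lt_trans; rewrite ler_wpM2l ?(ltW eps_gt0)// ler_norm.
have [bz|nbz] := pselect (bottom z).
  have := bot_neg bz; rewrite /gammam dot_row_mx => neg.
  have := feasible (- (a *: n + gam1m x (ypart z))) 1 (lat_dir _ gamm) _ _.
  rewrite dotNl dotDl mul1r => H; suff : 0 < 0 :> R by rewrite ltxx.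
  apply: lt_le_trans (H _ _) => [|/ntz//|_].
    by rewrite -/x in neg; lra.
  have := small _ _ Gm gamm; rewrite dotNr mulrN; apply: le_lt_trans.
  by rewrite -mulrN ler_wpM2l ?(ltW eps_gt0)// -normrN ler_norm.
have [lz|nlz] := pselect (lateral z).
  have := feasible (- nu x) 0 _ _ _.
  rewrite dotNl mul0r addr0 oppr_le0 => H; have := lat_neg lz.
  rewrite ltNge => /negP; apply; apply: H => // _.
  by rewrite dotNr (nu_unit Omega_C1 nu_normal lz.1) oppr_lt0.
have tz : thin z.
  have [Ox|bx] := closure_boundary Omega_open clx; last by case: nlz; split.
  split=> //; have /andP[y1 y2] := ybd; rewrite !lt_neqAle y1 y2 !andbT.
  by apply/andP; split; apply/eqP => E; [apply: nbz|apply: ntz]; split.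
have [|g0 h0] := @interior_max _ _ chi z cchi.
  have := open_nbhs_nbhs (conj (thin_open Omega_open gp_C1 gm_C1) tz).
  by apply: filterS => w tw; rewrite /chi /=; apply: zmax; exact: subset_closure.
have gE : grad psi z = grad phi z by apply/eqP; rewrite -subr_eq0 -gchi g0.
have hle : psd_le (hess psi z) (hess phi z).
  by move=> v; have := h0 v; rewrite mulmx0 dot0l hchi mulmxBr dotBl subr_le0.
have := F_mono (grad phi z) x (ypart z) clx yu (hess phi z) (hess psi z) r r
  (hess_sym z cphi) (hess_sym z cpsi) hle (lexx r).
rewrite lerD2r => FF; move: SF; rewrite /reflect_op !opprK gE oppr_gt0 => SF.
by have := lt_trans (lt_le_trans TF FF) SF; rewrite ltxx.
Qed.

End Strictness.

(** * Inner parallel sets *)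

Section InnerParallelSet.
Context {R : realType} {N : nat}.
Variables (Omega : set 'rV[R]_N) (nu : 'rV[R]_N -> 'rV[R]_N).
Hypothesis Omega_open : open Omega.
Hypothesis Omega_bounded : bounded_set Omega.
Hypothesis Omega_nonempty : Omega !=set0.
Hypothesis Omega_C1 : C1_boundary Omega.
Hypothesis nu_normal : outward_unit_normal Omega nu.

Lemma norm_le_dist_sq (c w : 'rV[R]_N) (t : R) : 0 <= t -> dist_sq c w <= t ^+ 2 ->
  `|w - c| <= t.
Proof.
move=> t0 H; rewrite -(@ler_pXn2r _ 2)// ?nnegrE//.
exact: le_trans (norm_sqr_le_dot _) H.
Qed.

Lemma dist_sq_cvg (T : Type) (G : set_system T) {FG : Filter G} (f g : T -> 'rV[R]_N) a b :
  f @ G --> a -> g @ G --> b -> (fun t => dist_sq (f t) (g t)) @ G --> dist_sq a b.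
Proof. by move=> fa gb; apply: cvg_dot; exact: cvgB gb fa. Qed.

(** The points at Euclidean distance at least r from the complement of Omega.
    Seen from a boundary point x, the nearest of them lie roughly at distance r
    along the inner normal, so that the squared distance to this set increases
    across the boundary although nothing smoother than C^1 is available. *)
Lemma inner_parallel_set : exists (r : R) (S : set 'rV[R]_N),
  [/\ 0 < r, compact S, S !=set0, S `<=` closure Omega &
   forall x, boundary Omega x ->
     (exists2 s, S s & dist_sq s x <= (3 / 2 * r) ^+ 2) /\
     forall s, S s -> dist_sq s x <= (2 * r) ^+ 2 -> r / 4 <= dot (nu x) (x - s)].
Proof.
(* With slope 1/6, the cone deviates by at most r/2 at distance 3 r. *)
have om0 : 0 < 6^-1 :> R by rewrite invr_gt0.
have [r1 r10 cone] := uniform_cone Omega_open Omega_bounded Omega_C1 nu_normal om0.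
have [x0 Ox0] := Omega_nonempty.
have /nbhs_ballP[d /= d0 Hd] := open_nbhs_nbhs (conj Omega_open Ox0).
pose r := Num.min (r1 / 3) d.
have r0 : 0 < r by rewrite lt_min d0 divr_gt0.
have r3 : 3 * r <= r1 by rewrite -ler_pdivlMl// mulrC ge_min lexx.
have rd : r <= d by rewrite ge_min lexx orbT.
pose S := [set s : 'rV[R]_N | forall w, ~ Omega w -> r ^+ 2 <= dist_sq s w].
have S_sub : S `<=` Omega.
  move=> s Ss; have [//|/Ss] := pselect (Omega s).
  by rewrite /dist_sq subrr dot0l leNgt exprn_gt0.
have S_closed : closed S.
  rewrite (_ : S = \bigcap_(w in ~` Omega) [set s | r ^+ 2 <= dist_sq s w]) //.
  apply: closed_bigI => w _.
  apply: (@closed_comp _ _ (fun s => dist_sq s w) [set t | r ^+ 2 <= t]).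
    by move=> s _; apply: (dist_sq_cvg (G := nbhs s)); [exact: cvg_id|exact: cvg_cst].
  exact: closed_ge.
have S_cl : S `<=` closure Omega by move=> s /S_sub; exact: subset_closure.
have S_compact : compact S.
  exact: subclosed_compact S_closed (closure_compact Omega_bounded) S_cl.
exists r, S; split=> //.
  exists x0 => w nOw; rewrite leNgt; apply/negP => H; apply: nOw; apply: Hd.
  rewrite -ball_normE /= distrC; apply: lt_le_trans rd.
  exact: dist_sq_lt r0 H.
move=> x bx; have nn := nu_unit Omega_C1 nu_normal bx.
have n1 := nu_norm_le1 Omega_C1 nu_normal bx.
split.
  exists (x - (3 / 2 * r) *: nu x); last first.
    by rewrite /dist_sq subKr dotZl dotZr nn mulr1 expr2.
  move=> w nOw; rewrite leNgt; apply/negP; set s := x - _ => wr; apply: nOw.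
  have wx : w - x = (w - s) - (3 / 2 * r) *: nu x by rewrite /s opprB addrA addrAC addrK.
  have ws := dist_sq_lt r0 wr.
  have wx3 : `|w - x| <= 3 * r.
    rewrite wx; apply: le_trans (ler_normB _ _) _; rewrite normrZ gtr0_norm ?mulr_gt0//.
    have : 3 / 2 * r * `|nu x| <= 3 / 2 * r by rewrite ler_piMr// ltW// mulr_gt0.
    lra.
  apply: (cone x w bx (le_trans wx3 r3)).2.
  have : dot (nu x) (w - s) < r.
    rewrite ltNge; apply/negP => H; have := dot_CauchySchwarz (nu x) (w - s).
    rewrite nn mul1r leNgt => /negP; apply; apply: lt_le_trans wr _.
    have r0' := ltW r0; have d0' := le_trans r0' H.
    by rewrite ler_pXn2r.
  have -> : dot (nu x) (w - x) = dot (nu x) (w - s) - 3 / 2 * r.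
    by rewrite wx [LHS]dotBr dotZr nn mulr1.
  lra.
move=> s Ss sx.
have xs : `|x - s| <= 2 * r by apply: norm_le_dist_sq => //; rewrite mulr_ge0// ltW.
pose w := s + (3 / 4 * r) *: nu x.
have Ow : Omega w.
  have [//|/Ss] := pselect (Omega w).
  rewrite /dist_sq /w addrC addKr dotZl dotZr nn mulr1; nra.
have wx : w - x = (3 / 4 * r) *: nu x - (x - s) by rewrite /w opprB addrA [s + _]addrC.
have wx3 : `|w - x| <= 3 * r.
  rewrite wx; apply: le_trans (ler_normB _ _) _; rewrite normrZ gtr0_norm ?mulr_gt0//.
  have : 3 / 4 * r * `|nu x| <= 3 / 4 * r by rewrite ler_piMr// ltW// mulr_gt0.
  lra.
have := (cone x w bx (le_trans wx3 r3)).1 Ow.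
have -> : dot (nu x) (w - x) = 3 / 4 * r - dot (nu x) (x - s).
  by rewrite wx [LHS]dotBr dotZr nn mulr1.
lra.
Qed.

End InnerParallelSet.

(** * The barrier *)

Section Barrier.
Context {R : realType} {N : nat}.

Lemma first_order_bound (V : normedModType R) (K : set 'rV[R]_N) (f : 'rV[R]_N -> R -> V)
    (f0 f1 : 'rV[R]_N -> V) : compact K -> {within K, continuous f1} ->
  uniform_first_order K f f0 f1 ->
  exists E y0 : R, [/\ 0 < E, 0 < y0 & forall y, `|y| < y0 -> y \in `[-1, 1] ->
    forall x, K x -> `|f x y - f0 x| <= E * `|y|].
Proof.
move=> cK cf1 Hf; have [B B0 HB] := within_continuous_bounded cK cf1.
have /nbhs_ballP[y0 /= y00 Hy] := Hf 1 ltr01.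
exists (1 + B), y0; split=> //; first by rewrite addr_gt0.
move=> y yy0 yI x Kx.
have H : `|f x y - (f0 x + y *: f1 x)| <= 1 * `|y|.
  by apply: Hy => //; rewrite -ball_normE /= sub0r normrN.
have -> : f x y - f0 x = (f x y - (f0 x + y *: f1 x)) + y *: f1 x.
  by rewrite opprD addrA subrK.
apply: le_trans (ler_normD _ _) _; rewrite normrZ mulrDl; apply: lerD => //.
by rewrite mulrC ler_wpM2r// HB.
Qed.

(** Formally h(x) + y (betao - gamo . Dh) + A/2 (y - eps m)^2 is a strict
    supersolution for the boundary conditions. Here h is the squared distance to
    a point s, and the other coefficients are frozen at a point b, to which x is
    tied by the term |x - b|^2; so nothing has to be differentiated twice. *)
Definition barrier (A : R) (s b : 'rV[R]_N) (c e : R) (z : 'rV[R]_(N + 1)) : R :=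
  dist_sq s (xpart z) + dist_sq b (xpart z) + c * ypart z + A / 2 * (ypart z - e) ^+ 2.

Lemma barrierE A s b c e : barrier A s b c e =
  diag_quad (row_mx (const_mx 2) (const_mx (A / 2)))
    (row_mx (- 2 *: (s + b)) (const_mx (c - A * e)))
    (dot s s + dot b b + A / 2 * e ^+ 2).
Proof.
apply/funext => z; rewrite /barrier !dist_sqE /diag_quad big_split_ord /= big_ord1.
rewrite !row_mxEr !mxE.
rewrite [in RHS](eq_bigr (fun i => ((- 2 *: s) 0 i * xpart z 0 i + 1 * xpart z 0 i ^+ 2) +
    ((- 2 *: b) 0 i * xpart z 0 i + 1 * xpart z 0 i ^+ 2))); last first.
  by move=> i _; rewrite !row_mxEl /xpart !mxE; ring.
have E (a : 'rV[R]_N) : \sum_i (a 0 i * xpart z 0 i +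
    (const_mx 1 : 'rV[R]_N) 0 i * xpart z 0 i ^+ 2) =
    \sum_i (a 0 i * xpart z 0 i + 1 * xpart z 0 i ^+ 2).
  by apply: eq_bigr => i _; rewrite [const_mx _ _ _]mxE.
rewrite !E [X in _ = _ + (X + _)]big_split /=.
have -> : ypart z = z 0 (rshift N ord0) by rewrite /ypart mxE.
by field.
Qed.

Lemma C2_barrier A s b c e : C2 (barrier A s b c e).
Proof. by rewrite barrierE; exact: C2_diag_quad. Qed.

Lemma xpart_grad_barrier A s b c e z :
  xpart (grad (barrier A s b c e) z) = 2 *: (xpart z - s) + 2 *: (xpart z - b).
Proof.
rewrite barrierE grad_diag_quad; apply/rowP => i.
by rewrite /xpart [LHS]mxE [LHS]mxE !row_mxEl !mxE; ring.
Qed.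

Lemma ypart_grad_barrier A s b c e z :
  ypart (grad (barrier A s b c e) z) = c + A * (ypart z - e).
Proof.
by rewrite barrierE grad_diag_quad /ypart [LHS]mxE [LHS]mxE !row_mxEr !mxE; field.
Qed.

Lemma hess_barrier A s b c e z :
  hess (barrier A s b c e) z =
  diag_mx (2 *: row_mx (const_mx 2) (const_mx (A / 2))).
Proof. by rewrite barrierE hess_diag_quad. Qed.

End Barrier.

Section ParametrizedMaximum.
Context {R : realType} {n : nat}.

Lemma usc_sub_continuous_max (K : set 'rV[R]_n) (u : 'rV[R]_n -> R) (M : R)
    (T : topologicalType) (Q : set T) (B : 'rV[R]_n * T -> R) :
  (forall x, K x -> `|u x| <= M) -> compact K -> K !=set0 -> compact Q -> Q !=set0 ->
  continuous B -> exists z q, [/\ K z, Q q & forall w p, K w -> Q p ->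
    usc_env K u w - B (w, p) <= usc_env K u z - B (z, q)].
Proof.
move=> uM cK [z0 Kz0] cQ [q0 Qq0] cB.
have cKQ : compact (K `*` Q) by exact: compact_setX.
have ne : K `*` Q !=set0 by exists (z0, q0).
have [|[z q] /= [Kz Qq] zq] := @usc_max_compact R _ _
    (fun a : 'rV[R]_n * T => usc_env K u a.1 - B a) cKQ ne.
  move=> a c [Ka Qa] ac; pose h := (c - (usc_env K u a.1 - B a)) / 2.
  have h0 : 0 < h by rewrite divr_gt0// subr_gt0.
  have ah : usc_env K u a.1 < usc_env K u a.1 + h by rewrite ltrDl.
  have n1 : \forall b \near a, K b.1 -> usc_env K u b.1 < usc_env K u a.1 + h.
    have c1 : (fun b : 'rV[R]_n * T => b.1) @ a --> a.1 by exact: (cvg_fst_comp (f := id)).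
    by have := c1 _ (usc_env_usc uM Ka ah).
  have n2 : \forall b \near a, B a - h < B b.
    by apply: (cvgr_gt _ (cB a)); rewrite ltrBlDr ltrDl.
  apply: filterS2 n1 n2 => b b1 b2 [/b1 {}b1 _]; rewrite /h in b1 b2; lra.
by exists z, q; split=> // w p Kw Qp; exact: (zq (w, p)).
Qed.

End ParametrizedMaximum.

Section BarrierEstimates.
Context {R : realType} {N : nat}.
Implicit Types (x s b : 'rV[R]_N).

(** Comparing the active parameter b with x itself: the penalty |x - b|^2 costs
    more than the slope c and the height e can gain, as y is of order eps. *)

Lemma active_dist_le (A eps G L1 L2 cx cb ex eb y : R) x b :
  0 < A -> 0 < eps -> 0 <= G -> 0 <= L1 -> 0 <= L2 -> A * eps <= 1 ->
  `|y| <= eps * G -> `|ex| <= eps * G -> `|eb| <= eps * G ->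
  `|cx - cb| <= L1 * `|x - b| -> `|ex - eb| <= eps * (L2 * `|x - b|) ->
  dist_sq b x + cb * y + A / 2 * (y - eb) ^+ 2 <= cx * y + A / 2 * (y - ex) ^+ 2 ->
  `|x - b| <= eps * (G * L1 + 2 * G * L2).
Proof.
move=> A0 e0 G0 L10 L20 Ae yG exG ebG cL eL H.
set d := `|x - b| in cL eL *.
have d0 : 0 <= d by exact: normr_ge0.
have D : d ^+ 2 <= dist_sq b x by exact: norm_sqr_le_dot.
have B1 : (cx - cb) * y <= L1 * d * (eps * G).
  apply: le_trans (ler_norm _) _; rewrite normrM; exact: ler_pM.
have B2 : (eb - ex) * (2 * y - ex - eb) <= eps * (L2 * d) * (4 * (eps * G)).
  apply: le_trans (ler_norm _) _; rewrite normrM [X in X * _]distrC; apply: ler_pM => //.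
  move: yG exG ebG; rewrite !ler_norml => /andP[? ?] /andP[? ?] /andP[? ?].
  apply/andP; split; lra.
have B3 : A / 2 * ((eb - ex) * (2 * y - ex - eb)) <= eps * (2 * G * L2) * d.
  apply: (@le_trans _ _ (A / 2 * (eps * (L2 * d) * (4 * (eps * G))))).
    by rewrite ler_wpM2l// divr_ge0// ltW.
  have -> : A / 2 * (eps * (L2 * d) * (4 * (eps * G))) =
    (A * eps) * (eps * (2 * G * L2) * d) by field.
  by rewrite ler_piMl// !mulr_ge0// ltW.
have E : A / 2 * (y - ex) ^+ 2 - A / 2 * (y - eb) ^+ 2 =
    A / 2 * ((eb - ex) * (2 * y - ex - eb)) by ring.
have F : d * d <= eps * (G * L1 + 2 * G * L2) * d.
  have -> : eps * (G * L1 + 2 * G * L2) * d = L1 * d * (eps * G) + eps * (2 * G * L2) * d.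
    by ring.
  by rewrite -expr2; lra.
have [->|dn0] := eqVneq d 0; first by rewrite !(mulr_ge0, addr_ge0)// ltW.
by move: F; rewrite ler_pM2r// lt0r dn0.
Qed.

(** The oblique operator on the barrier, split into the terms that vanish with
    eps and the restoring term A (y - e). *)
Lemma oblique_split x s b (gam gx gb : 'rV[R]_N) (betx betb bet : R) (g : R) :
  dot gam (2 *: (x - s) + 2 *: (x - b)) + (betb - 2 * dot gb (b - s) + g) - bet =
  2 * dot (gam - gx) (x - s) + 2 * dot gam (x - b) +
  (betb - 2 * dot gb (b - s) - (betx - 2 * dot gx (x - s))) + (betx - bet) + g.
Proof. by rewrite [dot gam (2 *: _ + _)]dotDr !dotZr (dotBl gam gx); ring. Qed.

Lemma oblique_remainder_le x s b (gam gx gb : 'rV[R]_N) (betx betb bet : R)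
   (M0 E1 Gm D L1 : R) :
  `|x - s| <= 2 * M0 -> `|gam - gx| <= E1 -> `|gam| <= Gm -> `|x - b| <= D ->
  `|betb - 2 * dot gb (b - s) - (betx - 2 * dot gx (x - s))| <= L1 * `|x - b| ->
  0 <= L1 -> `|betx - bet| <= E1 ->
  `|2 * dot (gam - gx) (x - s) + 2 * dot gam (x - b) +
  (betb - 2 * dot gb (b - s) - (betx - 2 * dot gx (x - s))) + (betx - bet)| <=
  4 * N%:R * E1 * M0 + 2 * N%:R * Gm * D + L1 * D + E1.
Proof.
move=> xs gE gG xb qL L10 bE.
have T1 := dot_const_le gE xs; have T2 := dot_const_le gG xb.
have T3 : L1 * `|x - b| <= L1 * D by rewrite ler_wpM2l.
apply: le_trans (ler_normD _ _) _; apply: lerD bE.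
apply: le_trans (ler_normD _ _) _; apply: lerD (le_trans qL T3).
apply: le_trans (ler_normD _ _) _; rewrite !normrM (ger0_norm (ler0n R 2)).
by apply: lerD; [move: T1|move: T2]; lra.
Qed.

End BarrierEstimates.

(** * The a priori bound *)

Section Apriori.
Context {R : realType} {N : nat}.
Variables (Omega : set 'rV[R]_N) (nu : 'rV[R]_N -> 'rV[R]_N).
Hypothesis Omega_open : open Omega.
Hypothesis Omega_bounded : bounded_set Omega.
Hypothesis Omega_nonempty : Omega !=set0.
Hypothesis Omega_C1 : C1_boundary Omega.
Hypothesis nu_normal : outward_unit_normal Omega nu.
Variables (gp gm : 'rV[R]_N -> R).
Hypothesis gp_C1 : C1 gp.
Hypothesis gm_C1 : C1 gm.
Hypothesis gm_lt_gp : forall x, closure Omega x -> gm x < gp x.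
Variables (gam1p gam1m : 'rV[R]_N -> R -> 'rV[R]_N).
Variables (gamo : 'rV[R]_N -> 'rV[R]_N) (betao : 'rV[R]_N -> R).
Hypothesis gamo_C1 : C1 gamo.
Hypothesis betao_C1 : C1 betao.
Variables (betap betam : 'rV[R]_N -> R -> R).
Variables (kp km : 'rV[R]_N -> 'rV[R]_N) (lp lm : 'rV[R]_N -> R).
Hypothesis kp_cont : {within closure Omega, continuous kp}.
Hypothesis km_cont : {within closure Omega, continuous km}.
Hypothesis lp_cont : {within closure Omega, continuous lp}.
Hypothesis lm_cont : {within closure Omega, continuous lm}.
Hypothesis gam1p_exp : uniform_first_order (closure Omega) gam1p gamo kp.
Hypothesis gam1m_exp : uniform_first_order (closure Omega) gam1m (fun x => - gamo x) km.
Hypothesis betap_exp : uniform_first_order (closure Omega) betap betao lp.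
Hypothesis betam_exp : uniform_first_order (closure Omega) betam (fun x => - betao x) lm.
Variable F : 'M[R]_(N + 1) -> 'rV[R]_(N + 1) -> R -> 'rV[R]_N -> R -> R.
Hypothesis F_cont : {within F_domain Omega, continuous (F_uncurried F)}.
Variable alpha : R.
Hypothesis alpha_gt0 : 0 < alpha.
Hypothesis F_mono : forall (p : 'rV[R]_(N + 1)) (x : 'rV[R]_N) (y : R),
  closure Omega x -> y \in `[-1, 1] ->
  forall (X Y : 'M[R]_(N + 1)) (r s : R),
    X \is symmetricmx -> Y \is symmetricmx -> psd_le Y X -> r <= s ->
    F X p r x y - alpha * r <= F Y p s x y - alpha * s.

Local Notation clO := (closure Omega).
Let cO : compact clO. Proof. exact: closure_compact. Qed.

Lemma gap_pos : exists2 th : R, 0 < th & forall x, clO x -> th <= (gp x - gm x) / 2.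
Proof.
have [x0 Ox0] := Omega_nonempty.
have ne : clO !=set0 by exists x0; exact: subset_closure.
have [x c cx xc|x clx xmax] := @usc_max_compact R _ clO (fun x => gm x - gp x) cO ne.
  have cc : (fun x => gm x - gp x) @ x --> gm x - gp x.
    exact: cvgB (C1_continuous gm_C1 (x := x)) (C1_continuous gp_C1 (x := x)).
  by apply: filterS (cvgr_lt _ cc _ xc) => w ? _.
exists ((gp x - gm x) / 2); first by rewrite divr_gt0// subr_gt0; exact: gm_lt_gp.
by move=> w /xmax; lra.
Qed.

Lemma C1_bound (V : normedModType R) (f : 'rV[R]_N -> V) : C1 f ->
  exists2 M : R, 0 < M & forall x, clO x -> `|f x| <= M.
Proof. by move=> /C1_continuous cf; exact: continuous_bounded. Qed.

Lemma boundary_expansions : exists E y0 : R, [/\ 0 < E, 0 < y0 &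
  forall y, `|y| < y0 -> y \in `[-1, 1] -> forall x, clO x ->
   [/\ `|gam1p x y - gamo x| <= E * `|y|, `|gam1m x y + gamo x| <= E * `|y|,
       `|betap x y - betao x| <= E * `|y| & `|betam x y + betao x| <= E * `|y|]].
Proof.
have [E1 [y1 [E10 y10 H1]]] := first_order_bound cO kp_cont gam1p_exp.
have [E2 [y2 [E20 y20 H2]]] := first_order_bound cO km_cont gam1m_exp.
have [E3 [y3 [E30 y30 H3]]] := first_order_bound cO lp_cont betap_exp.
have [E4 [y4 [E40 y40 H4]]] := first_order_bound cO lm_cont betam_exp.
exists (E1 + E2 + E3 + E4), (Num.min (Num.min y1 y2) (Num.min y3 y4)); split.
- by rewrite !addr_gt0.
- by rewrite !lt_min y10 y20 y30.
move=> y; rewrite !lt_min => /andP[/andP[yy1 yy2] /andP[yy3 yy4]] yI x clx.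
have up (e t : R) : t <= e * `|y| -> e <= E1 + E2 + E3 + E4 ->
    t <= (E1 + E2 + E3 + E4) * `|y|.
  by move=> te ee; apply: le_trans te _; rewrite ler_wpM2r.
split.
- by apply: up (H1 y yy1 yI x clx) _; lra.
- by apply: up (_ : _ <= E2 * `|y|) _; [have := H2 y yy2 yI x clx; rewrite opprK|lra].
- by apply: up (H3 y yy3 yI x clx) _; lra.
- by apply: up (_ : _ <= E4 * `|y|) _; [have := H4 y yy4 yI x clx; rewrite opprK|lra].
Qed.

(** betao - gamo . Dh at b, for h the squared distance to s. *)
Definition slope s b := betao b - 2 * dot (gamo b) (b - s).

Lemma slope_bounds (M0 : R) : 0 < M0 -> (forall x, clO x -> `|x| <= M0) ->
  exists L1 Q : R, [/\ 0 < L1, 0 < Q &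
   forall s, clO s -> (forall x b, clO x -> clO b ->
     `|slope s b - slope s x| <= L1 * `|x - b|) /\
     forall b, clO b -> `|slope s b| <= Q].
Proof.
move=> M00 HM0.
have dM x y : clO x -> clO y -> `|x - y| <= 2 * M0.
  move=> /HM0 xM /HM0 yM; apply: le_trans (ler_normB _ _) _; lra.
have [Lb Lb0 HLb] := C1_lipschitz M0 betao_C1.
have [Lg Lg0 HLg] := C1_lipschitz_rV M0 gamo_C1.
have [Go Go0 HGo] := C1_bound gamo_C1.
have [Bo Bo0 HBo] := C1_bound betao_C1.
have NN : 0 <= N%:R :> R := ler0n _ _.
exists (Lb + 4 * N%:R * Lg * M0 + 2 * N%:R * Go), (Bo + 4 * N%:R * Go * M0); split.
- by rewrite -addrA ltr_pwDl// addr_ge0// !mulr_ge0// ltW.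
- by rewrite ltr_pwDl// !mulr_ge0// ltW.
move=> s cs; split=> [x b cx cb|b cb].
  have -> : slope s b - slope s x = (betao b - betao x) -
      (2 * dot (gamo b - gamo x) (b - s) + 2 * dot (gamo x) (b - x)).
    have -> : b - x = (b - s) - (x - s) by rewrite opprB addrA subrK.
    by rewrite /slope dotBl [dot (gamo x) (b - s - _)]dotBr; ring.
  have d0 := normr_ge0 (x - b).
  have T1 := HLb b x (HM0 b cb) (HM0 x cx).
  have T2 := dot_const_le (HLg b x (HM0 b cb) (HM0 x cx)) (dM b s cb cs).
  have T3 := dot_const_le (HGo x cx) (lexx `|b - x|).
  rewrite (distrC b x) in T1 T2 T3.
  apply: le_trans (ler_normB _ _) _.
  have -> : (Lb + 4 * N%:R * Lg * M0 + 2 * N%:R * Go) * `|x - b| =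
    Lb * `|x - b| + (4 * N%:R * Lg * M0 * `|x - b| + 2 * N%:R * Go * `|x - b|) by ring.
  apply: (lerD T1); apply: le_trans (ler_normD _ _) _.
  rewrite !normrM (ger0_norm (ler0n R 2)).
  by apply: lerD; [move: T2|move: T3]; lra.
apply: le_trans (ler_normB _ _) _; apply: (lerD (HBo b cb)).
rewrite normrM (ger0_norm (ler0n R 2)).
have := dot_const_le (HGo b cb) (dM b s cb cs); lra.
Qed.

Definition barrier_hess (A : R) : 'M[R]_(N + 1) :=
  diag_mx (2 *: row_mx (const_mx 2) (const_mx (A / 2))).

Lemma F_barrier_bound (A P : R) : exists2 MF : R, 0 < MF & forall p x y, `|p| <= P -> clO x ->
  y \in `[-1, 1] -> `|F (barrier_hess A) p 0 x y| <= MF.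
Proof.
pose D : set ('M[R]_(N + 1) * 'rV[R]_(N + 1) * R * 'rV[R]_N * R) :=
  [set barrier_hess A] `*` [set p : 'rV[R]_(N + 1) | `|p| <= P] `*` [set (0 : R)]
  `*` clO `*` `[-1, 1].
have cD : compact D.
  apply: compact_setX; last exact: segment_compact.
  apply: compact_setX cO; apply: compact_setX; last exact: compact_set1.
  by apply: compact_setX; [exact: compact_set1|exact: compact_norm_ball].
have sD : D `<=` F_domain Omega.
  move=> [[[[X p] r] x] y] [[[[/= -> _] _] cx] yI]; split=> //.
  by rewrite symmetricmxE tr_diag_mx.
have [MF MF0 HMF] := within_continuous_bounded cD (continuous_subspaceW sD F_cont).
exists MF => // p x y pP cx yI.
exact: (HMF (barrier_hess A, p, 0, x, y)).
Qed.

End Apriori.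

(** The envelope minus the barrier is maximised jointly in z and in the
    parameters s and b. Optimality in b keeps b within O(eps) of x, optimality
    in s makes x - s point outwards on the lateral boundary, and for A large the
    term A (y - eps m) beats the O(eps) remainder on top and bottom. Hence only
    the equation can hold at the maximum, and its strict monotonicity in u
    bounds the value there. *)
Lemma apriori_upper (R : realType) (N : nat)
  (Omega : set 'rV[R]_N) (nu : 'rV[R]_N -> 'rV[R]_N)
  (Omega_open : open Omega)
  (Omega_bounded : bounded_set Omega)
  (Omega_nonempty : Omega !=set0)
  (Omega_C1 : C1_boundary Omega)
  (nu_normal : outward_unit_normal Omega nu)
  (gp gm : 'rV[R]_N -> R)
  (gp_C1 : C1 gp)
  (gm_C1 : C1 gm)
  (gm_lt_gp : forall x, closure Omega x -> gm x < gp x)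
  (gam1p gam1m : 'rV[R]_N -> R -> 'rV[R]_N)
  (gamo : 'rV[R]_N -> 'rV[R]_N) (betao : 'rV[R]_N -> R)
  (gamo_C1 : C1 gamo)
  (betao_C1 : C1 betao)
  (betap betam : 'rV[R]_N -> R -> R)
  (kp km : 'rV[R]_N -> 'rV[R]_N) (lp lm : 'rV[R]_N -> R)
  (kp_cont : {within closure Omega, continuous kp})
  (km_cont : {within closure Omega, continuous km})
  (lp_cont : {within closure Omega, continuous lp})
  (lm_cont : {within closure Omega, continuous lm})
  (gam1p_exp : uniform_first_order (closure Omega) gam1p gamo kp)
  (gam1m_exp : uniform_first_order (closure Omega) gam1m (fun x => - gamo x) km)
  (betap_exp : uniform_first_order (closure Omega) betap betao lp)
  (betam_exp : uniform_first_order (closure Omega) betam (fun x => - betao x) lm)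
  (F : 'M[R]_(N + 1) -> 'rV[R]_(N + 1) -> R -> 'rV[R]_N -> R -> R)
  (F_cont : {within F_domain Omega, continuous (F_uncurried F)})
  (alpha : R)
  (alpha_gt0 : 0 < alpha)
  (F_mono : forall (p : 'rV[R]_(N + 1)) (x : 'rV[R]_N) (y : R),
  closure Omega x -> y \in `[-1, 1] ->
  forall (X Y : 'M[R]_(N + 1)) (r s : R),
    X \is symmetricmx -> Y \is symmetricmx -> psd_le Y X -> r <= s ->
    F X p r x y - alpha * r <= F Y p s x y - alpha * s) :
  exists eps1 C0 : R, [/\ 0 < eps1, 0 < C0 &
  forall eps, 0 < eps -> eps < eps1 ->
  (forall z, closure (thin Omega gp gm eps) z -> ypart z \in `[-1, 1]) ->
  forall u (M : R), (forall z, closure (thin Omega gp gm eps) z -> `|u z| <= M) ->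
  subsol_above (closure (thin Omega gp gm eps))
    (strict_super Omega nu gp gm eps gam1p gam1m F betap betam) 0 u ->
  forall z, closure (thin Omega gp gm eps) z ->
    usc_env (closure (thin Omega gp gm eps)) u z <= C0].
Proof.
pose clO := closure Omega.
have cO : compact clO by exact: closure_compact.
have [M0 M00 HM0] := closure_bounded Omega_bounded.
pose sl := slope gamo betao.
have dM x y : clO x -> clO y -> `|x - y| <= 2 * M0.
  move=> /HM0 xM /HM0 yM; apply: le_trans (ler_normB _ _) _; lra.
have [th th0 Hth] := gap_pos Omega_bounded Omega_nonempty gp_C1 gm_C1 gm_lt_gp.
have [E [y0 [E0 y00 Hexp]]] := boundary_expansions Omega_bounded kp_cont km_cont lp_cont
  lm_cont gam1p_exp gam1m_exp betap_exp betam_exp.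
have [L1 [Q [L10 Q0 Hslope]]] := slope_bounds Omega_bounded gamo_C1 betao_C1 M00 HM0.
have [Gp Gp0 HGp] := C1_bound Omega_bounded gp_C1.
have [Gm Gm0 HGm] := C1_bound Omega_bounded gm_C1.
have [Go Go0 HGo] := C1_bound Omega_bounded gamo_C1.
have [Lp Lp0 HLp] := C1_lipschitz M0 gp_C1.
have [Lm Lm0 HLm] := C1_lipschitz M0 gm_C1.
have [r [S [r0 cS neS SO HS]]] := inner_parallel_set Omega_open Omega_bounded
  Omega_nonempty Omega_C1 nu_normal.
have NN : 0 <= N%:R :> R := ler0n _ _.
pose G := Gp + Gm; have G0 : 0 < G by rewrite addr_gt0.
pose L2 := Lp + Lm; have L20 : 0 < L2 by rewrite addr_gt0.
pose mid x := (gp x + gm x) / 2.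
have mid_le x : clO x -> `|mid x| <= G.
  move=> cx; have := HGp x cx; have := HGm x cx.
  rewrite !ler_norml /mid /G => /andP[a1 a2] /andP[a3 a4].
  by clear -a1 a2 a3 a4; apply/andP; split; lra.
have mid_lip x b : clO x -> clO b -> `|mid x - mid b| <= L2 * `|x - b|.
  move=> cx cb; have := HLp x b (HM0 x cx) (HM0 b cb).
  have := HLm x b (HM0 x cx) (HM0 b cb); have := normr_ge0 (x - b).
  rewrite !ler_norml /mid /L2 => ? /andP[a1 a2] /andP[a3 a4].
  have a5 : 0 <= Lp * `|x - b| by rewrite mulr_ge0// ltW.
  have a6 : 0 <= Lm * `|x - b| by rewrite mulr_ge0// ltW.
  by clear -a1 a2 a3 a4 a5 a6; rewrite mulrDl; apply/andP; split; lra.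
(* eps * Cd bounds |x - b|, eps * Cs what a change of s can gain through the
   slope, and eps * Cr the remainder of the oblique operator. *)
pose Cd := G * L1 + 2 * G * L2.
have Cd0 : 0 < Cd by rewrite addr_gt0 ?mulr_gt0.
pose Cs := 4 * N%:R * G * Go * M0.
have Cs0 : 0 <= Cs by rewrite !mulr_ge0// ltW.
pose Cr := 4 * N%:R * (E * G) * M0 + 2 * N%:R * (Go + E * G) * Cd + L1 * Cd + E * G.
have Cr0 : 0 < Cr.
  rewrite ltr_wpDl//; last by rewrite mulr_gt0.
  rewrite !addr_ge0// ?mulr_ge0// ?addr_ge0 ?mulr_ge0//; exact: ltW.
pose A := 2 * (Cr + 1) / th.
have A0 : 0 < A by rewrite divr_gt0// mulr_gt0// addr_gt0.
pose P := 8 * M0 + Q + 2 * G.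
have [MF MF0 HF] := F_barrier_bound Omega_bounded F_cont A P.
pose Cb := 8 * N%:R * M0 ^+ 2 + Q * G + 2 * G ^+ 2.
have Cb0 : 0 <= Cb by rewrite !addr_ge0 ?mulr_ge0 ?exprn_ge0// ltW.
(* eps < 1 / W makes eps times each summand of W smaller than 1. *)
pose W := 1 + A + G / y0 + Cs / r ^+ 2 + 5 * N%:R * Cd / r + 2 * L2 * Cd / th.
have W1 : 0 <= A by exact: ltW.
have W2 : 0 <= G / y0 by rewrite divr_ge0// ltW.
have W3 : 0 <= Cs / r ^+ 2 by rewrite divr_ge0// exprn_ge0// ltW.
have W4 : 0 <= 5 * N%:R * Cd / r by rewrite divr_ge0 ?mulr_ge0// ltW.
have W5 : 0 <= 2 * L2 * Cd / th by rewrite divr_ge0 ?mulr_ge0// ltW.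
have [V1 V2 V3 V4 V5] : [/\ A <= W, G / y0 <= W, Cs / r ^+ 2 <= W,
    5 * N%:R * Cd / r <= W & 2 * L2 * Cd / th <= W].
  by clear -W1 W2 W3 W4 W5; rewrite /W; split; lra.
have V0 : 1 <= W by clear -W1 W2 W3 W4 W5; rewrite /W; lra.
have W0 : 0 < W := lt_le_trans ltr01 V0.
exists W^-1, (MF / alpha + 2 * Cb); split; first by rewrite invr_gt0.
  by rewrite ltr_pwDl ?divr_gt0// mulr_ge0.
move=> eps eps0 epsW unitK u M uM subu.
set K := closure _ in unitK uM subu *.
have epsle t : 0 <= t -> t <= W -> eps * t < 1.
  move=> t0 tW; apply: (@le_lt_trans _ _ (eps * W)); first by rewrite ler_wpM2l// ltW.
  by rewrite -ltr_pdivlMr// div1r.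
have e1 : eps <= 1 by have /ltW := epsle 1 ler01 V0; rewrite mulr1.
have eA : A * eps <= 1 by rewrite mulrC; exact/ltW/epsle.
have ey : eps * G < y0 by have := epsle _ W2 V2; rewrite mulrA ltr_pdivrMr// mul1r.
have er : eps * Cs < r ^+ 2.
  by have := epsle _ W3 V3; rewrite mulrA ltr_pdivrMr ?exprn_gt0// mul1r.
have eN : eps * (5 * N%:R * Cd) < r.
  by have := epsle _ W4 V4; rewrite mulrA ltr_pdivrMr// mul1r.
have eth : eps * (2 * L2 * Cd) < th.
  by have := epsle _ W5 V5; rewrite mulrA ltr_pdivrMr// mul1r.
have Kcl z : K z -> clO (xpart z) /\ `|ypart z| <= eps * G.
  move=> /(closure_thin gp_C1 gm_C1)[cx /andP[y1 y2]]; split=> //.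
  have := HGp _ cx; have := HGm _ cx; rewrite !ler_norml => /andP[g1 g2] /andP[g3 g4].
  apply/andP; split.
    apply: le_trans y1; rewrite -mulrN ler_wpM2l ?(ltW eps0)// /G.
    by clear -g1 g2 g3 g4 Gp0 Gm0; lra.
  apply: le_trans y2 _; rewrite ler_wpM2l ?(ltW eps0)// /G.
  by clear -g1 g2 g3 g4 Gp0 Gm0; lra.
pose h b := eps * mid b.
pose B (a : 'rV[R]_(N + 1) * ('rV[R]_N * 'rV[R]_N)) :=
  barrier A a.2.1 a.2.2 (sl a.2.1 a.2.2) (h a.2.2) a.1.
have B_le z s b : K z -> S s -> clO b -> `|B (z, (s, b))| <= Cb.
  move=> Kz Ss cb; have [cx yG] := Kcl z Kz; have cs := SO s Ss.
  have DD t : clO t -> 0 <= dist_sq t (xpart z) <= 4 * N%:R * M0 ^+ 2.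
    move=> ct; rewrite dot_ge0 /=; apply: le_trans (ler_norm _) _.
    by apply: le_trans (dot_const_le (dM _ _ cx ct) (dM _ _ cx ct)) _; clear; lra.
  have /andP[D1 D1'] := DD s cs; have /andP[D2 D2'] := DD b cb.
  have cy : `|sl s b * ypart z| <= Q * G.
    rewrite normrM; apply: ler_pM => //; first exact: (Hslope s cs).2.
    by apply: le_trans yG _; rewrite ler_piMl// ltW.
  have ye : `|ypart z - h b| <= 2 * (eps * G).
    apply: le_trans (ler_normB _ _) _; rewrite mulr_natl mulr2n; apply: (lerD yG).
    rewrite /h normrM gtr0_norm// ler_wpM2l ?(ltW eps0)//; exact: mid_le.
  have T0 : 0 <= A / 2 * (ypart z - h b) ^+ 2.
    by rewrite mulr_ge0 ?sqr_ge0// divr_ge0// ltW.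
  have T1 : A / 2 * (ypart z - h b) ^+ 2 <= 2 * G ^+ 2.
    apply: (@le_trans _ _ (A / 2 * (2 * (eps * G)) ^+ 2)).
      have A20 : 0 <= A / 2 by rewrite divr_ge0// ltW.
      have eG0 : 0 <= 2 * (eps * G) := le_trans (normr_ge0 _) ye.
      by apply: (ler_wpM2l A20); rewrite -(real_normK (num_real (ypart z - h b))) ler_pXn2r.
    have -> : A / 2 * (2 * (eps * G)) ^+ 2 = (A * eps) * (eps * (2 * G ^+ 2)) by field.
    have G2 : 0 <= 2 * G ^+ 2 by rewrite mulr_ge0// sqr_ge0.
    have e2 : eps * (2 * G ^+ 2) <= 2 * G ^+ 2 by rewrite ler_piMl.
    by apply: le_trans e2; rewrite ler_piMl// mulr_ge0// ltW.
  move: cy; rewrite /B /barrier /= !ler_norml => /andP[c1 c2].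
  by clear -c1 c2 D1 D1' D2 D2' T0 T1; apply/andP; split; rewrite /Cb; lra.
have cB : continuous B.
  move=> a; have c0 : id @ a --> a by exact: cvg_id.
  have cz : (fun a : 'rV[R]_(N + 1) * ('rV[R]_N * 'rV[R]_N) => a.1) @ a --> a.1.
    exact: (cvg_fst_comp c0).
  have cs : (fun a : 'rV[R]_(N + 1) * ('rV[R]_N * 'rV[R]_N) => a.2.1) @ a --> a.2.1.
    exact: (cvg_fst_comp (cvg_snd_comp c0)).
  have cb : (fun a : 'rV[R]_(N + 1) * ('rV[R]_N * 'rV[R]_N) => a.2.2) @ a --> a.2.2.
    exact: (cvg_snd_comp (cvg_snd_comp c0)).
  pose T := ('rV[R]_(N + 1) * ('rV[R]_N * 'rV[R]_N))%type.
  have cx : (fun a : T => xpart a.1) @ a --> xpart a.1.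
    exact: (cvg_comp _ _ cz (@continuous_xpart _ _ a.1)).
  have cy : (fun a : T => ypart a.1) @ a --> ypart a.1.
    exact: (cvg_comp _ _ cz (@continuous_ypart _ _ a.1)).
  have cst (c : R) : (fun _ : T => c) @ a --> c by exact: (@cvg_cst R).
  have cbeta : (fun a : T => betao a.2.2) @ a --> betao a.2.2.
    exact: (cvg_comp _ _ cb (C1_continuous betao_C1 (x := a.2.2))).
  have cgam : (fun a : T => gamo a.2.2) @ a --> gamo a.2.2.
    exact: (cvg_comp _ _ cb (C1_continuous gamo_C1 (x := a.2.2))).
  have cgp : (fun a : T => gp a.2.2) @ a --> gp a.2.2.
    exact: (cvg_comp _ _ cb (C1_continuous gp_C1 (x := a.2.2))).
  have cgm : (fun a : T => gm a.2.2) @ a --> gm a.2.2.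
    exact: (cvg_comp _ _ cb (C1_continuous gm_C1 (x := a.2.2))).
  have cbs : (fun a : T => a.2.2 - a.2.1) @ a --> a.2.2 - a.2.1 by exact: cvgB.
  have cdot : (fun a : T => dot (gamo a.2.2) (a.2.2 - a.2.1)) @ a -->
      dot (gamo a.2.2) (a.2.2 - a.2.1) by exact: cvg_dot.
  have cslope : (fun a : T => sl a.2.1 a.2.2) @ a --> sl a.2.1 a.2.2.
    exact: cvgB cbeta (cvgM (cst 2) cdot).
  have ch : (fun a : T => h a.2.2) @ a --> h a.2.2.
    exact: cvgM (cst eps) (cvgM (cvgD cgp cgm) (cst 2^-1)).
  have cye : (fun a : T => ypart a.1 - h a.2.2) @ a --> ypart a.1 - h a.2.2.
    exact: cvgB cy ch.
  exact: cvgD (cvgD (cvgD (dist_sq_cvg cs cx) (dist_sq_cvg cb cx)) (cvgM cslope cy))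
    (cvgM (cst (A / 2)) (cvgM cye cye)).
have cK : compact K by exact: closure_thin_compact.
move=> z0 Kz0.
have [z [[s b] [Kz [/= Ss cb] zmax]]] := usc_sub_continuous_max uM cK (ex_intro _ _ Kz0)
  (compact_setX cS cO) (let: ex_intro s0 Ss0 := neS in
    ex_intro _ (s0, s0) (conj Ss0 (SO _ Ss0))) cB.
pose v := usc_env K u; rewrite -/v in zmax *.
suff vz : v z <= MF / alpha.
  have max0 := zmax z0 (s, b) Kz0 (conj Ss cb).
  have := B_le z0 s b Kz0 Ss cb; have := B_le z s b Kz Ss cb.
  rewrite !ler_norml => /andP[b1 b2] /andP[b3 b4]; clear -max0 vz b1 b2 b3 b4; lra.
rewrite leNgt; apply/negP => vbig.
have vz0 : 0 < v z by apply: lt_trans vbig; rewrite divr_gt0.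
have [cx yG] := Kcl z Kz; have yu := unitK z Kz; have cs := SO s Ss.
set x := xpart z in cx; set y := ypart z in yG yu.
have [slL slQ] := Hslope s cs.
have hG t : clO t -> `|h t| <= eps * G.
  by move=> ct; rewrite /h normrM gtr0_norm// ler_wpM2l ?(ltW eps0)//; exact: mid_le.
have xb : `|x - b| <= eps * Cd.
  apply: (@active_dist_le R N A eps G L1 L2 (sl s x) (sl s b) (h x) (h b) y) => //;
    rewrite ?(ltW G0) ?(ltW L10) ?(ltW L20)//.
  - exact: hG.
  - exact: hG.
  - by rewrite distrC; exact: slL.
  - by rewrite /h -mulrBr normrM gtr0_norm// ler_wpM2l ?(ltW eps0)//; exact: mid_lip.
  have xx : dist_sq x x = 0 by rewrite /dist_sq subrr dot0l.
  have := zmax z (s, x) Kz (conj Ss cx).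
  by rewrite /B /barrier /= -/x -/y xx; clear; lra.
have xs2 : `|x - s| <= 2 * M0 by exact: dM.
have G'0 : 0 <= E * G by rewrite mulr_ge0// ltW.
have estimate (gam : 'rV[R]_N) (bet : R) : `|gam - gamo x| <= E * (eps * G) ->
    `|betao x - bet| <= E * (eps * G) ->
    `|dot gam (2 *: (x - s) + 2 *: (x - b)) + (sl s b + A * (y - h b)) - bet -
      A * (y - h b)| <= eps * Cr.
  move=> gE bE.
  have gG : `|gam| <= Go + E * G.
    rewrite -[gam](subrK (gamo x)) addrC; apply: le_trans (ler_normD _ _) _.
    apply: lerD; first exact: HGo.
    by apply: le_trans gE _; rewrite mulrCA ler_piMl.
  have slE : `|sl s b - sl s x| <= L1 * `|x - b| by exact: slL.
  have := oblique_remainder_le xs2 gE gG xb slE (ltW L10) bE.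
  rewrite /sl /slope (oblique_split x s b gam (gamo x) (gamo b) (betao x)) addrK.
  by move=> H; apply: le_trans H _; clear; rewrite /Cr; lra.
have small_gap : eps * (L2 * Cd) < th / 2 by clear -eth; lra.
have hxb : `|mid x - mid b| <= th / 2.
  apply: le_trans (mid_lip x b cx cb) _; apply: le_trans (ltW small_gap).
  by rewrite mulrCA ler_wpM2l// ltW.
have restoring : eps * Cr < A * (eps * (th / 2)).
  have -> : A * (eps * (th / 2)) = eps * (Cr + 1) by rewrite /A; field; rewrite gt_eqF.
  by rewrite ltr_pM2l// ltrDl.
have yy0 : `|y| < y0 by exact: le_lt_trans yG ey.
have EyG : E * `|y| <= E * (eps * G) by rewrite ler_wpM2l// ltW.
have [gpE gmE bpE bmE] := Hexp y yy0 yu x cx.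
have thx := Hth x cx.
have estp : - (eps * Cr) <= dot (gam1p x y) (2 *: (x - s) + 2 *: (x - b)) +
    (sl s b + A * (y - h b)) - betap x y - A * (y - h b).
  have H1 : `|gam1p x y - gamo x| <= E * (eps * G) by exact: le_trans gpE EyG.
  have H2 : `|betao x - betap x y| <= E * (eps * G).
    by rewrite distrC; exact: le_trans bpE EyG.
  by have := estimate _ _ H1 H2; rewrite ler_norml => /andP[].
have estm : dot (- gam1m x y) (2 *: (x - s) + 2 *: (x - b)) +
    (sl s b + A * (y - h b)) - (- betam x y) - A * (y - h b) <= eps * Cr.
  have H1 : `|- gam1m x y - gamo x| <= E * (eps * G).
    by rewrite -opprD normrN; exact: le_trans gmE EyG.
  have H2 : `|betao x - (- betam x y)| <= E * (eps * G).
    by rewrite opprK addrC; exact: le_trans bmE EyG.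
  by have := estimate _ _ H1 H2; rewrite ler_norml => /andP[].
pose phi := barrier A s b (sl s b) (h b).
apply: (subu phi z (C2_barrier _ _ _ _ _) Kz _ vz0).
  by move=> w Kw; exact: (zmax w (s, b) Kw (conj Ss cb)).
have gx : xpart (grad phi z) = 2 *: (x - s) + 2 *: (x - b) by exact: xpart_grad_barrier.
have gy : ypart (grad phi z) = sl s b + A * (y - h b) by exact: ypart_grad_barrier.
split; rewrite -/x -/y.
- rewrite /strict_super /phi hess_barrier -/phi -/(barrier_hess A).
  have pP : `|grad phi z| <= P.
    apply: le_trans (norm_row_le _) _; rewrite gx gy.
    have -> : P = 8 * M0 + (Q + 2 * G) by rewrite /P; ring.
    apply: lerD.
      apply: le_trans (ler_normD _ _) _; rewrite !normrZ (ger0_norm (ler0n R 2)).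
      by have := dM x b cx cb; clear -xs2; lra.
    apply: le_trans (ler_normD _ _) _; apply: (lerD (slQ b cb)).
    rewrite normrM gtr0_norm//.
    apply: (@le_trans _ _ (A * (2 * (eps * G)))).
      rewrite ler_wpM2l ?(ltW A0)//; apply: le_trans (ler_normB _ _) _.
      by rewrite mulr_natl mulr2n; apply: lerD => //; exact: hG.
    have -> : A * (2 * (eps * G)) = (A * eps) * (2 * G) by ring.
    by rewrite ler_piMl// mulr_ge0// ltW.
  have sX : (barrier_hess A : 'M[R]_(N + 1)) \is symmetricmx by rewrite symmetricmxE tr_diag_mx.
  have := F_mono (grad phi z) x y cx yu _ _ 0 (v z) sX sX (fun w => lexx _) (ltW vz0).
  have := HF _ _ _ pP cx yu; rewrite ler_norml => /andP[FM _].
  move: vbig; rewrite ltr_pdivrMr// mulr0 subr0 (mulrC _ alpha); rewrite -/v.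
  by clear -FM; lra.
- move=> [bx _]; rewrite gx.
  have [[s' Ss' s'x] Hs] := HS x bx.
  have sx : dist_sq s x <= (2 * r) ^+ 2.
    have := zmax z (s', b) Kz (conj Ss' cb).
    rewrite /B /barrier /= -/x -/y /sl /slope => H.
    have ds : `|s' - s| <= 2 * M0 by apply: dM => //; exact: SO.
    have gd := dot_const_le (HGo b cb) ds.
    have gdy : `|dot (gamo b) (s' - s) * y| <= (N%:R * Go * (2 * M0)) * (eps * G).
      by rewrite normrM; apply: ler_pM.
    have E1 : dot (gamo b) (s' - s) = dot (gamo b) (b - s) - dot (gamo b) (b - s').
      by rewrite -dotBr; congr dot; apply/rowP => i; rewrite !mxE; ring.
    move: gdy; rewrite E1 ler_norml => /andP[_ gdy].
    rewrite /Cs in er; rewrite exprMn in s'x *.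
    by clear -gdy H er s'x r0; nra.
  have T1 := Hs s Ss sx.
  have T2 := dot_const_le (nu_norm_le1 Omega_C1 nu_normal bx) xb.
  rewrite dotDr !dotZr; move: T2; rewrite mulr1 ler_norml => /andP[T2 _].
  by clear -T1 T2 eN r0; lra.
- move=> [_]; rewrite -/x -/y => ytop; rewrite /gammap dot_row_mx -/x -/y gx gy mul1r.
  have : A * (eps * (th / 2)) <= A * (y - h b).
    rewrite ler_wpM2l ?(ltW A0)// ytop /h -mulrBr ler_wpM2l ?(ltW eps0)//.
    by move: hxb thx; clear; rewrite ler_norml /mid => /andP[? ?] ?; lra.
  by clear -estp restoring; lra.
move=> [_]; rewrite -/x -/y => ybot; rewrite /gammam dot_row_mx -/x -/y gx gy mulN1r.
rewrite dotNl in estm.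
have : A * (y - h b) <= - (A * (eps * (th / 2))).
  have H : gm x - mid b <= - (th / 2).
    by move: hxb thx; clear; rewrite ler_norml /mid => /andP[? ?] ?; lra.
  have := ler_wpM2l (ltW A0) (ler_wpM2l (ltW eps0) H).
  by rewrite mulrBr -ybot !mulrN.
by clear -estm restoring; lra.
Qed.

(** * Existence and bound for the boundary value problem *)

Section Viscosity.
Context {R : realType} {N : nat}.
Variables (Omega : set 'rV[R]_N) (nu : 'rV[R]_N -> 'rV[R]_N).
Variables (gp gm : 'rV[R]_N -> R) (eps : R).
Variables (gam1p gam1m : 'rV[R]_N -> R -> 'rV[R]_N) (betap betam : 'rV[R]_N -> R -> R).
Variable F : 'M[R]_(N + 1) -> 'rV[R]_(N + 1) -> R -> 'rV[R]_N -> R -> R.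

Local Notation K := (closure (thin Omega gp gm eps)).
Local Notation super := (strict_super Omega nu gp gm eps gam1p gam1m).
Local Notation sub := (strict_sub Omega nu gp gm eps gam1p gam1m).

Lemma not_strict_super phi z r : ~ super F betap betam phi z r <->
  [\/ F (hess phi z) (grad phi z) r (xpart z) (ypart z) <= 0,
      thin_lateral Omega gp gm eps z /\ dot (nu (xpart z)) (xpart (grad phi z)) <= 0,
      thin_top Omega gp eps z /\
        dot (gammap gam1p z) (grad phi z) <= betap (xpart z) (ypart z) |
      thin_bottom Omega gm eps z /\
        dot (gammam gam1m z) (grad phi z) <= betam (xpart z) (ypart z)].
Proof.
split=> [nS|H [SF Sl St Sb]]; last first.
  case: H => [|[lz]|[tz]|[bz]]; rewrite leNgt => /negP; apply => //.
  - exact: Sl.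
  - exact: St.
  - exact: Sb.
apply: contrapT => H; apply: nS; split=> [|lz|tz|bz]; rewrite ltNge; apply/negP => le;
  apply: H; [exact: Or41|exact: Or42|exact: Or43|exact: Or44].
Qed.

Lemma not_strict_sub phi z r : ~ sub F betap betam phi z r <->
  [\/ F (hess phi z) (grad phi z) r (xpart z) (ypart z) >= 0,
      thin_lateral Omega gp gm eps z /\ dot (nu (xpart z)) (xpart (grad phi z)) >= 0,
      thin_top Omega gp eps z /\
        dot (gammap gam1p z) (grad phi z) >= betap (xpart z) (ypart z) |
      thin_bottom Omega gm eps z /\
        dot (gammam gam1m z) (grad phi z) >= betam (xpart z) (ypart z)].
Proof.
have E : sub F betap betam phi z r <->
  [/\ F (hess phi z) (grad phi z) r (xpart z) (ypart z) < 0,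
      thin_lateral Omega gp gm eps z -> dot (nu (xpart z)) (xpart (grad phi z)) < 0,
      thin_top Omega gp eps z ->
        dot (gammap gam1p z) (grad phi z) < betap (xpart z) (ypart z) &
      thin_bottom Omega gm eps z ->
        dot (gammam gam1m z) (grad phi z) < betam (xpart z) (ypart z)].
  rewrite /strict_sub /strict_at /reflect_op /reflect_data !opprK oppr_gt0.
  by rewrite /xpart [lsubmx (- _)]linearN !dotNr oppr_gt0 !ltrN2.
rewrite E; split=> [nS|H [SF Sl St Sb]]; last first.
  case: H => [|[lz]|[tz]|[bz]]; rewrite leNgt => /negP; apply => //.
  - exact: Sl.
  - exact: St.
  - exact: Sb.
apply: contrapT => H; apply: nS; split=> [|lz|tz|bz]; rewrite ltNge; apply/negP => le;
  apply: H; [exact: Or41|exact: Or42|exact: Or43|exact: Or44].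
Qed.

(** Lower bounds for supersolutions reduce to upper bounds for subsolutions: the
    reflected data satisfy the same hypotheses. *)
Lemma supersol_reflect T u : supersol_below K (sub F betap betam) T u ->
  subsol_above K (super (reflect_op F) (reflect_data betap) (reflect_data betam)) (- T) (\- u).
Proof.
have uE z : lsc_env K u z = - usc_env K (\- u) z by rewrite lsc_envE.
move=> Hu phi z cphi Kz zmax z0 S; apply: (Hu (\- phi) z (C2N cphi) Kz).
- move=> w Kw; have := zmax w Kw; rewrite !uE /=; lra.
- by rewrite uE ltrNl.
apply/strict_subN; first exact: C2N.
rewrite uE opprK (_ : \- \- phi = phi) //.
by apply/funext => y /=; rewrite opprK.
Qed.

End Viscosity.

Lemma reflect_first_order (R : realType) (N : nat) (K : set 'rV[R]_N)
    (f : 'rV[R]_N -> R -> R) (f0 f1 : 'rV[R]_N -> R) :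
  uniform_first_order K f f0 f1 ->
  uniform_first_order K (reflect_data f) (\- f0) (\- f1).
Proof.
move=> Hf e e0; have := Hf e e0; apply: filterS => y Hy yI x Kx.
apply: le_trans (Hy yI x Kx).
have -> : reflect_data f x y - ((\- f0) x + y *: (\- f1) x) =
    - (f x y - (f0 x + y *: f1 x)) by rewrite /reflect_data /= scalerN; ring.
by rewrite normrN.
Qed.

Lemma reflect_op_mono (R : realType) (N : nat) (Omega : set 'rV[R]_N)
    (F : 'M[R]_(N + 1) -> 'rV[R]_(N + 1) -> R -> 'rV[R]_N -> R -> R) (alpha : R) :
  (forall (p : 'rV[R]_(N + 1)) (x : 'rV[R]_N) (y : R),
     closure Omega x -> y \in `[-1, 1] ->
     forall (X Y : 'M[R]_(N + 1)) (r s : R),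
       X \is symmetricmx -> Y \is symmetricmx -> psd_le Y X -> r <= s ->
       F X p r x y - alpha * r <= F Y p s x y - alpha * s) ->
  forall (p : 'rV[R]_(N + 1)) (x : 'rV[R]_N) (y : R),
     closure Omega x -> y \in `[-1, 1] ->
     forall (X Y : 'M[R]_(N + 1)) (r s : R),
       X \is symmetricmx -> Y \is symmetricmx -> psd_le Y X -> r <= s ->
       reflect_op F X p r x y - alpha * r <= reflect_op F Y p s x y - alpha * s.
Proof.
move=> H p x y cx yI X Y r s sX sY XY rs.
have sN (M : 'M[R]_(N + 1)) : M \is symmetricmx -> - M \is symmetricmx.
  by rewrite !symmetricmxE => /eqP sM; rewrite linearN /= -sM.
have YX : psd_le (- X) (- Y) by move=> v; rewrite !mulmxN !dotNl lerN2.
have sr : - s <= - r by rewrite lerN2.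
have := H (- p) x y cx yI (- Y) (- X) (- s) (- r) (sN _ sY) (sN _ sX) YX sr.
rewrite /reflect_op; lra.
Qed.

Theorem proposition1 (R : realType) (N : nat) (hN : (1 <= N)%N)
    (* the domain and its outward unit normal *)
    (Omega : set 'rV[R]_N) (nu : 'rV[R]_N -> 'rV[R]_N)
    (Omega_open : open Omega) (Omega_bounded : bounded_set Omega)
    (Omega_nonempty : Omega !=set0) (Omega_connected : connected Omega)
    (Omega_C1 : C1_boundary Omega) (nu_normal : outward_unit_normal Omega nu)
    (gp gm : 'rV[R]_N -> R) (gp_C1 : C1 gp) (gm_C1 : C1 gm)
    (gm_lt_gp : forall x, closure Omega x -> gm x < gp x)
    (* the equation *)
    (F : 'M[R]_(N + 1) -> 'rV[R]_(N + 1) -> R -> 'rV[R]_N -> R -> R)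
    (F_cont : {within [set a : 'M[R]_(N + 1) * 'rV[R]_(N + 1) * R * 'rV[R]_N * R |
                  let: (X, p, r, x, y) := a in
                  [/\ X \is symmetricmx, closure Omega x & y \in `[-1, 1]]],
                continuous (fun a : 'M[R]_(N + 1) * 'rV[R]_(N + 1) * R * 'rV[R]_N * R =>
                  let: (X, p, r, x, y) := a in F X p r x y)})
    (alpha : R) (alpha_gt0 : 0 < alpha)
    (F_mono : forall (p : 'rV[R]_(N + 1)) (x : 'rV[R]_N) (y : R),
       closure Omega x -> y \in `[-1, 1] ->
       forall (X Y : 'M[R]_(N + 1)) (r s : R),
         X \is symmetricmx -> Y \is symmetricmx -> psd_le Y X -> r <= s ->
         F X p r x y - alpha * r <= F Y p s x y - alpha * s)
    (* the oblique boundary data *)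
    (gam1p gam1m : 'rV[R]_N -> R -> 'rV[R]_N) (betap betam : 'rV[R]_N -> R -> R)
    (gam1p_cont : {within closure Omega `*` `[-1, 1], continuous (uncurry gam1p)})
    (gam1m_cont : {within closure Omega `*` `[-1, 1], continuous (uncurry gam1m)})
    (betap_cont : {within closure Omega `*` `[-1, 1], continuous (uncurry betap)})
    (betam_cont : {within closure Omega `*` `[-1, 1], continuous (uncurry betam)})
    (gamo : 'rV[R]_N -> 'rV[R]_N) (betao : 'rV[R]_N -> R)
    (gamo_C1 : C1 gamo) (betao_C1 : C1 betao)
    (gam_at0 : forall x, closure Omega x ->
       gam1p x 0 = gamo x /\ - gam1m x 0 = gamo x)
    (beta_at0 : forall x, closure Omega x ->
       betap x 0 = betao x /\ - betam x 0 = betao x)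
    (kp km : 'rV[R]_N -> 'rV[R]_N) (lp lm : 'rV[R]_N -> R)
    (kp_cont : {within closure Omega, continuous kp})
    (km_cont : {within closure Omega, continuous km})
    (lp_cont : {within closure Omega, continuous lp})
    (lm_cont : {within closure Omega, continuous lm})
    (gam1p_exp : uniform_first_order (closure Omega) gam1p gamo kp)
    (gam1m_exp : uniform_first_order (closure Omega) gam1m (fun x => - gamo x) km)
    (betap_exp : uniform_first_order (closure Omega) betap betao lp)
    (betam_exp : uniform_first_order (closure Omega) betam (fun x => - betao x) lm)
    (* the standing smallness constant *)
    (eps0 : R) (eps0_gt0 : 0 < eps0)
    (eps0_adm : admissible_eps0 Omega gp gm gam1p gam1m eps0) :
  exists eps1 C0 : R,
    [/\ 0 < eps1, eps1 < eps0, 0 < C0 &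
      forall eps : R, 0 < eps < eps1 ->
        (exists u : 'rV[R]_(N + 1) -> R,
           viscosity_solution Omega gp gm gam1p gam1m nu betap betam F eps u) /\
        (forall u : 'rV[R]_(N + 1) -> R,
           viscosity_solution Omega gp gm gam1p gam1m nu betap betam F eps u ->
           (ereal_sup [set `|u z|%:E | z in closure (thin Omega gp gm eps)] <= C0%:E)%E)].
Proof.
have [eA [CA [eA0 CA0 HA]]] := apriori_upper Omega_open Omega_bounded Omega_nonempty
  Omega_C1 nu_normal gp_C1 gm_C1 gm_lt_gp gamo_C1 betao_C1 kp_cont km_cont lp_cont lm_cont
  gam1p_exp gam1m_exp betap_exp betam_exp F_cont alpha_gt0 F_mono.
have lpN : {within closure Omega, continuous (\- lp)}.
  by apply/subspace_continuousP => x cx; exact: cvgN (within_cvg lp_cont cx).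
have lmN : {within closure Omega, continuous (\- lm)}.
  by apply/subspace_continuousP => x cx; exact: cvgN (within_cvg lm_cont cx).
have [eB [CB [eB0 CB0 HB]]] := apriori_upper Omega_open Omega_bounded Omega_nonempty
  Omega_C1 nu_normal gp_C1 gm_C1 gm_lt_gp gamo_C1 (C1N betao_C1) kp_cont km_cont lpN lmN
  gam1p_exp gam1m_exp (reflect_first_order betap_exp) (reflect_first_order betam_exp)
  (reflect_op_cont F_cont) alpha_gt0 (reflect_op_mono F_mono).
have cO := closure_compact Omega_bounded.
have cOI : compact (closure Omega `*` `[-1, 1] : set ('rV[R]_N * R)).
  by apply: compact_setX => //; exact: segment_compact.
have [Gp Gp0 HGp] := within_continuous_bounded cOI gam1p_cont.
have [Gm Gm0 HGm] := within_continuous_bounded cOI gam1m_cont.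
have [Dp Dp0 HDp] := continuous_bounded cO (continuous_grad gp_C1).
have [Dm Dm0 HDm] := continuous_bounded cO (continuous_grad gm_C1).
pose Gam := Gp + Gm; pose G1 := Dp + Dm.
(* eps * S < 1 keeps the directions of [strict_compare] off the graphs, whose
   slopes are of order eps, at the corners too. *)
pose S := N%:R * G1 * (1 + N%:R * Gam + Gam).
have Gam0 : 0 < Gam by rewrite addr_gt0.
have S0 : 0 <= S.
  have Gam0' := ltW Gam0; have G10 : 0 <= G1 by rewrite ltW// addr_gt0.
  have H := mulr_ge0 (ler0n R N) Gam0'.
  apply: mulr_ge0; [exact: mulr_ge0|by clear -H Gam0'; lra].
have Hgam x y : closure Omega x -> y \in `[-1, 1] ->
    `|gam1p x y| <= Gam /\ `|gam1m x y| <= Gam.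
  move=> cx yI; have := HGp (x, y) (conj cx yI); have := HGm (x, y) (conj cx yI).
  by rewrite /Gam /= => H1 H2; clear -H1 H2 Gp0 Gm0; split; lra.
have Hg x : closure Omega x -> `|grad gp x| <= G1 /\ `|grad gm x| <= G1.
  by move=> cx; have := HDp x cx; have := HDm x cx; rewrite /G1 => H1 H2;
    clear -H1 H2 Dp0 Dm0; split; lra.
pose e1 := Num.min (Num.min (eps0 / 2) (S + 1)^-1) (Num.min eA eB).
have S1 : 0 < S + 1 by rewrite ltr_wpDl.
exists e1, (CA + CB); split.
- by rewrite !lt_min divr_gt0// invr_gt0 S1 eA0.
- apply: le_lt_trans (_ : eps0 / 2 < _); first by rewrite !ge_min lexx.
  by rewrite ltr_pdivrMr// ltr_pMr// ltr1n.
- by rewrite addr_gt0.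
move=> eps /andP[eps_gt0]; rewrite !lt_min => /andP[/andP[ee0 eS] /andP[eeA eeB]].
have eps_lt0 : eps < eps0.
  by apply: lt_trans ee0 _; rewrite ltr_pdivrMr// ltr_pMr// ltr1n.
have epsS : eps * S < 1.
  apply: (@le_lt_trans _ _ (eps * (S + 1))); first by rewrite ler_wpM2l ?(ltW eps_gt0)// lerDl.
  by rewrite -ltr_pdivlMr// div1r.
have eps_adm : 0 < eps < eps0 by rewrite eps_gt0.
have [unitK' _ _] := eps0_adm eps eps_adm.
set K := closure (thin Omega gp gm eps) in unitK'.
have unitK z : K z -> ypart z \in `[-1, 1] by move=> /unitK'[].
have upper u (M : R) : (forall z, K z -> `|u z| <= M) ->
    subsol_above K (strict_super Omega nu gp gm eps gam1p gam1m F betap betam) 0 u ->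
    forall z, K z -> usc_env K u z <= CA + CB.
  move=> uM Hu z Kz; apply: (@le_trans _ _ CA); last by rewrite lerDl ltW.
  exact: (HA eps eps_gt0 eeA unitK u M uM Hu z Kz).
have lower u (M : R) : (forall z, K z -> `|u z| <= M) ->
    supersol_below K (strict_sub Omega nu gp gm eps gam1p gam1m F betap betam) 0 u ->
    forall z, K z -> - (CA + CB) <= lsc_env K u z.
  move=> uM /supersol_reflect; rewrite oppr0 => Hu z Kz.
  have NuM t : K t -> `|(\- u) t| <= M by move=> Kt; rewrite normrN; exact: uM.
  have := HB eps eps_gt0 eeB unitK (\- u) M NuM Hu z Kz.
  rewrite lsc_envE /= lerN2 => H; apply: le_trans H _; rewrite lerDr; exact: ltW.
split; last first.
  move=> u [[ub usub] [_ usup]].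
  have [M uM] : exists M : R, forall z, K z -> `|u z| <= M.
    have [M [_ HM]] := ub; exists (M + 1) => z Kz.
    by apply: (HM (M + 1)) => //; rewrite ltrDl.
  have NuM t : K t -> `|(\- u) t| <= M by move=> Kt; rewrite normrN; exact: uM.
  have H1 := upper u M uM (fun phi z cphi Kz zm _ =>
    (not_strict_super _ _ _ _ _ _ _ _ _ _ _ _ _).2 (usub phi z cphi Kz zm)).
  have H2 := lower u M uM (fun phi z cphi Kz zm _ =>
    (not_strict_sub _ _ _ _ _ _ _ _ _ _ _ _ _).2 (usup phi z cphi Kz zm)).
  apply: ge_ereal_sup => _ [z Kz <-]; rewrite lee_fin ler_norml.
  rewrite (le_trans _ (H1 z Kz) : u z <= _) ?andbT; last exact: (le_usc_env uM Kz).
  apply: le_trans (H2 z Kz) _.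
  rewrite lsc_envE lerNl; exact: (@le_usc_env _ _ K (\- u) M NuM z Kz).
have cK : compact K by exact: closure_thin_compact.
have CAB : 0 < CA + CB by rewrite addr_gt0.
have [u [M [uM Hsub Hsup]]] := @perron R _ K
  (strict_super Omega nu gp gm eps gam1p gam1m F betap betam)
  (strict_sub Omega nu gp gm eps gam1p gam1m F betap betam) cK
  (strict_super_stable Omega_C1 nu_normal gp_C1 gm_C1 gam1p_cont gam1m_cont unitK F_cont
     betap_cont betam_cont)
  (strict_sub_stable Omega_C1 nu_normal gp_C1 gm_C1 gam1p_cont gam1m_cont unitK F_cont
     betap_cont betam_cont)
  (fun psi phi z r => strict_compare Omega_open Omega_bounded Omega_C1 nu_normal gp_C1
     gm_C1 gm_lt_gp eps_gt0 unitK F_mono Hgam Hg epsS)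
  (CA + CB) CAB upper lower.
have ub : [bounded u z | z in K].
  exists M; split; first exact: num_real.
  by move=> t Mt z Kz; apply: le_trans (uM z Kz) (ltW Mt).
exists u; split; split=> // v phi z cphi Kz zm.
  exact: (not_strict_super _ _ _ _ _ _ _ _ _ _ _ _ _).1 (Hsub phi z cphi Kz zm).
exact: (not_strict_sub _ _ _ _ _ _ _ _ _ _ _ _ _).1 (Hsup phi z cphi Kz zm).
Qed.
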